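(* Let $d\ge 2$ and suppose the spontaneous magnetization is non-vanishing for some infinite-volume ground state. Then the transverse correlation $\omega_0(S_x^{(2)}S_y^{(2)})$ does not decay as $|\omega_0(S_x^{(2)}S_y^{(2)})|=o(|x-y|^{-(d-1)})$, i.e. it is not true that $|x-y|^{d-1}|\omega_0(S_x^{(2)}S_y^{(2)})|\to 0$ as $|x-y|\to\infty$.
   Context: Fix $d\ge 1$ and a spin magnitude $S\in\{1/2,1,\dots\}$; at each $x\in\mathbb{Z}^d$ spin-$S$ operators $S_x^{(1)},S_x^{(2)},S_x^{(3)}$ on $\mathbb{C}^{2S+1}$ with $[S_x^{(1)},S_x^{(2)}]=iS_x^{(3)}$ and cyclic permutations; quasi-local algebra built from $\mathfrak{A}_\Gamma=\bigotimes_{x\in\Gamma}M_{2S+1}(\mathbb{C})$, $\mathfrak{A}_{\rm loc}=\bigcup_\Gamma\mathfrak{A}_\Gamma$. For a positive integer $L$, $\Lambda=\Lambda_L=\{-L+1,\dots,L\}^d$ with periodic boundary conditions; $H_{0,{\rm p}}^{(\Lambda)}=\sum_{\{x,y\}\subset\Lambda:|x-y|=1}\mathbf{S}_x\cdot\mathbf{S}_y$, $O^{(\Lambda)}=\sum_{x\in\Lambda}(-1)^{x^{(1)}+\cdots+x^{(d)}}S_x^{(3)}$, $H_{\rm p}^{(\Lambda)}(B)=H_{0,{\rm p}}^{(\Lambda)}-BO^{(\Lambda)}$. Let $P_0^{(\Lambda)}(B)$ be the projection onto the ground-state space of $H_{\rm p}^{(\Lambda)}(B)$ and $\omega_B^{(\Lambda)}(\cdot)={\rm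 Tr}[P_0^{(\Lambda)}(B)(\cdot)]/{\rm Tr}P_0^{(\Lambda)}(B)$. Define $\omega_0={\rm weak}^\ast\text{-}\lim_{B\searrow 0}{\rm weak}^\ast\text{-}\lim_{L\to\infty}\omega_B^{(\Lambda_L)}$ (along suitable subsequences). A state $\omega$ is an infinite-volume ground state if $\lim_{L\to\infty}\omega(a^\ast[H_{0,{\rm p}}^{(\Lambda_L)},a])\ge0$ for all $a\in\mathfrak{A}_{\rm loc}$; its spontaneous magnetization is $\lim_{N\to\infty}\sup_{|\Lambda_L|\ge N}\frac{1}{|\Lambda_L|}\omega(O^{(\Lambda_L)})$. *)

(* Defs.v *)
From HB Require Import structures.
From mathcomp Require Import all_boot all_order all_algebra.
From mathcomp Require Import complex.
From mathcomp Require Import reals sequences.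

Set Implicit Arguments.
Unset Strict Implicit.
Unset Printing Implicit Defensive.

Import Order.TTheory GRing.Theory Num.Theory.
Local Open Scope ring_scope.

(*  - n = 2S (n >= 1), single-site space C^(n+1), basis k : 'I_n.+1 with      *)
(*    S^(3)-eigenvalue m_k = S - k.                                           *)
(*  - Boxes are indexed by m : nat with L = m.+1, so that                     *)
(*    Lam_L = {-L+1,...,L}^d = {-m,...,m+1}^d.  A site of the box is          *)
(*    b : {ffun 'I_d -> 'I_(2m+2)} with integer coordinates b i - m.          *)
(*  - Operators on the box are (2S+1)^|Lam| square matrices indexed by the    *)
(*    configurations Cfg m = {ffun Box m -> 'I_n.+1} (tensor-product basis).  *)
(*  - The quasi-local algebra is the union of the box algebras (every finite  *)
(*    region lies in some box); a state is a consistent family of states on   *)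
(*    the box algebras (this is the same as a state on the C*-inductive       *)
(*    limit), weak* convergence is convergence on every local observable.     *)

Section Defs.
Variable R : realType.
Local Notation C := R[i].
Variables (n d : nat).

Definition cvgC (u : nat -> C) (l : C) : Prop :=
  forall eps : R, 0 < eps -> exists N : nat, forall k, (N <= k)%N ->
    `|u k - l| < eps%:C%C.

Definition cvgR (u : nat -> R) (l : R) : Prop :=
  forall eps : R, 0 < eps -> exists N : nat, forall k, (N <= k)%N ->
    `|u k - l| < eps.

Definition spin_m (k : 'I_n.+1) : C := (n%:R - 2 * k%:R) / 2.
(* <k|S^+|k+1> = sqrt((k+1)(n-k)) *)
Definition spin_c (k : nat) : C := (Num.sqrt (((k.+1) * (n - k))%N%:R : R))%:C%C.

Definition spin3 (k l : 'I_n.+1) : C := if k == l then spin_m k else 0.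
Definition spin1 (k l : 'I_n.+1) : C :=
  (if (l : nat) == k.+1 then spin_c k
   else if (k : nat) == l.+1 then spin_c l else 0) / 2.
Definition spin2 (k l : 'I_n.+1) : C :=
  (if (l : nat) == k.+1 then spin_c k
   else if (k : nat) == l.+1 then - spin_c l else 0) / (2 * 'i%C).

Definition spin (a : 'I_3) : 'I_n.+1 -> 'I_n.+1 -> C :=
  if (a : nat) == 0%N then spin1 else if (a : nat) == 1%N then spin2 else spin3.

Definition Pt := 'I_d -> int.
Definition Box (m : nat) := {ffun 'I_d -> 'I_(m.*2.+2)}.
Definition pt (m : nat) (b : Box m) : Pt := fun i => (b i)%:Z - m%:Z.
Definition box_of (m : nat) (x : Pt) : Box m :=
  [ffun i => inord (absz (x i + m%:Z))].
Definition inbox (m : nat) (x : Pt) : bool :=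
  [forall i, (- m%:Z <= x i) && (x i <= m%:Z + 1)].

Definition adjp (m : nat) (b c : Box m) : bool :=
  [exists i, [&& (((b i).+1 %% m.*2.+2)%N == c i) || (((c i).+1 %% m.*2.+2)%N == b i)
             & [forall j, (j != i) ==> (b j == c j)]]].

Definition Cfg (m : nat) := {ffun Box m -> 'I_n.+1}.
Definition Op (m : nat) := 'M[C]_(#|{: Cfg m}|).

Definition mkop (m : nat) (f : Cfg m -> Cfg m -> C) : Op m :=
  \matrix_(i, j) f (enum_val i) (enum_val j).

Definition adj_op (m : nat) (A : Op m) : Op m := map_mx (fun z => z^*%C) A^T.

Definition siteop (m : nat) (a : 'I_3) (x : Box m) : Op m :=
  mkop (fun s t : Cfg m => spin a (s x) (t x) *
          (if [forall y, (y != x) ==> (s y == t y)] then 1 else 0)).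

Definition S1 m x := @siteop m (inord 0) x.
Definition S2 m x := @siteop m (inord 1) x.
Definition S3 m x := @siteop m (inord 2) x.

Definition dotS (m : nat) (x y : Box m) : Op m :=
  \sum_(a < 3) (siteop a x *m siteop a y).

(* H_{0,p}: sum over unordered periodic nearest-neighbour pairs {x,y}
   = half the sum over ordered pairs *)
Definition H0p (m : nat) : Op m :=
  2^-1 *: \sum_(x : Box m) \sum_(y : Box m | adjp x y) dotS x y.

Definition stag (m : nat) (x : Box m) : C :=
  (-1) ^+ (odd (absz (\sum_(i < d) pt x i))).

Definition Ostag (m : nat) : Op m := \sum_(x : Box m) stag x *: S3 x.

Definition Hp (m : nat) (B : R) : Op m := H0p m - B%:C%C *: Ostag m.

(* embedding A in 𝔄_{Lam(m0)} into 𝔄_{Lam(m)} (A ⊗ 1), meaningful for m0 <= m *)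
Definition restr (m0 m : nat) (s : Cfg m) : Cfg m0 :=
  [ffun b0 : Box m0 => s (box_of m (pt b0))].
Definition embed (m0 m : nat) (A : Op m0) : Op m :=
  mkop (fun s t : Cfg m =>
    A (enum_rank (restr m0 s)) (enum_rank (restr m0 t)) *
    (if [forall b : Box m, inbox m0 (pt b) || (s b == t b)] then 1 else 0)).

Definition is_gs_proj (N : nat) (H P : 'M[C]_N) : Prop :=
  P *m P = P /\ map_mx (fun z => z^*%C) P^T = P /\
  exists E0 : C, eigenvalue H E0 /\ (forall e, eigenvalue H e -> E0 <= e) /\
    forall v : 'cV[C]_N, P *m v = v <-> H *m v = E0 *: v.

Definition State := forall m : nat, Op m -> C.

Definition is_state (w : State) : Prop :=
  (forall m (c : C) (A B : Op m), w m (c *: A + B) = c * w m A + w m B) /\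
  (forall m (A : Op m), 0 <= w m (adj_op A *m A)) /\
  (forall m, w m 1%:M = 1) /\
  (forall m0 m (A : Op m0), (m0 <= m)%N -> w m (embed m A) = w m0 A).

Definition is_inf_gs (w : State) : Prop :=
  is_state w /\
  forall m0 (a : Op m0), exists l : C, 0 <= l /\
    cvgC (fun m => let A := embed m a in
                   w m (adj_op A *m (H0p m *m A - A *m H0p m))) l.

Definition mag_seq (w : State) (m : nat) : R :=
  complex.Re (w m (Ostag m)) / (#|{: Box m}|)%:R.
Definition spont_mag (w : State) : R := limn_sup (mag_seq w).

Definition fin_val (m0 m : nat) (P : Op m) (A : Op m0) : C :=
  if (m0 <= m)%N then \tr (P *m embed m A) / \tr P else 0.

Definition is_fv_limit (B : R) (w : State) : Prop :=
  exists phi : nat -> nat, (forall j, (phi j < phi j.+1)%N) /\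
  exists P : forall m, Op m, (forall m, is_gs_proj (Hp m B) (P m)) /\
  forall m0 (A : Op m0), cvgC (fun j => fin_val (P (phi j)) A) (w m0 A).

Definition is_omega0 (w0 : State) : Prop :=
  exists (Bs : nat -> R) (ws : nat -> State),
    (forall k, 0 < Bs k) /\ cvgR Bs 0 /\
    (forall k, is_fv_limit (Bs k) (ws k)) /\
    (forall m (A : Op m), cvgC (fun k => ws k m A) (w0 m A)).

Definition lev (x y : Pt) : nat := \max_(i < d) (absz (x i) + absz (y i))%N.

Definition corr2 (w : State) (x y : Pt) : C :=
  let m := lev x y in w m (S2 (box_of m x) *m S2 (box_of m y)).

Definition distZ (x y : Pt) : R :=
  Num.sqrt (\sum_(i < d) ((x i - y i)%:~R : R) ^+ 2).

End Defs.

(* Main.v *)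
(* A Goldstone argument for ground states.  Write O = sum eta_x S3_x, let <.>
   be the ground state on a torus with field B > 0, let g be a test function,
   A = sum over bonds of (g_x + g_y) (S1_x + S1_y) = sum F_x S1_x, and
   T = sum eta_x b_x S2_x.

   - Reflection positivity gives Gaussian domination
     H - t A + t^2 G >= E_0 with G = sum over bonds of (g_x + g_y)^2 / 2, and
     testing it on perturbations of the ground state gives
     <A^2>^2 <= G <[A, [H, A]]> / 2, where the double commutator is at most of
     order sum (F_x - F_y)^2 + B sum F_x^2.
   - The uncertainty relation for A and T, whose commutator is
     i sum F_x b_x eta_x S3_x, bounds (<O> / |box|)^4 (sum F_x b_x)^4 by
     <A^2>^2 <T^2>^2.
   - If g is a pyramid of height 2r over a box of 4r points a side and b the
     indicator of its support, and B <= r^-2, all powers of r cancel exactly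
     when <T^2> is of order r^(d+1).  The assumed decay makes it smaller.
   - The magnetisation <O> / |box| stays bounded below as B -> 0 after the
     thermodynamic limit: an infinite-volume ground state with magnetisation
     delta has a large tile carrying a magnetisation delta / 2; replacing it on
     that tile by the ground state of H - B O costs only a boundary term, while
     the field energy is of the order of the volume. *)

(* Reflection positivity and averaging over translations need the torus, whereas the decay is
   assumed for the limit state. This dictates the order of choices: the decay fixes a scale r; then
   comes a field B below r^-2; last comes a volume, allowed to depend on B, so large that the
   finitely many correlations inside a box of side 4r are close to their limits and that the
   boundary cost is small against the field energy.

   The test operator couples to the sums g_x + g_y because the rotation by pi about the second axis
   on one sublattice reverses S1 and S3 there. It makes the staggered field uniform and turns these
   sums into differences, which is what completing the square on a bond produces. A rotated bond is
   minus a sum of products of equal factors built from S1, i S2 and S3, which are real matrices;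
   this is the sign that reflection positivity requires.

   The pyramid has size r but steps of order 1, so the exchange part of the double commutator is
   only of order r^d, and the field part, of order B r^2 r^d, is no larger. Gaussian domination
   controls S1 while the decay concerns S2; the uncertainty relation links the two. *)
Require Import Defs.
From HB Require Import structures.
From mathcomp Require Import all_boot all_order all_algebra.
From mathcomp Require Import complex ring lra zify.
From mathcomp Require Import reals sequences.
Set Implicit Arguments.
Unset Strict Implicit.
Unset Printing Implicit Defensive.
Import Order.TTheory GRing.Theory Num.Theory.
Local Open Scope ring_scope.

(** * Complex matrices *)

(* Definitions sealed by an opaque proof: a failing unification between large
   operator expressions must not unfold them. *)
Lemma seal (T : Type) (x : T) : {y : T | y = x}.
Proof. by exists x. Qed.

Section ComplexMatrices.
Variable R : rcfType.
Local Notation C := R[i].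

Definition dag_def m n (A : 'M[C]_(m, n)) : 'M[C]_(n, m) :=
  map_mx (fun z => z^*%C) A^T.
Lemma dag_sealed m n : {f | f = @dag_def m n}.
Proof. exact: seal. Qed.
Definition dag {m n} : 'M[C]_(m, n) -> 'M[C]_(n, m) :=
  sval (dag_sealed m n).

Lemma dag_unseal m n (A : 'M[C]_(m, n)) :
  dag A = map_mx (fun z => z^*%C) A^T.
Proof. exact: (congr1 (fun f => f A) (svalP (dag_sealed m n))). Qed.

Lemma addmxE m n (A B : 'M[C]_(m, n)) i j : (A + B) i j = A i j + B i j.
Proof. by rewrite mxE. Qed.

Lemma oppmxE m n (A : 'M[C]_(m, n)) i j : (- A) i j = - A i j.
Proof. by rewrite mxE. Qed.

Lemma scalemxE m n a (A : 'M[C]_(m, n)) i j : (a *: A) i j = a * A i j.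
Proof. by rewrite mxE. Qed.

Definition entE := (addmxE, oppmxE, scalemxE).

Lemma dagE m n (A : 'M[C]_(m, n)) i j : dag A i j = (A j i)^*%C.
Proof. by rewrite dag_unseal !mxE. Qed.

Lemma dagK m n (A : 'M[C]_(m, n)) : dag (dag A) = A.
Proof. by apply/matrixP => i j; rewrite !dagE conjcK. Qed.

Lemma dagM m n p (A : 'M[C]_(m, n)) (B : 'M[C]_(n, p)) :
  dag (A *m B) = dag B *m dag A.
Proof. by rewrite !dag_unseal trmx_mul (map_mxM (@conjc R)). Qed.

Lemma dagD m n (A B : 'M[C]_(m, n)) : dag (A + B) = dag A + dag B.
Proof. by apply/matrixP => i j; rewrite !(dagE, mxE) rmorphD. Qed.

Lemma dagN m n (A : 'M[C]_(m, n)) : dag (- A) = - dag A.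
Proof. by apply/matrixP => i j; rewrite !(dagE, mxE) rmorphN. Qed.

Lemma dagZ m n (a : C) (A : 'M[C]_(m, n)) : dag (a *: A) = a^*%C *: dag A.
Proof. by apply/matrixP => i j; rewrite !(dagE, mxE) rmorphM. Qed.

Lemma dag0 m n : dag (0 : 'M[C]_(m, n)) = 0.
Proof. by apply/matrixP => i j; rewrite !(dagE, mxE) rmorph0. Qed.

Lemma dag1 n : dag (1%:M : 'M[C]_n) = 1%:M.
Proof. by apply/matrixP => i j; rewrite !(dagE, mxE) rmorph_nat eq_sym. Qed.

Lemma dag_sum m n I (r : seq I) (P : pred I) (F : I -> 'M[C]_(m, n)) :
  dag (\sum_(i <- r | P i) F i) = \sum_(i <- r | P i) dag (F i).
Proof.
apply: (big_morph _ (@dagD m n) (@dag0 m n)).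
Qed.

Lemma mxtrace_dag n (A : 'M[C]_n) : \tr (dag A) = (\tr A)^*%C.
Proof. by rewrite rmorph_sum; apply: eq_bigr => i _; rewrite dagE. Qed.

Lemma ReD (x y : C) : complex.Re (x + y) = complex.Re x + complex.Re y.
Proof. by case: x y => [? ?] [? ?]. Qed.

Lemma ReN (x : C) : complex.Re (- x) = - complex.Re x.
Proof. by case: x. Qed.

Lemma ReZ (r : R) (x : C) : complex.Re (r%:C%C * x) = r * complex.Re x.
Proof. by case: x => [? ?] /=; rewrite mul0r subr0. Qed.

Lemma Re_sum I (r : seq I) (P : pred I) (F : I -> C) :
  complex.Re (\sum_(i <- r | P i) F i) = \sum_(i <- r | P i) complex.Re (F i).
Proof. by apply: (big_morph _ ReD). Qed.

Lemma Re_conj (x : C) : complex.Re x^*%C = complex.Re x.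
Proof. by case: x. Qed.

Lemma Re_ge0 (x : C) : 0 <= x -> 0 <= complex.Re x.
Proof. by rewrite lecE => /andP[]. Qed.

Lemma mxtrace_dag_mul_ge0 m n (A : 'M[C]_(m, n)) : 0 <= \tr (dag A *m A).
Proof.
apply: sumr_ge0 => i _; rewrite !mxE; apply: sumr_ge0 => j _.
by rewrite dagE mulrC mulcJ_ge0.
Qed.

Lemma hermitian_diagonalization n (A : 'M[C]_n) : dag A = A ->
  exists (U : 'M[C]_n) (d : 'I_n -> R),
    [/\ dag U *m U = 1%:M, U *m dag U = 1%:M &
        A = dag U *m diag_mx (\row_i (d i)%:C%C) *m U].
Proof.
move=> hA; have hA' : A \is hermsymmx.
  by apply/is_hermitianmxP; rewrite expr0 scale1r -{1}hA dag_unseal.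
have UU : spectralmx A *m dag (spectralmx A) = 1%:M.
  by rewrite dag_unseal; apply/unitarymxP/spectral_unitarymx.
have UU' : dag (spectralmx A) *m spectralmx A = 1%:M by apply: mulmx1C.
exists (spectralmx A), (fun i => complex.Re (spectral_diag A 0 i)); split => //.
have iU : invmx (spectralmx A) = dag (spectralmx A).
  rewrite dag_unseal; exact: invmx_unitary (spectral_unitarymx A).
have /hermitian_normalmx /orthomx_spectralP {1}-> := hA'.
rewrite iU; congr (_ *m diag_mx _ *m _).
apply/rowP => i; rewrite !mxE RRe_real //.
by have /mxOverP := hermitian_spectral_diag_real hA'; apply.
Qed.

(** In the eigenbasis the trace is a sum of |Y_ij|^2 with weights e_i e_j, so replacing every
    eigenvalue by its modulus can only increase it. *)
Lemma mxtrace_conj_diag n (U X : 'M[C]_n) (e : 'I_n -> R) :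
    dag U *m U = 1%:M ->
  let Z := dag U *m diag_mx (\row_i (e i)%:C%C) *m U in
  let Y := U *m X *m dag U in
  complex.Re (\tr (Z *m X *m Z *m dag X))
    = \sum_i \sum_j e i * e j * complex.Re (Y i j * (Y i j)^*%C).
Proof.
move=> UU Z Y; set D := diag_mx _ in Z *.
have -> : Z *m X *m Z *m dag X
    = dag U *m (D *m Y *m D *m dag Y *m U).
  rewrite /Z /Y !dagM dagK; move: D {Z} => D; rewrite !mulmxA.
  by rewrite -[in RHS](mulmxA _ (dag U) U) UU mulmx1.
rewrite mxtrace_mulC -[X in \tr X]mulmxA (mulmx1C UU) mulmx1.
rewrite /mxtrace Re_sum; apply: eq_bigr => i _.
rewrite mxE Re_sum; apply: eq_bigr => j _.
rewrite dagE mul_mx_diag mxE mul_diag_mx !mxE.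
rewrite -ReZ rmorphM; congr complex.Re; ring.
Qed.

Lemma conj_mul n (U A B : 'M[C]_n) : U *m dag U = 1%:M ->
  (dag U *m A *m U) *m (dag U *m B *m U) = dag U *m (A *m B) *m U.
Proof. by move=> UU; rewrite -!mulmxA (mulmxA U) UU mul1mx. Qed.

(* The modulus of the Hermitian dilation [[0, c], [c^*, 0]] commutes with
   diag(1, -1), because conjugation by the latter changes the sign of the
   dilation; its diagonal blocks are |c^*| and |c|. *)
Lemma matrix_reflection n (c : 'M[C]_n) : exists Z1 Z2 : 'M[C]_n,
  [/\ dag Z1 = Z1, dag Z2 = Z2, Z1 *m Z1 = c *m dag c, Z2 *m Z2 = dag c *m c &
   forall X Y : 'M[C]_n, 2 * complex.Re (\tr (dag c *m X *m c *m dag Y)) <=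
     complex.Re (\tr (Z1 *m X *m Z1 *m dag X)) +
     complex.Re (\tr (Z2 *m Y *m Z2 *m dag Y))].
Proof.
pose simb := (mulmx0, mul0mx, mul1mx, mulmx1, mulNmx, mulmxN, addr0, add0r,
  opprK, oppr0).
have dag_block (a b e f : 'M[C]_n) :
    dag (block_mx a b e f) = block_mx (dag a) (dag e) (dag b) (dag f).
  by rewrite !dag_unseal tr_block_mx map_block_mx.
have mul_dd (a b e f : 'M[C]_n) :
    block_mx a 0 0 b *m block_mx e 0 0 f = block_mx (a *m e) 0 0 (b *m f).
  by rewrite mulmx_block !(mulmx0, mul0mx) !addr0 !add0r.
have mul_od (a b e f : 'M[C]_n) :
    block_mx 0 a b 0 *m block_mx e 0 0 f = block_mx 0 (a *m f) (b *m e) 0.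
  by rewrite mulmx_block !(mulmx0, mul0mx) !addr0 !add0r.
have mul_oo (a b e f : 'M[C]_n) :
    block_mx 0 a b 0 *m block_mx 0 e f 0 = block_mx (a *m f) 0 0 (b *m e).
  by rewrite mulmx_block !(mulmx0, mul0mx) !addr0 !add0r.
have [c2 c2b] : exists c2 : 'M[C]_(n + n), c2 = block_mx 0 c (dag c) 0 by eexists.
have hc2 : dag c2 = c2 by rewrite c2b dag_block dagK !dag0.
have [U [d [UU UU' c2E]]] := hermitian_diagonalization hc2.
have [D DE] : exists D : ('I_(n + n) -> R) -> 'M[C]_(n + n),
  forall e, D e = diag_mx (\row_i (e i)%:C%C) by eexists.
rewrite -DE in c2E.
pose Z := dag U *m D (fun i => `|d i|) *m U.
pose J : 'M[C]_(n + n) := block_mx 1%:M 0 0 (- 1%:M).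
have JJ : J *m J = 1%:M.
  by rewrite /J mulmx_block !simb -scalar_mx_block.
have Jc : J *m c2 = - c2 *m J.
  by rewrite /J c2b opp_block_mx !mulmx_block !simb.
have hD e : dag (D e) = D e.
  rewrite DE; apply/matrixP => i j; rewrite !(dagE, mxE) eq_sym.
  by case: eqP => [->|_]; rewrite ?mulr1n ?mulr0n ?rmorph0 // conjc_real.
have hZ : dag Z = Z by rewrite /Z !dagM dagK hD mulmxA.
have ZZ : Z *m Z = c2 *m c2.
  rewrite c2E /Z (conj_mul (D d) _ UU') (conj_mul (D _) _ UU').
  congr (_ *m _ *m _); rewrite !DE !mulmx_diag; congr diag_mx; apply/rowP => i; rewrite !mxE.
  by rewrite -!rmorphM -normrM ger0_norm // -expr2 sqr_ge0.
(* In the eigenbasis of the dilation, J becomes Q, which intertwines d with -d: a nonzero Q_ij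
   forces d_j = - d_i, hence |d_j| = |d_i|, so Q commutes with the moduli. *)
have JZ : J *m Z = Z *m J.
  have [Q QE] : exists Q, U *m J *m dag U = Q by eexists.
  have JE : J = dag U *m Q *m U by rewrite -QE !mulmxA UU mul1mx -mulmxA UU mulmx1.
  have QD : Q *m D d = - D d *m Q.
    rewrite -QE; transitivity (U *m (J *m c2) *m dag U).
      by rewrite c2E !mulmxA -[RHS]mulmxA UU' mulmx1.
    by rewrite Jc c2E !mulNmx mulmxN mulNmx !mulmxA UU' mul1mx.
  rewrite JE /Z !(conj_mul _ _ UU'); congr (_ *m _ *m _).
  apply/matrixP => i j; have /matrixP/(_ i j) := QD.
  rewrite !DE mulNmx [in X in _ = X]mxE !mul_mx_diag !mul_diag_mx !mxE => e.
  have [->|Q0] := eqVneq (Q i j) 0; first by rewrite mulr0 mul0r.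
  rewrite mulrC; congr (_ * _); move: e; rewrite -mulNr mulrC.
  move=> /(mulIf Q0); rewrite -rmorphN => /complexI ->.
  by rewrite normrN.
pose Z1 := ulsubmx Z; pose Z2 := drsubmx Z.
have Zb : Z = block_mx Z1 0 0 Z2.
  have := JZ; rewrite -[Z]submxK /J !mulmx_block !simb.
  move=> /eq_block_mx[_ e1 e2 _].
  have e0 (a : 'M[C]_n) : a = - a -> a = 0.
    move=> e; apply/matrixP => i j; have /matrixP/(_ i j) := e.
    by rewrite !mxE => /eqP; rewrite eq_sym eqNr => /eqP.
  by rewrite (e0 _ e1) (e0 (dlsubmx Z)) // -[in LHS]e2 .
have hb : dag Z1 = Z1 /\ dag Z2 = Z2.
  by move: hZ; rewrite Zb dag_block => /eq_block_mx[].
have [z1 z2] : Z1 *m Z1 = c *m dag c /\ Z2 *m Z2 = dag c *m c.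
  move: ZZ; rewrite Zb c2b !mulmx_block !simb.
  by move=> /eq_block_mx[].
case: hb => h1 h2; exists Z1, Z2; split; [exact: h1|exact: h2|exact: z1|exact: z2|] => X Y.
pose W := block_mx X 0 0 Y.
have dW : dag W = block_mx (dag X) 0 0 (dag Y) by rewrite dag_block !dag0.
have := mxtrace_conj_diag W d UU; rewrite /= -DE -c2E => e1.
have := mxtrace_conj_diag W (fun i => `|d i|) UU; rewrite /= -DE -/Z => e2.
have le12 : complex.Re (\tr (c2 *m W *m c2 *m dag W)) <=
    complex.Re (\tr (Z *m W *m Z *m dag W)).
  rewrite e1 e2; apply: ler_sum => i _; apply: ler_sum => j _.
  apply: ler_wpM2r; first by apply/Re_ge0/mulcJ_ge0.
  by rewrite -normrM ler_norm.
have eZ : \tr (Z *m W *m Z *m dag W) =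
    \tr (Z1 *m X *m Z1 *m dag X) + \tr (Z2 *m Y *m Z2 *m dag Y).
  rewrite Zb dW !mul_dd.
  by rewrite mxtrace_block.
have ec : \tr (c2 *m W *m c2 *m dag W) =
    \tr (c *m Y *m dag c *m dag X) + \tr (dag c *m X *m c *m dag Y).
  rewrite c2b dW !mul_od mul_oo mul_dd.
  by rewrite mxtrace_block.
move: le12; rewrite eZ ec !ReD; apply: le_trans; rewrite le_eqVlt; apply/orP; left.
(* The two mixed terms are complex conjugates of each other; this is the origin of the factor 2. *)
have -> : \tr (c *m Y *m dag c *m dag X) = (\tr (dag c *m X *m c *m dag Y))^*%C.
  rewrite -mxtrace_dag !dagM !dagK !mulmxA mxtrace_mulC !mulmxA.
  by rewrite -[in RHS]mulmxA [in RHS]mxtrace_mulC !mulmxA.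
by rewrite Re_conj mulr_natl mulr2n.
Qed.

(** The form inequality A >= e. The number e need not be attained, so that bounds of different
    operators can be averaged. *)
Definition lower_bound n (A : 'M[C]_n) (e : R) : Prop :=
  forall v : 'cV[C]_n,
    e * complex.Re (\tr (dag v *m v)) <= complex.Re (\tr (dag v *m A *m v)).

Lemma mxtrace_dag_conj n (A : 'M[C]_n) (w : 'cV[C]_n) (d : 'I_n -> R)
    (U : 'M[C]_n) (v : 'cV[C]_n) :
    A = dag U *m diag_mx (\row_i (d i)%:C%C) *m U -> w = U *m v ->
  complex.Re (\tr (dag v *m A *m v))
    = \sum_i d i * complex.Re (w i 0 * (w i 0)^*%C).
Proof.
move=> -> wE; set D := diag_mx _.
have -> : dag v *m (dag U *m D *m U) *m v = dag w *m D *m w.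
  by rewrite wE dagM; move: D => D; rewrite !mulmxA.
rewrite mxtrace_mulC /mxtrace Re_sum; apply: eq_bigr => i _.
rewrite mxE big_ord1 /D mul_mx_diag mxE dagE !mxE.
by rewrite mulrA mulrC ReZ.
Qed.

Lemma mxtrace_dag_norm n (v : 'cV[C]_n) :
  complex.Re (\tr (dag v *m v)) = \sum_i complex.Re (v i 0 * (v i 0)^*%C).
Proof.
rewrite mxtrace_mulC /mxtrace Re_sum; apply: eq_bigr => i _.
by rewrite mxE big_ord1 dagE.
Qed.

Lemma mxtrace_unitary n (U : 'M[C]_n) (v : 'cV[C]_n) : dag U *m U = 1%:M ->
  \tr (dag (U *m v) *m (U *m v)) = \tr (dag v *m v).
Proof. by move=> UU; rewrite dagM -mulmxA (mulmxA _ U v) UU mul1mx. Qed.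

Lemma hermitian_minimum n (A : 'M[C]_n) : (0 < n)%N -> dag A = A ->
  exists (e : R) (v : 'cV[C]_n),
    [/\ lower_bound A e, v != 0 & A *m v = e%:C%C *: v].
Proof.
case: n A => // n A _ hA.
have [U [d [UU UU' AE]]] := hermitian_diagonalization hA.
case: (@Order.TotalTheory.arg_minP _ _ _ ord0 predT d) => // i _ mini.
exists (d i), (dag U *m delta_mx i 0); split.
- move=> v; rewrite (mxtrace_dag_conj AE (erefl _)).
  rewrite -(mxtrace_unitary v UU) mxtrace_dag_norm mulr_sumr.
  by apply: ler_sum => j _; rewrite ler_wpM2r ?mini ?Re_ge0 ?mulcJ_ge0.
- apply/eqP => /(congr1 (mulmx U)); rewrite mulmxA UU' mul1mx mulmx0.
  by move=> /matrixP/(_ i 0)/eqP; rewrite !mxE !eqxx oner_eq0.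
- rewrite AE -!mulmxA (mulmxA U) UU' mul1mx scalemxAr; congr (_ *m _).
  apply/matrixP => j k; rewrite mul_diag_mx !mxE.
  by case: eqP => [->|_]; rewrite ?mulr0.
Qed.

(** X is the square root of the positive matrix A - e, up to a unitary. This transports an operator
    inequality to a functional that is only known to be nonnegative on the products [dag X *m X]. *)
Lemma lower_bound_factor n (A : 'M[C]_n) (e : R) :
  dag A = A -> lower_bound A e -> 
  exists X : 'M[C]_n, A - e%:C%C%:M = dag X *m X.
Proof.
move=> hA lA; have [U [d [UU UU' AE]]] := hermitian_diagonalization hA.
have le_ed i : e <= d i.
  have := lA (dag U *m delta_mx i 0); rewrite (mxtrace_dag_conj AE (erefl _)).
  rewrite mxtrace_unitary ?dagK // mxtrace_dag_norm mulmxA UU' mul1mx.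
  rewrite (bigD1 i) //= big1 ?addr0; last first.
    by move=> j ji; rewrite !mxE (negPf ji) mul0r.
  rewrite (bigD1 i) //= big1 ?addr0; last first.
    by move=> j ji; rewrite !mxE (negPf ji) mul0r mulr0.
  by rewrite !mxE !eqxx conjc_nat -natrM [complex.Re _]/(1 : R) !mulr1.
pose D := diag_mx (\row_i (Num.sqrt (d i - e))%:C%C) : 'M[C]_n.
exists (D *m U).
have hD : dag D = D.
  apply/matrixP => i j; rewrite !(dagE, mxE) eq_sym.
  by case: eqP => [->|_]; rewrite ?mulr1n ?mulr0n ?rmorph0 // conjc_real.
have -> : e%:C%C%:M = dag U *m diag_mx (\row_i e%:C%C) *m U.
  have -> : diag_mx (\row_i e%:C%C) = e%:C%C%:M :> 'M[C]_n.
    by rewrite -diag_const_mx; congr diag_mx; apply/rowP => i; rewrite !mxE.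
  by rewrite mul_mx_scalar -scalemxAl UU scalemx1.
rewrite AE -mulmxBl -mulmxBr dagM hD mulmxA -(mulmxA _ D D).
congr (_ *m _ *m _); rewrite /D mulmx_diag; apply/matrixP => i j.
rewrite !mxE; case: eqP => [->|_]; rewrite ?mulr1n ?mulr0n ?subr0 //.
by rewrite -rmorphM -expr2 sqr_sqrtr ?rmorphB // subr_ge0.
Qed.

Lemma discriminant_le (a b c : R) :
  (forall x y : R, 0 <= x ^+ 2 * a + x * y * b + y ^+ 2 * c) ->
  b ^+ 2 <= 4 * a * c.
Proof.
move=> h.
have a0 : 0 <= a by have := h 1 0; lra.
have c0 : 0 <= c by have := h 0 1; lra.
have [c1|c1] := eqVneq c 0; last first.
  have {}c1 : 0 < c by rewrite lt_def c1.
  (* Up to scale, the point where the form is least in y. *)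
  have := h (2 * c) (- b).
  have -> : (2 * c) ^+ 2 * a + 2 * c * - b * b + (- b) ^+ 2 * c
     = c * (4 * a * c - b ^+ 2) by ring.
  by rewrite pmulr_rge0 // subr_ge0.
(* For c = 0 the form is x^2 a + x y b, and at this point its value is - b^2. *)
have := h b (- (a + 1)); rewrite c1 => h'.
have {}h' : 0 <= - b ^+ 2 by move: h'; congr (0 <= _); ring.
by rewrite mulr0; lra.
Qed.

(** The limit r -> 0 without topology: if u < 0, half of the zero of u + r w is a counterexample. *)
Lemma ge0_limit (u w : R) : (forall r, 0 < r -> 0 <= u + r * w) -> 0 <= u.
Proof.
move=> h; rewrite leNgt; apply/negP => u0.
have := h 1 ltr01; rewrite mul1r => h1.
have w0 : 0 < w by lra.
have := h (- u / (2 * w)); rewrite divr_gt0 ?mulr_gt0 ?oppr_gt0 // => /(_ isT).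
have -> : - u / (2 * w) * w = - u / 2 by field; lra.
lra.
Qed.

(* The real part of a state: only real parts of expectations are estimated. *)
Definition is_rstate n (f : 'M[C]_n -> R) : Prop :=
  [/\ forall A B, f (A + B) = f A + f B,
      forall (r : R) A, f (r%:C%C *: A) = r * f A,
      forall A : 'M[C]_n, 0 <= f (dag A *m A) & f 1%:M = 1].

Section RealState.
Variables (n : nat) (f : 'M[C]_n -> R).
Hypothesis hf : is_rstate f.

Lemma rstateD A B : f (A + B) = f A + f B. Proof. by case: hf. Qed.
Lemma rstateZ (r : R) (A : 'M[C]_n) : f (r%:C%C *: A) = r * f A. Proof. by case: hf. Qed.
Lemma rstate_ge0 (A : 'M[C]_n) : 0 <= f (dag A *m A). Proof. by case: hf. Qed.
Lemma rstate1 : f 1%:M = 1. Proof. by case: hf. Qed.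

Lemma rstateN (A : 'M[C]_n) : f (- A) = - f A.
Proof.
have -> : - A = (- 1)%:C%C *: A by rewrite rmorphN1 scaleN1r.
by rewrite rstateZ mulN1r.
Qed.

Lemma rstateB (A B : 'M[C]_n) : f (A - B) = f A - f B.
Proof. by rewrite rstateD rstateN. Qed.

Lemma rstate0 : f 0 = 0.
Proof. by rewrite -(subrr 0) rstateB subrr. Qed.

Lemma rstate_sum I (r : seq I) (P : pred I) (F : I -> 'M[C]_n) :
  f (\sum_(i <- r | P i) F i) = \sum_(i <- r | P i) f (F i).
Proof. exact: (big_morph _ rstateD rstate0). Qed.

Lemma rstate_herm_sqr_ge0 (A : 'M[C]_n) : dag A = A -> 0 <= f (A *m A).
Proof. by move=> hA; rewrite -{1}hA rstate_ge0. Qed.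

Lemma rstate_lower_bound (A : 'M[C]_n) e : dag A = A -> lower_bound A e -> e <= f A.
Proof.
move=> hA /(lower_bound_factor hA) [X AE]; rewrite -subr_ge0.
have <- : f (A - e%:C%C%:M) = f A - e.
  by rewrite rstateB -scalemx1 rstateZ rstate1 mulr1.
by rewrite AE rstate_ge0.
Qed.

(** Positivity on x A + i y B for all real x and y, followed by the discriminant. The factor i makes
    the commutator Hermitian, so its real part carries all the information. *)
Lemma rstate_uncertainty (A B : 'M[C]_n) : dag A = A -> dag B = B ->
  f ('i%C *: (A *m B - B *m A)) ^+ 2 <= 4 * f (A *m A) * f (B *m B).
Proof.
move=> hA hB; apply: discriminant_le => x y.
have := rstate_ge0 (x%:C%C *: A + (y%:C%C * 'i%C) *: B).
have ii : 'i%C * 'i%C = -1 :> C by rewrite -expr2 sqr_i.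
have -> : dag (x%:C%C *: A + (y%:C%C * 'i%C) *: B)
    = x%:C%C *: A - (y%:C%C * 'i%C) *: B.
  rewrite dagD !dagZ hA hB conjc_real -scaleNr; congr (_ + _ *: _).
  by apply/eqP; rewrite eq_complex /= !(mulr0, mul0r, subr0, oppr0) !eqxx.
rewrite mulmxBl !mulmxDr -!scalemxAl -!scalemxAr !scalerA.
have -> : y%:C%C * 'i%C * (y%:C%C * 'i%C) = (- y ^+ 2)%:C%C :> C.
  by rewrite mulrACA ii -rmorphM mulrN1 -rmorphN.
have -> : y%:C%C * 'i%C * x%:C%C = (x * y)%:C%C * 'i%C :> C.
  by rewrite rmorphM; ring.
have -> : x%:C%C * (y%:C%C * 'i%C) = (x * y)%:C%C * 'i%C :> C.
  by rewrite rmorphM; ring.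
rewrite -rmorphM -!scalerA scalerBr !(rstateD, rstateB, rstateN, rstateZ).
by congr (0 <= _); ring.
Qed.

(* Linear response: testing the lower bound on the perturbed vectors
   (1 + s A) Omega, to second order in (s, t). *)
Lemma rstate_gaussian_domination (H A : 'M[C]_n) (E G : R) :
    dag H = H -> dag A = A ->
    (forall X, f (H *m X) = E * f X) -> (forall X, f (X *m H) = E * f X) ->
    (forall t : R, lower_bound (H - t%:C%C *: A + (t ^+ 2 * G)%:C%C%:M) E) ->
  f (A *m A) ^+ 2 <= G * (f (A *m H *m A) - E * f (A *m A)).
Proof.
move=> hH hA fH fH' lbE; set D := _ - _.
(* Positivity of H - t A + t^2 G - E, written as [dag X *m X], on the perturbation 1 + s A. *)
have key (s t : R) : 0 <= s ^+ 2 * D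
    - t * (f A + 2 * s * f (A *m A) + s ^+ 2 * f (A *m A *m A))
    + t ^+ 2 * G * (1 + 2 * s * f A + s ^+ 2 * f (A *m A)).
  have hY : dag (H - t%:C%C *: A + (t ^+ 2 * G)%:C%C%:M)
      = H - t%:C%C *: A + (t ^+ 2 * G)%:C%C%:M.
    by rewrite !(dagD, dagN, dagZ) -scalemx1 dagZ dag1 !conjc_real hH hA.
  have [X YE] := lower_bound_factor hY (lbE t).
  pose r := t ^+ 2 * G - E.
  have {}YE : dag X *m X = H + ((- t)%:C%C *: A + r%:C%C *: 1%:M).
    by rewrite -YE /r rmorphN scaleNr rmorphB scalemx1 raddfB !addrA.
  have fX (P Q : 'M[C]_n) : f (P *m (dag X *m X) *m Q)
      = f (P *m H *m Q) - t * f (P *m A *m Q) + r * f (P *m Q).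
    rewrite YE !mulmxDr -!scalemxAr mulmx1 !mulmxDl -!scalemxAl.
    by rewrite !rstateD !rstateZ mulNr addrA.
  have lin (P1 P2 P3 P4 : 'M[C]_n) (q : R) :
      f (P1 + s%:C%C *: P2 + (s%:C%C *: P3 + q%:C%C *: P4))
    = f P1 + s * f P2 + (s * f P3 + q * f P4).
    by rewrite !rstateD !rstateZ.
  have := rstate_ge0 (X *m (1%:M + s%:C%C *: A)).
  have -> : dag (X *m (1%:M + s%:C%C *: A)) *m (X *m (1%:M + s%:C%C *: A))
    = dag X *m X + s%:C%C *: (A *m (dag X *m X))
      + (s%:C%C *: ((dag X *m X) *m A)
         + (s ^+ 2)%:C%C *: (A *m (dag X *m X) *m A)).
    rewrite dagM mulmxA -(mulmxA _ (dag X)); move: (dag X *m X) => Y.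
    rewrite dagD dag1 dagZ conjc_real hA mulmxDl (mul1mx Y) -(scalemxAl _ A).
    rewrite mulmxDr mulmx1 -scalemxAr mulmxDl -scalemxAl scalerDr scalerA.
    have <- : (s ^+ 2)%:C%C = s%:C%C * s%:C%C :> C by rewrite -rmorphM.
    exact: erefl.
  rewrite lin.
  have := fX 1%:M 1%:M; rewrite !mul1mx !mulmx1 => ->.
  have := fX A 1%:M; rewrite !mulmx1 => ->.
  have := fX 1%:M A; rewrite !mul1mx => ->.
  rewrite fX fH !fH' rstate1.
  have -> : f H = E by rewrite -[H]mulmx1 fH rstate1 mulr1.
  by congr (0 <= _); rewrite /D /r; ring.
(* With s and t both scaled by the square root of r, adding the inequalities for (s, t) and (-s, -t)
   cancels the odd terms; dividing by r and letting r -> 0 leaves the form x^2 D - 2 x y f(A^2) +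
   y^2 G. *)
have D4 : (- 2 * f (A *m A)) ^+ 2 <= 4 * D * G.
  apply: discriminant_le => x y.
  apply: (@ge0_limit _ (x ^+ 2 * y ^+ 2 * G * f (A *m A))) => r r0.
  have := key (Num.sqrt r * x) (Num.sqrt r * y).
  have := key (- (Num.sqrt r * x)) (- (Num.sqrt r * y)).
  have := sqr_sqrtr (ltW r0); set q := Num.sqrt r => q2 k1 k2.
  rewrite -(pmulr_rge0 _ r0) -q2.
  move: (addr_ge0 k1 k2); rewrite -(pmulr_rge0 _ (ltr0Sn R 1)).
  move=> h; rewrite -(pmulr_rge0 _ (ltr0Sn R 3)).
  by apply: le_trans h _; rewrite le_eqVlt; apply/orP; left; apply/eqP; ring.
by move: D4; lra.
Qed.

End RealState.

End ComplexMatrices.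

(** * Operators on spin configurations *)

Section Kernels.
Variables (R : rcfType) (T : finType).
Local Notation C := R[i].
Implicit Types A B : 'M[C]_#|T|.

Definition ker A (s t : T) : C := A (enum_rank s) (enum_rank t).
Definition mk_def (f : T -> T -> C) : 'M[C]_#|T| :=
  \matrix_(i, j) f (enum_val i) (enum_val j).
Lemma mk_sealed : {f | f = mk_def}.
Proof. exact: seal. Qed.
Definition mk : (T -> T -> C) -> 'M[C]_#|T| := sval mk_sealed.

Lemma mk_unseal f : mk f = \matrix_(i, j) f (enum_val i) (enum_val j).
Proof. exact: (congr1 (fun g => g f) (svalP mk_sealed)). Qed.

Lemma kerP A B : (forall s t, ker A s t = ker B s t) -> A = B.
Proof.
move=> h; apply/matrixP => i j.
by have := h (enum_val i) (enum_val j); rewrite /ker !enum_valK.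
Qed.

Lemma ker_mk f s t : ker (mk f) s t = f s t.
Proof. by rewrite /ker mk_unseal mxE !enum_rankK. Qed.

Lemma kerM A B s t : ker (A *m B) s t = \sum_u ker A s u * ker B u t.
Proof.
rewrite /ker mxE (reindex enum_rank) //=.
exact: (onW_bij _ (enum_rank_bij T)).
Qed.

Lemma kerD A B s t : ker (A + B) s t = ker A s t + ker B s t.
Proof. by rewrite /ker mxE. Qed.

Lemma kerN A s t : ker (- A) s t = - ker A s t.
Proof. by rewrite /ker mxE. Qed.

Lemma kerZ a A s t : ker (a *: A) s t = a * ker A s t.
Proof. by rewrite /ker mxE. Qed.

Lemma ker0 s t : ker 0 s t = 0.
Proof. by rewrite /ker mxE. Qed.

Lemma ker1 s t : ker 1%:M s t = (s == t)%:R.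
Proof. by rewrite /ker mxE (inj_eq enum_rank_inj). Qed.

Lemma ker_dag A s t : ker (dag A) s t = (ker A t s)^*%C.
Proof. by rewrite /ker dagE. Qed.

Lemma mxtrace_ker A : \tr A = \sum_s ker A s s.
Proof.
rewrite /mxtrace (reindex enum_rank) //=.
exact: (onW_bij _ (enum_rank_bij T)).
Qed.

End Kernels.

(** * Embedding operators along maps of sites *)

Section Embedding.
Variables (R : rcfType) (n : nat).
Local Notation C := R[i].
Local Notation cfg V := {ffun V -> 'I_n.+1}.
Local Notation op V := 'M[C]_#|{: cfg V}|.

Definition pull (V W : finType) (tau : V -> W) (s : cfg W) : cfg V :=
  [ffun v => s (tau v)].

Definition eqoff (V W : finType) (tau : V -> W) (s t : cfg W) : bool :=
  [forall y, (y \in codom tau) || (s y == t y)].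

(** A on the image of [tau], tensored with the identity elsewhere. For a bijection this is the
    action of a permutation of the sites, so one construction serves for inclusions of boxes, tiles,
    halves of a reflected lattice, translations and reflections. *)
Definition emb_def (V W : finType) (tau : V -> W) (A : op V) : op W :=
  mk (fun s t => ker A (pull tau s) (pull tau t) * (eqoff tau s t)%:R).
Lemma emb_sealed (V W : finType) : {f | f = @emb_def V W}.
Proof. exact: seal. Qed.
Definition emb (V W : finType) : (V -> W) -> op V -> op W :=
  sval (emb_sealed V W).

Definition glue (V W : finType) (tau : V -> W) (a : cfg V) (s : cfg W) :
    cfg W :=
  [ffun y => if [pick v | tau v == y] is Some v then a v else s y].

Lemma ker_emb (V W : finType) (tau : V -> W) (A : op V) s t :
  ker (emb tau A) s t = ker A (pull tau s) (pull tau t) * (eqoff tau s t)%:R.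
Proof.
have -> : emb tau A = emb_def tau A.
  exact: (congr1 (fun g => g tau A) (svalP (emb_sealed V W))).
exact: ker_mk.
Qed.

Lemma glue_off (V W : finType) (tau : V -> W) (a : cfg V) (s : cfg W) y :
  y \notin codom tau -> glue tau a s y = s y.
Proof.
move=> yN; rewrite ffunE; case: pickP => // v /eqP vy.
by rewrite -vy codom_f in yN.
Qed.

Lemma eqoffP (V W : finType) (tau : V -> W) (s t : cfg W) :
  reflect (forall y, y \notin codom tau -> s y = t y) (eqoff tau s t).
Proof.
apply: (iffP forallP) => h y; first by have := h y; case: (y \in _) => //= /eqP.
by case: (boolP (y \in _)) => //= /h ->.
Qed.

Lemma emb_eq (V W : finType) (tau sig : V -> W) (A : op V) : tau =1 sig ->
  emb tau A = emb sig A.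
Proof.
move=> ts; apply: kerP => s t; rewrite !ker_emb.
have e u : pull tau u = pull sig u by apply/ffunP => v; rewrite !ffunE ts.
rewrite !e; congr (_ * _%:R); congr nat_of_bool; apply: eq_forallb => y.
by rewrite (eq_codom ts).
Qed.

Lemma embD (V W : finType) (tau : V -> W) (A B : op V) :
  emb tau (A + B) = emb tau A + emb tau B.
Proof. by apply: kerP => s t; rewrite !(ker_emb, kerD) mulrDl. Qed.

Lemma embZ (V W : finType) (tau : V -> W) a (A : op V) :
  emb tau (a *: A) = a *: emb tau A.
Proof. by apply: kerP => s t; rewrite !(ker_emb, kerZ) mulrA. Qed.

Lemma embN (V W : finType) (tau : V -> W) (A : op V) :
  emb tau (- A) = - emb tau A.
Proof. by apply: kerP => s t; rewrite !(ker_emb, kerN) mulNr. Qed.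

Lemma embB (V W : finType) (tau : V -> W) (A B : op V) :
  emb tau (A - B) = emb tau A - emb tau B.
Proof. by rewrite embD embN. Qed.

Lemma emb0 (V W : finType) (tau : V -> W) : emb tau 0 = 0.
Proof. by apply: kerP => s t; rewrite !(ker_emb, ker0) mul0r. Qed.

Lemma emb_sum (V W : finType) (tau : V -> W) I (r : seq I) (P : pred I)
    (F : I -> op V) :
  emb tau (\sum_(i <- r | P i) F i) = \sum_(i <- r | P i) emb tau (F i).
Proof. exact: (big_morph _ (@embD _ _ _) (@emb0 _ _ _)). Qed.

Lemma eqoff_sym (V W : finType) (tau : V -> W) (s t : cfg W) :
  eqoff tau s t = eqoff tau t s.
Proof. by apply: eq_forallb => y; rewrite eq_sym. Qed.

Lemma emb_dag (V W : finType) (tau : V -> W) (A : op V) :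
  emb tau (dag A) = dag (emb tau A).
Proof.
apply: kerP => s t; rewrite ker_dag !ker_emb ker_dag rmorphM eqoff_sym.
by rewrite [X in _ = _ * X]conjc_nat.
Qed.

Lemma emb1 (V W : finType) (tau : V -> W) : emb tau (1%:M : op V) = 1%:M.
Proof.
apply: kerP => s t; rewrite ker_emb !ker1 -natrM mulnb; congr _%:R.
congr nat_of_bool; apply/andP/eqP => [[/eqP e /eqoffP h]|->]; last first.
  by split=> //; apply/eqoffP.
apply/ffunP => y; have [/codomP[v ->]|/h //] := boolP (y \in codom tau).
by have /ffunP/(_ v) := e; rewrite !ffunE.
Qed.

Section Injective.
Variables (V W : finType) (tau : V -> W).
Hypothesis tau_inj : injective tau.

Lemma glue_on a s v : glue tau a s (tau v) = a v.
Proof.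
rewrite ffunE; case: pickP => [w /eqP /tau_inj -> //|].
by move=> /(_ v); rewrite eqxx.
Qed.

Lemma pull_glue a s : pull tau (glue tau a s) = a.
Proof. by apply/ffunP => v; rewrite ffunE glue_on. Qed.

Lemma eqoff_glue a s t : eqoff tau (glue tau a s) t = eqoff tau s t.
Proof.
apply/eqoffP/eqoffP => h y yN; have := h y yN; by rewrite glue_off.
Qed.

Lemma glue_pull s t : eqoff tau s t -> glue tau (pull tau t) s = t.
Proof.
move=> /eqoffP h; apply/ffunP => y.
have [/codomP[v ->]|yN] := boolP (y \in codom tau).
  by rewrite glue_on ffunE.
by rewrite glue_off // h.
Qed.

Lemma sum_eqoff (F : cfg W -> C) s :
  \sum_(u | eqoff tau s u) F u = \sum_a F (glue tau a s).
Proof.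
rewrite (reindex_onto (fun a => glue tau a s) (pull tau)); last first.
  by move=> u /glue_pull.
apply: eq_bigl => a; rewrite pull_glue eqxx andbT eqoff_sym eqoff_glue.
exact/eqoffP.
Qed.

Lemma embM (A B : op V) : emb tau (A *m B) = emb tau A *m emb tau B.
Proof.
apply: kerP => s t; rewrite kerM ker_emb kerM mulr_suml.
rewrite (eq_bigr (fun u => if eqoff tau s u then ker A (pull tau s) (pull tau u)
   * ker B (pull tau u) (pull tau t) * (eqoff tau u t)%:R else 0)); last first.
  move=> u _; rewrite !ker_emb; case: ifP => _; last by rewrite mulr0 mul0r.
  by rewrite mulr1 mulrA.
rewrite -big_mkcond sum_eqoff; apply: eq_bigr => a _.
by rewrite !pull_glue eqoff_glue.
Qed.

End Injective.

Lemma emb_comp (U V W : finType) (sig : U -> V) (tau : V -> W) (A : op U) :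
  injective tau -> emb tau (emb sig A) = emb (tau \o sig) A.
Proof.
move=> ti; apply: kerP => s t; rewrite !ker_emb -mulrA -natrM mulnb.
have e u : pull sig (pull tau u) = pull (tau \o sig) u.
  by apply/ffunP => v; rewrite !ffunE.
rewrite !e; congr (_ * _%:R); congr nat_of_bool.
apply/andP/eqoffP => [[/eqoffP h1 /eqoffP h2] y yN|h].
  have [/codomP[v yv]|/h2 //] := boolP (y \in codom tau).
  have := h1 v; rewrite !ffunE yv; apply; apply: contra yN => /codomP[w vw].
  by rewrite yv vw; apply/codomP; exists w.
split; apply/eqoffP => y yN; last first.
  by apply: h; apply: contra yN => /codomP[w ->]; exact: (codom_f tau (sig w)).
rewrite !ffunE; apply: h; apply: contra yN => /codomP[w /= /ti ->].
exact: codom_f.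
Qed.

(** Only one intermediate configuration contributes, so the kernel of the product factorises. The
    resulting formula is symmetric in the two operators, which gives their commutation. *)
Lemma ker_emb_disjoint (V V' W : finType) (tau : V -> W) (sig : V' -> W)
    (A : op V) (B : op V') s t :
    injective tau -> injective sig -> (forall v v', tau v != sig v') ->
  ker (emb tau A *m emb sig B) s t = ker A (pull tau s) (pull tau t) *
    ker B (pull sig s) (pull sig t) *
    [forall y, [|| y \in codom tau, y \in codom sig | s y == t y]]%:R.
Proof.
move=> ti si ts; rewrite kerM.
have offs v' : sig v' \notin codom tau.
  by apply/negP => /codomP[v /eqP]; rewrite eq_sym (negPf (ts _ _)).
have offt v : tau v \notin codom sig.
  by apply/negP => /codomP[v' /eqP]; rewrite (negPf (ts _ _)).
(* The intermediate configuration: already t on the image of [tau], still s elsewhere. *)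
pose u0 := glue tau (pull tau t) s.
have pu0 : pull sig u0 = pull sig s.
  by apply/ffunP => v; rewrite [LHS]ffunE [RHS]ffunE glue_off.
rewrite (bigD1 u0) //= big1 ?addr0; last first.
  move=> u uu0; rewrite !ker_emb; case: (boolP (eqoff tau s u)) => e1; last first.
    by rewrite mulr0 mul0r.
  case: (boolP (eqoff sig u t)) => e2; last by rewrite !mulr0.
  case/eqP: uu0; rewrite /u0 -{1}(glue_pull ti e1); congr glue.
  by apply/ffunP => v; rewrite !ffunE; have /eqoffP -> := e2.
rewrite !ker_emb pu0 /u0 (pull_glue ti) eqoff_sym eqoff_glue.
have -> : eqoff tau s s by exact/eqoffP.
rewrite mulr1 mulrA; congr (_ * _%:R); congr nat_of_bool.
apply/eqoffP/forallP => h y; last first.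
  move=> yN; have [/codomP[v ->]|yN'] := boolP (y \in codom tau).
    by rewrite glue_on // ffunE.
  by rewrite glue_off //; have := h y; rewrite (negPf yN') (negPf yN) /= => /eqP.
case: (boolP (y \in codom tau)) => //= yt.
by case: (boolP (y \in codom sig)) => //= /h; rewrite glue_off // => ->.
Qed.

Lemma emb_commute (V V' W : finType) (tau : V -> W) (sig : V' -> W)
    (A : op V) (B : op V') :
    injective tau -> injective sig -> (forall v v', tau v != sig v') ->
  emb tau A *m emb sig B = emb sig B *m emb tau A.
Proof.
move=> ti si ts; apply: kerP => s t; rewrite !ker_emb_disjoint //; last first.
  by move=> v v'; rewrite eq_sym.
congr (_ * _%:R); first by rewrite mulrC.
by congr nat_of_bool; apply: eq_forallb => y; rewrite orbCA.
Qed.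

Lemma mxtrace_emb_bij (V : finType) (tau : V -> V) (A : op V) :
  injective tau -> \tr (emb tau A) = \tr A.
Proof.
move=> ti; rewrite !mxtrace_ker [RHS](reindex (pull tau)) /=; last first.
  have [g tg gt] := injF_bij ti.
  exists (pull g) => s _; apply/ffunP => v; rewrite !ffunE ?gt ?tg //.
apply: eq_bigr => s _; rewrite ker_emb.
by have -> : eqoff tau s s; [exact/eqoffP|rewrite mulr1].
Qed.

(** A one-site operator is an embedding along a map from a point, so that the rules for embeddings
    apply to it. *)
Definition sop_def (V : finType) (x : V) (M : 'M[C]_n.+1) : op V :=
  emb (fun _ : unit => x) (mk (fun s t : cfg unit => M (s tt) (t tt))).
Lemma sop_sealed (V : finType) : {f | f = @sop_def V}.
Proof. exact: seal. Qed.
Definition sop (V : finType) : V -> 'M[C]_n.+1 -> op V :=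
  sval (sop_sealed V).

Lemma sop_unseal (V : finType) (x : V) (M : 'M[C]_n.+1) : sop x M =
  emb (fun _ : unit => x) (mk (fun s t : cfg unit => M (s tt) (t tt))).
Proof. exact: (congr1 (fun g => g x M) (svalP (sop_sealed V))). Qed.

Lemma unit_inj (V : finType) (x : V) : injective (fun _ : unit => x).
Proof. by move=> [] []. Qed.

Lemma ker_sop (V : finType) (x : V) M (s t : cfg V) :
  ker (sop x M) s t = M (s x) (t x) * [forall y, (y != x) ==> (s y == t y)]%:R.
Proof.
rewrite sop_unseal ker_emb ker_mk !ffunE; congr (_ * _%:R); congr nat_of_bool.
apply: eq_forallb => y; rewrite implybE negbK; congr (_ || _).
by apply/codomP/eqP => [[? ->]//|->]; exists tt.
Qed.

Lemma emb_sop (V W : finType) (tau : V -> W) x M : injective tau ->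
  emb tau (sop x M) = sop (tau x) M.
Proof. by move=> ti; rewrite !sop_unseal emb_comp. Qed.

Lemma sopM (V : finType) (x : V) (M N : 'M[C]_n.+1) :
  sop x (M *m N) = sop x M *m sop x N.
Proof.
rewrite !sop_unseal -embM; last exact: unit_inj.
congr emb; apply: kerP => s t; rewrite ker_mk kerM mxE.
rewrite [RHS](reindex (fun k => [ffun _ : unit => k])) /=; last first.
  exists (fun s : cfg unit => s tt) => [k _|u _]; first by rewrite ffunE.
  by apply/ffunP => -[]; rewrite ffunE.
by apply: eq_bigr => k _; rewrite !ker_mk ffunE.
Qed.

Lemma sopD (V : finType) (x : V) (M N : 'M[C]_n.+1) :
  sop x (M + N) = sop x M + sop x N.
Proof. by apply: kerP => s t; rewrite kerD !ker_sop mxE mulrDl. Qed.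

Lemma sopZ (V : finType) (x : V) a (M : 'M[C]_n.+1) :
  sop x (a *: M) = a *: sop x M.
Proof. by apply: kerP => s t; rewrite kerZ !ker_sop mxE mulrA. Qed.

Lemma sopN (V : finType) (x : V) (M : 'M[C]_n.+1) : sop x (- M) = - sop x M.
Proof. by apply: kerP => s t; rewrite kerN !ker_sop mxE mulNr. Qed.

Lemma sopB (V : finType) (x : V) (M N : 'M[C]_n.+1) :
  sop x (M - N) = sop x M - sop x N.
Proof. by rewrite sopD sopN. Qed.

Lemma sop1 (V : finType) (x : V) : sop x 1%:M = 1%:M.
Proof.
rewrite !sop_unseal -[RHS](emb1 (fun _ : unit => x)); congr emb.
apply: kerP => s t; rewrite ker_mk ker1 mxE; congr (nat_of_bool _)%:R.
by apply/eqP/eqP => [e|-> //]; apply/ffunP => -[].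
Qed.

Lemma sop_dag (V : finType) (x : V) (M : 'M[C]_n.+1) :
  sop x (dag M) = dag (sop x M).
Proof.
rewrite !sop_unseal -emb_dag; congr emb.
by apply: kerP => s t; rewrite ker_dag !ker_mk dagE.
Qed.

Lemma sop_commute (V : finType) (x y : V) (M N : 'M[C]_n.+1) : x != y ->
  sop x M *m sop y N = sop y N *m sop x M.
Proof.
by move=> xy; rewrite !sop_unseal; apply: emb_commute => //; exact: unit_inj.
Qed.

Lemma emb_sop_commute (V W : finType) (tau : V -> W) (A : op V) (y : W) N :
    injective tau -> y \notin codom tau ->
  emb tau A *m sop y N = sop y N *m emb tau A.
Proof.
move=> ti yN; rewrite sop_unseal; apply: emb_commute => //; first exact: unit_inj.
by move=> v _; apply: contraNneq yN => <-; rewrite codom_f.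
Qed.

End Embedding.

(** The relation between [S1, S2] and [S^+, S^-], isolated from the matrices: x and y are the ladder
    operators, h = 1/2 and z = i. *)
Lemma ladder_commutator (F : fieldType) N (x y : 'M[F]_N) (z h : F) :
    2 * h = 1 ->
  (h *: (x + y)) *m ((- z * h) *: (x - y)) -
  ((- z * h) *: (x - y)) *m (h *: (x + y)) = z *: (h *: (x *m y - y *m x)).
Proof.
move=> h2; rewrite -!scalemxAl -!scalemxAr !mulmxDl !mulmxDr !mulmxN !mulNmx.
move: (x *m x) (x *m y) (y *m x) (y *m y) => a b c d.
by apply/matrixP => k l; rewrite !mxE -[RHS]mul1r -h2; ring.
Qed.

(** * Spin matrices and their relations *)

Section SpinMatrices.
Variables (R : realType) (n : nat).
Local Notation C := R[i].
Local Notation M := 'M[C]_n.+1.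

Definition s1 : M := \matrix_(k, l) spin1 R k l.
Definition s2 : M := \matrix_(k, l) spin2 R k l.
Definition s3 : M := \matrix_(k, l) spin3 R k l.
(** S(S+1) with n = 2S. *)
Definition casimir : R := (n * n.+2)%:R / 4.

(** The raising operator; its transpose [q] is the lowering operator, as the ladder coefficients are
    real. *)
Let p : M := \matrix_(k, l) (if (l : nat) == k.+1 then spin_c R n k else 0).
Let q : M := p^T.

Lemma ii : 'i%C * 'i%C = -1 :> C.
Proof. by rewrite -expr2 sqr_i. Qed.

Lemma invr_2i : (2 * 'i%C)^-1 = - 'i%C / 2 :> C.
Proof.
rewrite invfM mulrC; congr (_ * _); apply: (@mulIf _ 'i%C).
  by apply/eqP => /(congr1 (@complex.Im R)) /eqP; rewrite /= oner_eq0.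
rewrite mulNr ii opprK mulVf //.
by apply/eqP => /(congr1 (@complex.Im R)) /eqP; rewrite /= oner_eq0.
Qed.

Lemma s1E : s1 = 2^-1 *: (p + q).
Proof.
apply/matrixP => k l; rewrite !mxE /spin1 mulrC; congr (_ * _).
case: ifP => [/eqP e|]; last by rewrite add0r.
by case: ifP => [/eqP|]; [lia|rewrite addr0].
Qed.

Lemma s2E : s2 = (- 'i%C / 2) *: (p - q).
Proof.
apply/matrixP => k l; rewrite !mxE /spin2 mulrC invr_2i; congr (_ * _).
case: ifP => [/eqP e|]; last by case: ifP; rewrite ?sub0r ?oppr0 ?addr0.
by case: ifP => [/eqP|]; [lia|rewrite subr0].
Qed.

Lemma s3E : s3 = diag_mx (\row_k spin_m R k).
Proof.
apply/matrixP => k l; rewrite !mxE /spin3.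
by case: eqVneq => [->|]; rewrite ?mulr1n ?mulr0n.
Qed.

Lemma conj_spin_c k : (spin_c R n k)^*%C = spin_c R n k.
Proof. exact: conjc_real. Qed.

Lemma spin_cM k : spin_c R n k * spin_c R n k = (k.+1 * (n - k))%:R.
Proof.
rewrite /spin_c -rmorphM -expr2 sqr_sqrtr ?ler0n //.
by rewrite (rmorph_nat (real_complex R)).
Qed.

Lemma pq : p *m q = diag_mx (\row_k ((k.+1 * (n - k))%:R : C)).
Proof.
apply/matrixP => k l; rewrite !mxE.
case: (ltnP k n) => [kn|nk]; last first.
  have ek : (k : nat) = n by have := ltn_ord k; lia.
  rewrite big1; last first.
    move=> j _; rewrite !mxE; case: eqP => [e|]; last by rewrite mul0r.
    by have := ltn_ord j; lia.
  by rewrite ek subnn muln0 mul0rn.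
pose j := Ordinal (kn : (k.+1 < n.+1)%N).
rewrite (bigD1 j) //= big1 ?addr0; last first.
  move=> j' jj'; rewrite !mxE; case: eqP => [e|]; last by rewrite mul0r.
  by case/eqP: jj'; apply: val_inj.
rewrite !mxE /= eqxx eqSS; case: (eqVneq k l) => [<-|kl].
  by rewrite eqxx mulr1n spin_cM.
by rewrite -val_eqE /= in kl; rewrite (negPf kl) mulr0.
Qed.

Lemma qp : q *m p = diag_mx (\row_k ((k * (n.+1 - k))%:R : C)).
Proof.
apply/matrixP => k l; rewrite !mxE.
case: (posnP k) => [k0|k0].
  rewrite big1; last first.
    move=> j _; rewrite !mxE; case: eqP => [e|]; last by rewrite mul0r.
    lia.
  by rewrite k0 mul0n mul0rn.
have kn : (k.-1 < n.+1)%N by have := ltn_ord k; lia.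
pose j := Ordinal kn.
rewrite (bigD1 j) //= big1 ?addr0; last first.
  move=> j' jj'; rewrite !mxE; case: eqP => [e|]; last by rewrite mul0r.
  by case/eqP: jj'; apply: val_inj => /=; lia.
rewrite !mxE /= prednK // eqxx; case: (eqVneq k l) => [<-|kl].
  by rewrite eqxx mulr1n spin_cM prednK //; congr (_ * _)%:R; lia.
by rewrite -val_eqE /= in kl; rewrite eq_sym (negPf kl) mulr0.
Qed.

Lemma s3p : s3 *m p - p *m s3 = p.
Proof.
apply/matrixP => k l; rewrite s3E mul_diag_mx mul_mx_diag !mxE.
case: eqP => [e|]; last by rewrite mulr0 mul0r subr0.
rewrite [_ * spin_m R l]mulrC -mulrBl /spin_m e -[k.+1]addn1 natrD.
rewrite -[RHS]mul1r; congr (_ * _); by field.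
Qed.

Lemma conjM (x y : C) : (x * y)^*%C = x^*%C * y^*%C.
Proof. exact: rmorphM. Qed.

Lemma conjN (x : C) : (- x)^*%C = - x^*%C.
Proof. exact: rmorphN. Qed.

Lemma conjD (x y : C) : (x + y)^*%C = x^*%C + y^*%C.
Proof. exact: rmorphD. Qed.

Lemma conj_half : (2^-1 : C)^*%C = 2^-1.
Proof. by rewrite conjc_inv conjc_nat. Qed.

Lemma conj_i : ('i%C : C)^*%C = - 'i%C.
Proof. by apply/eqP; rewrite eq_complex /= oppr0 !eqxx. Qed.

Lemma conj_if (b : bool) k : (if b then spin_c R n k else 0)^*%C =
  if b then spin_c R n k else 0.
Proof. by case: b; rewrite ?conj_spin_c ?conjc0. Qed.

Lemma s1_herm : dag s1 = s1.
Proof.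
rewrite s1E dagZ dagD conj_half addrC; congr (_ *: (_ + _));
  by apply/matrixP => k l; rewrite dagE !mxE conj_if.
Qed.

Lemma s2_herm : dag s2 = s2.
Proof.
have dp : dag p = q by apply/matrixP => k l; rewrite dagE !mxE conj_if.
rewrite s2E dagZ dagD dagN -dp dagK dp.
rewrite conjM conjN conj_half conj_i opprK -opprB scalerN -scaleNr.
by rewrite mulNr.
Qed.

Lemma conj_spin_m (k : 'I_n.+1) : (spin_m R k)^*%C = spin_m R k :> C.
Proof.
rewrite /spin_m conjM conj_half; congr (_ * _).
by rewrite conjD conjN conjM !conjc_nat.
Qed.

Lemma s3_herm : dag s3 = s3.
Proof.
apply/matrixP => k l; rewrite dagE !mxE /spin3 eq_sym.
by case: eqP => [->|_]; rewrite ?conj_spin_m ?conjc0.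
Qed.

Lemma s3q : s3 *m q - q *m s3 = - q.
Proof.
have := congr1 trmx s3p; rewrite linearB /= !trmx_mul.
have -> : s3^T = s3 by rewrite s3E tr_diag_mx.
by rewrite -/q => e; rewrite -[in RHS]e opprB.
Qed.

Lemma s12 : s1 *m s2 - s2 *m s1 = 'i%C *: s3.
Proof.
have -> : s3 = 2^-1 *: (p *m q - q *m p).
  rewrite pq qp s3E; apply/matrixP => k l; rewrite !mxE.
  case: eqVneq => [->|_]; last by rewrite !mulr0n subr0 mulr0.
  rewrite !mulr1n /spin_m mulrC; congr (_ * _).
  have := ltn_ord l; rewrite ltnS => ln.
  rewrite !natrM !natrB //; last by apply: leq_trans ln _.
  by ring.
by rewrite s1E s2E; apply: ladder_commutator; rewrite mulfV ?pnatr_eq0.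
Qed.

Lemma s31 : s3 *m s1 - s1 *m s3 = 'i%C *: s2.
Proof.
have := s3q; have := s3p; rewrite s1E s2E; move: p q => x y.
rewrite -scalemxAl -scalemxAr mulmxDl mulmxDr.
move: (s3 *m x) (s3 *m y) (x *m s3) (y *m s3) => a b c d e1 e2.
rewrite -scalerBr opprD addrACA e1 e2 scalerA; congr (_ *: _).
by rewrite mulrA mulrN ii opprK mul1r.
Qed.

Lemma spin_casimir : s1 *m s1 + s2 *m s2 + s3 *m s3 = casimir%:C%C%:M.
Proof.
have -> : s1 *m s1 + s2 *m s2 = 2^-1 *: (p *m q + q *m p).
  rewrite s1E s2E; move: p q => x y.
  rewrite -!scalemxAl -!scalemxAr !scalerA !mulmxDl !mulmxDr.
  rewrite !mulmxN !mulNmx.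
  have -> : - 'i%C / 2 * (- 'i%C / 2) = - (2^-1 * 2^-1) :> C.
    by rewrite mulrACA mulrNN ii mulN1r.
  move: (x *m x) (x *m y) (y *m x) (y *m y) => a b c d.
  by apply/matrixP => k l; rewrite !entE; field.
rewrite pq qp s3E mulmx_diag; apply/matrixP => k l; rewrite !mxE.
case: eqVneq => [->|_]; last by rewrite !mulr0n !addr0 mulr0.
rewrite !mulr1n /spin_m /casimir.
have -> : (((n * n.+2)%:R / 4 : R)%:C)%C = (n * n.+2)%:R / 4 :> C.
  rewrite rmorphM (rmorph_nat (real_complex R)); congr (_ * _).
  by rewrite fmorphV (rmorph_nat (real_complex R)).
have := ltn_ord l; rewrite ltnS => ln.
rewrite !natrM !natrB //; last by apply: leq_trans ln _.
by field.
Qed.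

End SpinMatrices.

(** * Gaussian domination *)

Section RealMatrices.
Variable R : rcfType.
Local Notation C := R[i].

(** Reality of the entries, in the form used on a doubled space: the right half acts through Y^T,
    which reality turns into [dag Y]. *)
Definition real_mx {m n} (A : 'M[C]_(m, n)) : Prop := dag A = A^T.

Lemma real_mxD m n (A B : 'M[C]_(m, n)) :
  real_mx A -> real_mx B -> real_mx (A + B).
Proof. by rewrite /real_mx dagD linearD /= => -> ->. Qed.

Lemma real_mxN m n (A : 'M[C]_(m, n)) : real_mx A -> real_mx (- A).
Proof. by rewrite /real_mx dagN linearN /= => ->. Qed.

Lemma real_mxZ m n (r : R) (A : 'M[C]_(m, n)) :
  real_mx A -> real_mx (r%:C%C *: A).
Proof. by rewrite /real_mx dagZ conjc_real linearZ /= => ->. Qed.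

Lemma real_mxM m n p (A : 'M[C]_(m, n)) (B : 'M[C]_(n, p)) :
  real_mx A -> real_mx B -> real_mx (A *m B).
Proof. by rewrite /real_mx dagM trmx_mul => -> ->. Qed.

Lemma real_mx1 n : real_mx (1%:M : 'M[C]_n).
Proof. by rewrite /real_mx dag1 trmx1. Qed.

Lemma real_mx0 m n : real_mx (0 : 'M[C]_(m, n)).
Proof. by rewrite /real_mx dag0 trmx0. Qed.

Lemma real_mx_sum m n I (r : seq I) (P : pred I) (F : I -> 'M[C]_(m, n)) :
  (forall i, P i -> real_mx (F i)) -> real_mx (\sum_(i <- r | P i) F i).
Proof.
by move=> h; elim/big_ind: _ => //; [exact: real_mx0|exact: real_mxD].
Qed.

Lemma real_mx_sop n (V : finType) (x : V) (M : 'M[C]_n.+1) :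
  real_mx M -> real_mx (sop x M).
Proof.
move=> hM; rewrite /real_mx -sop_dag hM; apply: kerP => s t.
have -> : ker (sop x M)^T s t = ker (sop x M) t s by rewrite /ker mxE.
rewrite !ker_sop mxE; congr (_ * (nat_of_bool _)%:R).
by apply: eq_forallb => y; rewrite (eq_sym (s y)).
Qed.

End RealMatrices.

(** * Reflection positivity in matrix form *)

Section ReflectionPositivity.
Variables (R : rcfType) (N : nat) (I : finType).
Local Notation C := R[i].

(* The quadratic form of L (x) 1 + 1 (x) L' - sum_k M_k (x) M'_k on a vector
   of the doubled space, written as a matrix c. *)
Definition doubled_form (c L L' : 'M[C]_N) (M M' : I -> 'M[C]_N) : R :=
  complex.Re (\tr (dag c *m L *m c)) + complex.Re (\tr (dag c *m c *m dag L'))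
  - \sum_k complex.Re (\tr (dag c *m M k *m c *m dag (M' k))).

(** The two symmetric forms are tested on the moduli Z1 and Z2 given by [matrix_reflection]. The
    one-sided terms see only [c *m dag c] and [dag c *m c], which the moduli reproduce, while the
    coupling terms of c are at most the average of those of Z1 and Z2. *)
Lemma doubled_form_reflection (L L' : 'M[C]_N) (M M' : I -> 'M[C]_N) e e' :
    dag L = L -> dag L' = L' ->
    (forall c, e * complex.Re (\tr (dag c *m c)) <= doubled_form c L L M M) ->
    (forall c, e' * complex.Re (\tr (dag c *m c)) <=
      doubled_form c L' L' M' M') ->
  forall c, (e + e') / 2 * complex.Re (\tr (dag c *m c)) <=
    doubled_form c L L' M M'.
Proof.
move=> hL hL' he he' c; have [Z1 [Z2 [h1 h2 z1 z2 hZ]]] := matrix_reflection c.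
have := he Z1; have := he' Z2; rewrite /doubled_form h1 h2 z1 z2 hL hL'.
have -> : \tr (Z2 *m L' *m Z2) = \tr (dag c *m c *m L').
  by rewrite mxtrace_mulC mulmxA z2.
have -> : \tr (Z1 *m L *m Z1) = \tr (c *m dag c *m L).
  by rewrite mxtrace_mulC mulmxA z1.
have -> : \tr (dag c *m L *m c) = \tr (c *m dag c *m L).
  by rewrite mxtrace_mulC mulmxA.
rewrite (mxtrace_mulC c).
have : \sum_k 2 * complex.Re (\tr (dag c *m M k *m c *m dag (M' k))) <=
    \sum_k (complex.Re (\tr (Z1 *m M k *m Z1 *m dag (M k))) +
     complex.Re (\tr (Z2 *m M' k *m Z2 *m dag (M' k)))).
  by apply: ler_sum => k _; exact: hZ.
rewrite -mulr_sumr big_split /=.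
move: (complex.Re (\tr (c *m dag c *m L))) => a1.
move: (complex.Re (\tr (dag c *m c *m L'))) => a2.
move: (complex.Re (\tr (dag c *m c))) => a3.
move: (\sum_k _) (\sum_k _) (\sum_k _) => b1 b2 b3; lra.
Qed.

End ReflectionPositivity.

Lemma mulmx_scale2 (F : comPzRingType) m n p (a : F) (A : 'M[F]_(m, n))
  (B : 'M[F]_(n, p)) : (a *: A) *m (a *: B) = (a * a) *: (A *m B).
Proof. by rewrite -scalemxAl -scalemxAr scalerA. Qed.

Lemma eq_scale_sub (F : pzRingType) m n (a b : F) (X X' Y Y' : 'M[F]_(m, n)) :
  X = X' -> Y = Y' -> a *: X - b *: Y = a *: X' - b *: Y'.
Proof. by move=> -> ->. Qed.

(** * The rotated Hamiltonian in a test field *)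

Section RotatedHamiltonian.
Variables (R : realType) (n : nat).
Local Notation C := R[i].
Local Notation cfg V := {ffun V -> 'I_n.+1}.
Local Notation op V := 'M[C]_#|{: cfg V}|.

Definition S1_def (V : finType) (x : V) : op V := sop x (s1 R n).
Definition S2_def (V : finType) (x : V) : op V := sop x (s2 R n).
Definition S3_def (V : finType) (x : V) : op V := sop x (s3 R n).
Lemma S1_sealed (V : finType) : {f | f = @S1_def V}.
Proof. exact: seal. Qed.
Definition S1_ {V : finType} : V -> op V := sval (S1_sealed V).
Lemma S2_sealed (V : finType) : {f | f = @S2_def V}.
Proof. exact: seal. Qed.
Definition S2_ {V : finType} : V -> op V := sval (S2_sealed V).
Lemma S3_sealed (V : finType) : {f | f = @S3_def V}.
Proof. exact: seal. Qed.
Definition S3_ {V : finType} : V -> op V := sval (S3_sealed V).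

Lemma S1_E (V : finType) (x : V) : S1_ x = sop x (s1 R n).
Proof. exact: (congr1 (fun g => g x) (svalP (S1_sealed V))). Qed.

Lemma S2_E (V : finType) (x : V) : S2_ x = sop x (s2 R n).
Proof. exact: (congr1 (fun g => g x) (svalP (S2_sealed V))). Qed.

Lemma S3_E (V : finType) (x : V) : S3_ x = sop x (s3 R n).
Proof. exact: (congr1 (fun g => g x) (svalP (S3_sealed V))). Qed.

(** The factor i makes S2 real and reverses the sign of its product: a rotated bond, - S1 S1 + S2 S2
    - S3 S3, becomes minus a sum of products of the same real factor at both ends. *)
Definition factor_mx (r : R) (k : 'I_3) : 'M[C]_n.+1 :=
  if k == 0 then s1 R n - r%:C%C *: 1%:M
  else if k == 1 then 'i%C *: s2 R n else s3 R n.

Definition bond_factor_def (V : finType) (h : V -> R) (k : 'I_3) (x : V) :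
    op V := sop x (factor_mx (h x) k).
Lemma bond_factor_sealed (V : finType) : {f | f = @bond_factor_def V}.
Proof. exact: seal. Qed.
Definition bond_factor {V : finType} : (V -> R) -> 'I_3 -> V -> op V :=
  sval (bond_factor_sealed V).

Lemma bond_factorE (V : finType) (h : V -> R) k x :
  bond_factor h k x = sop x (factor_mx (h x) k).
Proof.
exact: (congr1 (fun g => g h k x) (svalP (bond_factor_sealed V))).
Qed.

Definition loc_def (V : finType) (h : V -> R) (x : V) : op V :=
  (h x ^+ 2 / 2)%:C%C *: 1%:M - (h x)%:C%C *: S1_ x.
Lemma loc_sealed (V : finType) : {f | f = @loc_def V}.
Proof. exact: seal. Qed.
Definition loc {V : finType} : (V -> R) -> V -> op V :=
  sval (loc_sealed V).

Lemma locE (V : finType) (h : V -> R) x :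
  loc h x = (h x ^+ 2 / 2)%:C%C *: 1%:M - (h x)%:C%C *: S1_ x.
Proof. exact: (congr1 (fun g => g h x) (svalP (loc_sealed V))). Qed.

Definition bond_def (V : finType) (h : V -> R) (x y : V) : op V :=
  \sum_k bond_factor h k x *m bond_factor h k y.
Lemma bond_sealed (V : finType) : {f | f = @bond_def V}.
Proof. exact: seal. Qed.
Definition bond {V : finType} : (V -> R) -> V -> V -> op V :=
  sval (bond_sealed V).

Lemma bondE (V : finType) (h : V -> R) x y :
  bond h x y = \sum_k bond_factor h k x *m bond_factor h k y.
Proof. exact: (congr1 (fun g => g h x y) (svalP (bond_sealed V))). Qed.

(* Completing the square: for x <> y this is
   - S1 x S1 y + S2 x S2 y - S3 x S3 y
   - (h x - h y) (S1 x - S1 y) + (h x - h y)^2 / 2. *)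
Definition field_bond_def (V : finType) (h : V -> R) (x y : V) : op V :=
  loc h x + loc h y - bond h x y.
Lemma field_bond_sealed (V : finType) : {f | f = @field_bond_def V}.
Proof. exact: seal. Qed.
Definition field_bond {V : finType} : (V -> R) -> V -> V -> op V :=
  sval (field_bond_sealed V).

Lemma field_bondE (V : finType) (h : V -> R) x y :
  field_bond h x y = loc h x + loc h y - bond h x y.
Proof.
exact: (congr1 (fun g => g h x y) (svalP (field_bond_sealed V))).
Qed.

(** The factor 1/2 compensates for counting ordered pairs; the field is uniform because the rotation
    has already been performed. *)
Definition field_ham_def (V : finType) (adj : rel V) (B : R) (h : V -> R) :
    op V :=
  (2^-1 : R)%:C%C *: \sum_x \sum_(y | adj x y) field_bond h x y
  - B%:C%C *: \sum_x S3_ x.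
Lemma field_ham_sealed (V : finType) : {f | f = @field_ham_def V}.
Proof. exact: seal. Qed.
Definition field_ham {V : finType} : rel V -> R -> (V -> R) -> op V :=
  sval (field_ham_sealed V).

Lemma field_hamE (V : finType) (adj : rel V) (B : R) (h : V -> R) :
  field_ham adj B h =
  (2^-1 : R)%:C%C *: \sum_x \sum_(y | adj x y) field_bond h x y
  - B%:C%C *: \sum_x S3_ x.
Proof.
exact: (congr1 (fun g => g adj B h) (svalP (field_ham_sealed V))).
Qed.

Lemma S1_herm (V : finType) (x : V) : dag (S1_ x) = S1_ x.
Proof. by rewrite S1_E -sop_dag s1_herm. Qed.

Lemma S2_herm (V : finType) (x : V) : dag (S2_ x) = S2_ x.
Proof. by rewrite S2_E -sop_dag s2_herm. Qed.

Lemma S3_herm (V : finType) (x : V) : dag (S3_ x) = S3_ x.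
Proof. by rewrite S3_E -sop_dag s3_herm. Qed.

Lemma real_s1 : real_mx (s1 R n).
Proof.
rewrite /real_mx s1_herm; apply/matrixP => k l; rewrite !mxE /spin1.
congr (_ / _); case: eqP => [e|_]; last by case: eqP.
by case: eqP => // e'; lia.
Qed.

Lemma real_s3 : real_mx (s3 R n).
Proof.
rewrite /real_mx s3_herm; apply/matrixP => k l; rewrite !mxE /spin3 eq_sym.
by case: eqP => [->|].
Qed.

Lemma real_is2 : real_mx ('i%C *: s2 R n).
Proof.
rewrite /real_mx dagZ conj_i s2_herm linearZ /= scaleNr -scalerN; congr (_ *: _).
apply/matrixP => k l; rewrite oppmxE !mxE /spin2 -mulNr.
congr (_ / _); case: eqP => [e|_]; last by case: eqP; rewrite ?opprK ?oppr0.
by case: eqP => // e'; lia.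
Qed.

Lemma real_S1 (V : finType) (x : V) : real_mx (S1_ x).
Proof. rewrite S1_E; exact/real_mx_sop/real_s1. Qed.

Lemma real_S3 (V : finType) (x : V) : real_mx (S3_ x).
Proof. rewrite S3_E; exact/real_mx_sop/real_s3. Qed.

Lemma real_bond_factor (V : finType) (h : V -> R) k x :
  real_mx (bond_factor h k x).
Proof.
rewrite bond_factorE; apply: real_mx_sop; rewrite /factor_mx; case: (k == 0); last case: (k == 1).
- by apply: real_mxD; [exact: real_s1|exact/real_mxN/real_mxZ/real_mx1].
- exact: real_is2.
- exact: real_s3.
Qed.

Lemma bond_factor_commute (V : finType) (h : V -> R) k x y : x != y ->
  bond_factor h k x *m bond_factor h k y = bond_factor h k y *m bond_factor h k x.
Proof. by rewrite !bond_factorE; exact: sop_commute. Qed.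

Lemma emb_S1 (V W : finType) (tau : V -> W) x : injective tau ->
  emb tau (S1_ x) = S1_ (tau x).
Proof. by rewrite !S1_E; exact: emb_sop. Qed.

Lemma emb_S2 (V W : finType) (tau : V -> W) x : injective tau ->
  emb tau (S2_ x) = S2_ (tau x).
Proof. by rewrite !S2_E; exact: emb_sop. Qed.

Lemma emb_S3 (V W : finType) (tau : V -> W) x : injective tau ->
  emb tau (S3_ x) = S3_ (tau x).
Proof. by rewrite !S3_E; exact: emb_sop. Qed.

Lemma emb_bond_factor (V W : finType) (tau : V -> W) (h : W -> R) k x :
  injective tau ->
  emb tau (bond_factor (h \o tau) k x) = bond_factor h k (tau x).
Proof. by rewrite !bond_factorE; exact: emb_sop. Qed.

Lemma bond_factor_dag (V : finType) (h : V -> R) k x :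
  dag (bond_factor h k x) = (if k == 1 then -1 else 1) *: bond_factor h k x.
Proof.
rewrite bond_factorE -sop_dag -sopZ; congr sop; rewrite /factor_mx.
case: (eqVneq k 0) => [->|_]; last case: (k == 1).
- by rewrite dagD dagN dagZ dag1 conjc_real s1_herm scale1r.
- by rewrite dagZ conj_i s2_herm scaleNr scaleN1r.
- by rewrite s3_herm scale1r.
Qed.

Lemma bond_factor_herm (V : finType) (h : V -> R) k x y : x != y ->
  dag (bond_factor h k x *m bond_factor h k y)
  = bond_factor h k x *m bond_factor h k y.
Proof.
move=> xy; rewrite dagM (bond_factor_commute _ _ xy) !bond_factor_dag mulmx_scale2.
by case: (k == 1); rewrite ?mulrNN mulr1 scale1r.
Qed.

Lemma loc_herm (V : finType) (h : V -> R) x : dag (loc h x) = loc h x.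
Proof. by rewrite locE dagD dagN !dagZ dag1 S1_herm !conjc_real. Qed.

Lemma real_loc (V : finType) (h : V -> R) x : real_mx (loc h x).
Proof.
rewrite locE; apply: real_mxD; first exact/real_mxZ/real_mx1.
exact/real_mxN/real_mxZ/real_S1.
Qed.

Lemma emb_loc (V W : finType) (tau : V -> W) (h : W -> R) x :
  injective tau -> emb tau (loc (h \o tau) x) = loc h (tau x).
Proof. by move=> ti; rewrite !locE embB !embZ emb1 emb_S1. Qed.

Lemma bond_herm (V : finType) (h : V -> R) x y : x != y ->
  dag (bond h x y) = bond h x y.
Proof.
by move=> xy; rewrite bondE dag_sum; apply: eq_bigr => k _; exact: bond_factor_herm.
Qed.

Lemma bond_sym (V : finType) (h : V -> R) x y : x != y ->
  bond h x y = bond h y x.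
Proof. by move=> xy; rewrite !bondE; apply: eq_bigr => k _; exact: bond_factor_commute. Qed.

Lemma real_bond (V : finType) (h : V -> R) x y : real_mx (bond h x y).
Proof.
rewrite bondE; apply: real_mx_sum => k _; apply: real_mxM;
  exact: real_bond_factor.
Qed.

Lemma emb_bond (V W : finType) (tau : V -> W) (h : W -> R) x y :
  injective tau -> emb tau (bond (h \o tau) x y) = bond h (tau x) (tau y).
Proof.
move=> ti; rewrite !bondE emb_sum; apply: eq_bigr => k _.
by rewrite (embM ti) !(emb_bond_factor _ _ _ ti).
Qed.

Lemma field_bond_herm (V : finType) (h : V -> R) x y : x != y ->
  dag (field_bond h x y) = field_bond h x y.
Proof.
by move=> xy; rewrite !field_bondE dagD dagN dagD !loc_herm bond_herm.
Qed.

Lemma real_field_bond (V : finType) (h : V -> R) x y :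
  real_mx (field_bond h x y).
Proof.
rewrite !field_bondE; apply: real_mxD; last exact/real_mxN/real_bond.
by apply: real_mxD; exact: real_loc.
Qed.

Lemma field_bond_sym (V : finType) (h : V -> R) x y : x != y ->
  field_bond h x y = field_bond h y x.
Proof. by move=> xy; rewrite !field_bondE (addrC (loc h x)) bond_sym. Qed.

Lemma emb_field_bond (V W : finType) (tau : V -> W) (h : W -> R) x y :
    injective tau ->
  emb tau (field_bond (h \o tau) x y) = field_bond h (tau x) (tau y).
Proof.
by move=> ti; rewrite !field_bondE embB embD !(emb_loc _ _ ti) (emb_bond _ _ _ ti).
Qed.

Lemma real_field_ham (V : finType) (adj : rel V) B (h : V -> R) :
  real_mx (field_ham adj B h).
Proof.
rewrite field_hamE; apply: real_mxD; last first.
  by apply/real_mxN/real_mxZ/real_mx_sum => x _; exact: real_S3.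
apply/real_mxZ/real_mx_sum => x _; apply: real_mx_sum => y _.
exact: real_field_bond.
Qed.

Lemma field_ham_herm (V : finType) (adj : rel V) B (h : V -> R) :
  irreflexive adj -> dag (field_ham adj B h) = field_ham adj B h.
Proof.
move=> irr; rewrite !field_hamE dagD dagN (dagZ (_)%:C%C) (dagZ B%:C%C).
rewrite !conjc_real !dag_sum.
apply: eq_scale_sub; apply: eq_bigr => x _; last exact: S3_herm.
rewrite dag_sum; apply: eq_bigr => y xy; apply: field_bond_herm.
by apply: contraTneq xy => ->; rewrite irr.
Qed.

Lemma emb_field_ham (V W : finType) (tau : V -> W) (h : W -> R)
    (adj : rel V) B : injective tau ->
  emb tau (field_ham adj B (h \o tau)) =
  (2^-1 : R)%:C%C *:
    \sum_x \sum_(y | adj x y) field_bond h (tau x) (tau y)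
  - B%:C%C *: \sum_x S3_ (tau x).
Proof.
move=> ti; rewrite !field_hamE embB (embZ _ (_)%:C%C) (embZ _ B%:C%C) !emb_sum.
apply: eq_scale_sub; apply: eq_bigr => x _; last exact: emb_S3.
by rewrite emb_sum; apply: eq_bigr => y _; rewrite emb_field_bond.
Qed.

End RotatedHamiltonian.

Lemma mxtrace_form (R : rcfType) (T : finType) (v : 'cV[R[i]]_#|T|)
    (A : 'M[R[i]]_#|T|) :
  \tr (dag v *m A *m v) = \sum_s \sum_t
    (v (enum_rank s) 0)^*%C * ker A s t * v (enum_rank t) 0.
Proof.
have bij := onW_bij _ (enum_rank_bij T).
rewrite /mxtrace big_ord1 mxE (reindex enum_rank) /=; last exact: bij.
rewrite [RHS]exchange_big /=; apply: eq_bigr => t _.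
rewrite mxE (reindex enum_rank) /=; last exact: bij.
rewrite mulr_suml.
by apply: eq_bigr => s _; rewrite dagE.
Qed.

Lemma half_sum_split (F : comPzRingType) m p (c b : F)
    (A1 A2 T1 T2 l1 l2 X : 'M[F]_(m, p)) : c *+ 2 = 1 ->
  c *: (A1 + A2 + (l1 + l2 - X) *+ 2) - b *: (T1 + T2) =
  (c *: A1 - b *: T1 + l1) + (c *: A2 - b *: T2 + l2) - X.
Proof.
move=> c2; rewrite scalerDr -scalerMnr scalerMnl c2 scale1r.
by apply/matrixP => i j; rewrite !mxE; ring.
Qed.

(** * Lattices with a reflection through bonds *)

Section ReflectedLattice.
Variables (R : realType) (n : nat) (V : finType) (adj : rel V).
Variables (theta : V -> V) (left : pred V).
Hypothesis adj_sym : symmetric adj.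
Hypothesis adj_irr : irreflexive adj.
Hypothesis thetaK : involutive theta.
Hypothesis left_theta : forall x, left (theta x) = ~~ left x.
Hypothesis adj_theta : forall x y, adj (theta x) (theta y) = adj x y.
Hypothesis adj_cross :
  forall x y, left x -> ~~ left y -> adj x y -> y = theta x.
Local Notation C := R[i].
Local Notation VL := {x : V | left x}.
Local Notation cfg V := {ffun V -> 'I_n.+1}.
Local Notation op V := 'M[C]_#|{: cfg V}|.

Let iota : VL -> V := val.
Let iota' : VL -> V := theta \o val.

Let iota_inj : injective iota. Proof. exact: val_inj. Qed.
Let iota'_inj : injective iota'.
Proof. by move=> x y /(inv_inj thetaK) /val_inj. Qed.
Let iota_disj a b : iota a != iota' b.
Proof.
apply/eqP => e; have := valP a; rewrite -/(iota a) e /iota' /= left_theta.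
by rewrite (valP b).
Qed.

Lemma sum_reflection (Z : nmodType) (F : V -> Z) :
  \sum_x F x = \sum_(a : VL) F (val a) + \sum_(a : VL) F (theta (val a)).
Proof.
have e (G : V -> Z) : \sum_(a : VL) G (val a) = \sum_(x | left x) G x.
  by symmetry; exact: (big_sub left G).
rewrite (bigID left) /= !e (e (fun x => F (theta x))); congr (_ + _).
rewrite (reindex_inj (inv_inj thetaK)) /=.
by apply: eq_bigl => x; rewrite left_theta negbK.
Qed.

(** By [adj_cross] the only bonds between the halves join a site to its mirror image; each is
    counted in both orders, whence the doubling. *)
Lemma sum_adj_reflection (Z : nmodType) (G : V -> V -> Z) :
    (forall x y, adj x y -> G x y = G y x) ->
  \sum_x \sum_(y | adj x y) G x y =
    \sum_(a : VL) \sum_(b : VL | adj (val a) (val b)) G (val a) (val b) +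
    \sum_(a : VL) \sum_(b : VL | adj (val a) (val b))
      G (theta (val a)) (theta (val b)) +
    (\sum_(a : VL | adj (val a) (theta (val a))) G (val a) (theta (val a))) *+ 2.
Proof.
move=> Gsym; pose g x y := if adj x y then G x y else 0.
have diag (a b : VL) : a != b -> adj (val a) (theta (val b)) = false.
  move=> ab; apply/negP => /(adj_cross (valP a)); rewrite left_theta (valP b).
  by move=> /(_ isT) /(inv_inj thetaK) /val_inj e; rewrite e eqxx in ab.
under eq_bigr => x _ do rewrite big_mkcond -/(g x _) sum_reflection.
rewrite sum_reflection /= !big_split /= -!addrA; congr (_ + _).
  by apply: eq_bigr => a _; rewrite [RHS]big_mkcond.
rewrite addrA [RHS]addrC mulr2n; congr (_ + _ + _).
- rewrite [RHS]big_mkcond; apply: eq_bigr => a _.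
  rewrite (bigD1 a) //= big1 ?addr0 // => b ba.
  by rewrite /g diag // eq_sym.
- rewrite [RHS]big_mkcond; apply: eq_bigr => a _.
  rewrite (bigD1 a) //= big1 ?addr0 => [|b ba].
    by rewrite /g adj_sym; case: ifP => // aa; rewrite Gsym // adj_sym.
  by rewrite /g adj_sym diag.
- apply: eq_bigr => a _; rewrite [RHS]big_mkcond; apply: eq_bigr => b _.
  by rewrite /g adj_theta.
Qed.

Let adjL : rel VL := fun a b => adj (val a) (val b).
Let cross : pred VL := fun a => adj (val a) (theta (val a)).

Let half_ham (B : R) (g : VL -> R) : op VL :=
  field_ham n adjL B g + \sum_(a | cross a) loc n g a.

Let cross_factor (g : VL -> R) (p : VL * 'I_3) : op VL :=
  if cross p.1 then bond_factor n g p.2 p.1 else 0.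

(** The decomposition L (x) 1 + 1 (x) L' - sum M (x) M'. A crossing bond gives its one-site terms to
    the two halves and leaves only a product of factors as coupling. *)
Let field_ham_split (B : R) (h : V -> R) :
  field_ham n adj B h = emb iota (half_ham B (h \o iota))
    + emb iota' (half_ham B (h \o iota'))
    - \sum_p emb iota (cross_factor (h \o iota) p)
        *m emb iota' (cross_factor (h \o iota') p).
Proof.
have neq x y : adj x y -> x != y.
  by apply: contraTneq => ->; rewrite adj_irr.
rewrite [in LHS]field_hamE.
rewrite sum_adj_reflection; last first.
  by move=> x y /neq xy; exact: field_bond_sym.
rewrite (sum_reflection (fun x => S3_ R n x)).
have eh (tau : VL -> V) : injective tau ->
    emb tau (half_ham B (h \o tau)) = ((2^-1 : R)%:C)%C *:
      (\sum_a \sum_(b | adjL a b) field_bond n h (tau a) (tau b))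
    - B%:C%C *: \sum_a S3_ R n (tau a) + \sum_(a | cross a) loc n h (tau a).
  move=> ti; rewrite /half_ham embD (emb_field_ham n h adjL B ti) emb_sum.
  by congr (_ + _); apply: eq_bigr => a _; exact: emb_loc.
rewrite (eh iota) // (eh iota') //.
have -> : \sum_p emb iota (cross_factor (h \o iota) p)
        *m emb iota' (cross_factor (h \o iota') p)
    = \sum_(a | cross a) bond n h (iota a) (iota' a).
  rewrite [RHS]big_mkcond -(pair_bigA _ (fun a k =>
    emb iota (cross_factor (h \o iota) (a, k))
        *m emb iota' (cross_factor (h \o iota') (a, k)))) /=.
  apply: eq_bigr => a _; rewrite /cross_factor /=; case: (cross a).
    by rewrite bondE; apply: eq_bigr => k _; rewrite !emb_bond_factor.
  by rewrite big1 // => k _; rewrite emb0 mul0mx.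
have -> : \sum_(a : VL | adj (val a) (theta (val a)))
      field_bond n h (val a) (theta (val a)) =
    \sum_(a | cross a) loc n h (iota a) + \sum_(a | cross a) loc n h (iota' a)
    - \sum_(a | cross a) bond n h (iota a) (iota' a).
  rewrite -big_split /= -sumrB.
  by apply: eq_bigr => a _; rewrite field_bondE.
rewrite -/adjL; apply: half_sum_split; rewrite -rmorphMn -[in RHS](rmorph1 (real_complex R)).
by have -> : 2^-1 *+ 2 = 1 :> R by rewrite -[LHS]mulr_natr mulVf // pnatr_eq0.
Qed.

Let merge (p : cfg VL * cfg VL) : cfg V :=
  glue iota p.1 (glue iota' p.2 [ffun=> ord0]).

Let cover x : (x \in codom iota) || (x \in codom iota').
Proof.
case: (boolP (left x)) => lx; apply/orP; [left|right]; apply/codomP.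
  by exists (Sub x lx).
have lx' : left (theta x) by rewrite left_theta.
by exists (Sub (theta x) lx'); rewrite /iota' /= thetaK.
Qed.

Let pull_merge p : pull iota (merge p) = p.1 /\ pull iota' (merge p) = p.2.
Proof.
split; first exact: pull_glue.
apply/ffunP => a; rewrite ffunE glue_off ?glue_on //.
apply/negP => /codomP[b /esym /eqP]; exact/negP/iota_disj.
Qed.

Let merge_pull s : merge (pull iota s, pull iota' s) = s.
Proof.
have [e1 e2] := pull_merge (pull iota s, pull iota' s).
apply/ffunP => x; have /orP[/codomP[a ->]|/codomP[a ->]] := cover x.
  by have /ffunP/(_ a) := e1; rewrite !ffunE.
by have /ffunP/(_ a) := e2; rewrite !ffunE.
Qed.

Let sum_merge (F : cfg V -> C) :
  \sum_s F s = \sum_a \sum_b F (merge (a, b)).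
Proof.
rewrite pair_bigA /= (reindex merge) /=; first by apply: eq_bigr => -[].
exists (fun s => (pull iota s, pull iota' s)) => [[a b] _|s _].
  by have [-> ->] := pull_merge (a, b).
exact: merge_pull.
Qed.

(** A vector of the whole system read as a matrix with rows indexed by left and columns by right
    configurations: the left half acts by X c and the right half by c Y^T. *)
Let vec (c : op VL) : 'cV[C]_#|{: cfg V}| :=
  \col_i ker c (pull iota (enum_val i)) (pull iota' (enum_val i)).

Let vecP (v : 'cV[C]_#|{: cfg V}|) : exists c, v = vec c.
Proof.
exists (mk (fun a b => v (enum_rank (merge (a, b))) 0)).
by apply/colP => i; rewrite mxE ker_mk merge_pull enum_valK.
Qed.

Let vecE c a b : vec c (enum_rank (merge (a, b))) 0 = ker c a b.
Proof. by rewrite mxE enum_rankK; have [-> ->] := pull_merge (a, b). Qed.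

Let form_vec c (X Y : op VL) :
  \tr (dag (vec c) *m (emb iota X *m emb iota' Y) *m vec c)
  = \tr (dag c *m X *m c *m Y^T).
Proof.
have kE a b a' b' : ker (emb iota X *m emb iota' Y) (merge (a, b)) (merge (a', b'))
    = ker X a a' * ker Y b b'.
  rewrite ker_emb_disjoint //.
  have [-> ->] := pull_merge (a, b); have [-> ->] := pull_merge (a', b').
  rewrite (_ : [forall _, _]) ?mulr1 //; apply/forallP => y; rewrite orbA.
  by rewrite cover.
rewrite mxtrace_form sum_merge mxtrace_ker exchange_big /=.
apply: eq_bigr => b _; rewrite kerM.
under eq_bigr => a _ do rewrite sum_merge.
under eq_bigr => a _ do under eq_bigr => a' _ do
  under eq_bigr => b' _ do rewrite kE !vecE.
under [RHS]eq_bigr => b' _ do rewrite kerM mulr_suml.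
rewrite [RHS]exchange_big /= exchange_big /=; apply: eq_bigr => a' _.
rewrite exchange_big /=; apply: eq_bigr => b' _.
have -> : ker Y^T b' b = ker Y b b' by rewrite /ker mxE.
rewrite kerM !mulr_suml; apply: eq_bigr => a _.
by rewrite ker_dag !mulrA; ring.
Qed.

Let form_left c (X : op VL) :
  \tr (dag (vec c) *m emb iota X *m vec c) = \tr (dag c *m X *m c).
Proof.
by have := form_vec c X 1%:M; rewrite emb1 trmx1 !mulmx1.
Qed.

Let form_right c (Y : op VL) :
  \tr (dag (vec c) *m emb iota' Y *m vec c) = \tr (dag c *m c *m Y^T).
Proof.
by have := form_vec c 1%:M Y; rewrite emb1 mul1mx mulmx1.
Qed.

Let form_1 c : \tr (dag (vec c) *m vec c) = \tr (dag c *m c).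
Proof.
by have := form_left c 1%:M; rewrite emb1 !mulmx1.
Qed.

Let real_half_ham B g : real_mx (half_ham B g).
Proof.
apply: real_mxD; first exact: real_field_ham.
by apply: real_mx_sum => a _; exact: real_loc.
Qed.

Let half_ham_herm B g : dag (half_ham B g) = half_ham B g.
Proof.
rewrite /half_ham dagD field_ham_herm ?dag_sum; last by move=> a; exact: adj_irr.
by congr (_ + _); apply: eq_bigr => a _; exact: loc_herm.
Qed.

Let real_cross_factor g p : real_mx (cross_factor g p).
Proof.
rewrite /cross_factor; case: (cross _); last exact: real_mx0.
exact: real_bond_factor.
Qed.

Let form_field_ham B h c :
  complex.Re (\tr (dag (vec c) *m field_ham n adj B h *m vec c)) =
  doubled_form c (half_ham B (h \o iota)) (half_ham B (h \o iota'))
    (cross_factor (h \o iota)) (cross_factor (h \o iota')).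
Proof.
rewrite field_ham_split mulmxBr mulmxBl raddfB /= ReD ReN mulmxDr mulmxDl.
rewrite mxtraceD ReD form_left form_right /doubled_form -real_half_ham.
rewrite mulmx_sumr mulmx_suml (raddf_sum (@mxtrace _ _)).
congr (_ - _); rewrite Re_sum.
apply: eq_bigr => p _; congr complex.Re; rewrite (real_cross_factor _ p).
exact: form_vec.
Qed.

Definition reflect_left (h : V -> R) : V -> R :=
  fun x => if left x then h x else h (theta x).
Definition reflect_right (h : V -> R) : V -> R :=
  fun x => if left x then h (theta x) else h x.

(** Reflecting the field gives both halves the same restriction, so the two hypotheses bound the
    symmetric forms of [doubled_form_reflection], and the original field is the mixed one. *)
Theorem reflection_positivity B (h : V -> R) e e' :
    lower_bound (field_ham n adj B (reflect_left h)) e ->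
    lower_bound (field_ham n adj B (reflect_right h)) e' ->
  lower_bound (field_ham n adj B h) ((e + e') / 2).
Proof.
have eL : (reflect_left h) \o iota = h \o iota.
  by apply: boolp.funext => a; rewrite /reflect_left /= (valP a).
have eL' : (reflect_left h) \o iota' = h \o iota.
  apply: boolp.funext => a.
  by rewrite /reflect_left /= left_theta (valP a) /= thetaK.
have eR : (reflect_right h) \o iota = h \o iota'.
  by apply: boolp.funext => a; rewrite /reflect_right /= (valP a).
have eR' : (reflect_right h) \o iota' = h \o iota'.
  apply: boolp.funext => a.
  by rewrite /reflect_right /= left_theta (valP a).
move=> le le' v; have [c ->] := vecP v; rewrite form_field_ham form_1.
apply: doubled_form_reflection; try exact: half_ham_herm.
- by move=> c'; have := le (vec c'); rewrite form_field_ham form_1 eL eL'.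
- by move=> c'; have := le' (vec c'); rewrite form_field_ham form_1 eR eR'.
Qed.

End ReflectedLattice.

Lemma square_expansion (F : comPzRingType) m (p q pp qq r w : F) (a b c d : 'M[F]_m) :
    pp + qq - p * q = r -> w = p - q ->
  (pp *: 1%:M - p *: a) + (qq *: 1%:M - q *: b)
    - ((a - p *: 1%:M) *m (b - q *: 1%:M) + ((-1) *: c + d))
  = - (a *m b) + c - d - w *: (a - b) + r *: 1%:M.
Proof.
move=> <- ->; rewrite mulmxBl !mulmxBr -!scalemxAl -!scalemxAr mulmx1 !mul1mx.
move: (a *m b) (1%:M) => e f.
by apply/matrixP => i j; rewrite !mxE; ring.
Qed.

(** * Constant fields have the least energy *)

Section GaussianDomination.
Variables (R : realType) (n : nat) (V : finType).
Local Notation C := R[i].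

Lemma lower_bound_le m (A : 'M[C]_m) (e e' : R) :
  e' <= e -> lower_bound A e -> lower_bound A e'.
Proof.
move=> ee lA v; apply: le_trans (lA v); apply: ler_wpM2r => //.
exact/Re_ge0/mxtrace_dag_mul_ge0.
Qed.

Lemma mxtrace_dag_mul_gt0 m (v : 'cV[C]_m) :
  v != 0 -> 0 < complex.Re (\tr (dag v *m v)).
Proof.
move=> v0; rewrite lt_def Re_ge0 ?mxtrace_dag_mul_ge0 // andbT mxtrace_dag_norm.
apply: contra_neq v0 => /eqP; rewrite psumr_eq0 => [/allP h|i _]; last first.
  exact/Re_ge0/mulcJ_ge0.
apply/colP => i; have := h i (mem_index_enum i); rewrite mxE implyTb.
case: (v i 0) => a b /=; rewrite mulrN opprK -!expr2 paddr_eq0 ?sqr_ge0 //.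
by rewrite !sqrf_eq0 => /andP[/eqP -> /eqP ->].
Qed.

Lemma hermitian_greatest_lower_bound m (A : 'M[C]_m) : (0 < m)%N -> dag A = A ->
  exists e, lower_bound A e /\ forall e', lower_bound A e' -> e' <= e.
Proof.
move=> m0 hA; have [e [v [le v0 Av]]] := hermitian_minimum m0 hA.
exists e; split=> // e' /(_ v).
rewrite -mulmxA Av -scalemxAr linearZ /= ReZ.
by rewrite ler_pM2r // mxtrace_dag_mul_gt0.
Qed.

Lemma field_bond_diff (h : V -> R) (x y : V) : field_bond n h x y =
  - (S1_ R n x *m S1_ R n y) + S2_ R n x *m S2_ R n y - S3_ R n x *m S3_ R n y
  - (h x - h y)%:C%C *: (S1_ R n x - S1_ R n y)
  + ((h x - h y) ^+ 2 / 2)%:C%C *: 1%:M.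
Proof.
rewrite field_bondE !locE bondE big_ord_recl big_ord_recl big_ord1.
have e0 z : bond_factor n h ord0 z = S1_ R n z - (h z)%:C%C *: 1%:M.
  by rewrite bond_factorE /factor_mx /= sopB sopZ sop1 S1_E.
have e1 z : bond_factor n h (lift ord0 ord0) z = 'i%C *: S2_ R n z.
  by rewrite bond_factorE /factor_mx /= sopZ S2_E.
have e2 z : bond_factor n h (lift ord0 (lift ord0 ord0)) z = S3_ R n z.
  by rewrite bond_factorE /factor_mx /= S3_E.
rewrite !e0 !e1 !e2 mulmx_scale2 ii.
apply: square_expansion; last by rewrite rmorphB.
by rewrite -rmorphM -rmorphD -rmorphB; congr (_%:C)%C; field.
Qed.

Variable adj : rel V.
Hypothesis adj_sym : symmetric adj.
Hypothesis adj_irr : irreflexive adj.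

Hypothesis reflections : forall x y, adj x y ->
  exists (theta : V -> V) (left : pred V),
    [/\ involutive theta, forall z, left (theta z) = ~~ left z,
        forall z w, adj (theta z) (theta w) = adj z w,
        forall z w, left z -> ~~ left w -> adj z w -> w = theta z &
        left x /\ theta x = y].

Lemma field_ham_constant B (h : V -> R) :
  (forall x y, adj x y -> h x = h y) ->
  field_ham n adj B h = field_ham n adj B (fun _ => 0).
Proof.
move=> hh; rewrite !field_hamE; congr (_ *: _ - _).
apply: eq_bigr => x _; apply: eq_bigr => y xy.
by rewrite !field_bond_diff (hh _ _ xy) !subrr.
Qed.

(* Among the fields h \o sigma, take one of least energy, and among those
   one with the fewest non-constant bonds: reflecting it across such a bond
   would produce one with fewer. *)
Theorem gaussian_domination B (e : R) (h : V -> R) :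
  lower_bound (field_ham n adj B (fun _ => 0)) e ->
  lower_bound (field_ham n adj B h) e.
Proof.
move=> lb0.
have card0 : (0 < #|{: {ffun V -> 'I_n.+1}}|)%N.
  by apply/card_gt0P; exists [ffun=> ord0].
(* Repeated reflections only rearrange the values of h, so every field met has the form h \o s with
   s in a finite set, and minimisers exist. *)
have /boolp.choice[E EP] (s : {ffun V -> V}) := hermitian_greatest_lower_bound
  card0 (field_ham_herm n B (h \o s) adj_irr).
pose bad (s : {ffun V -> V}) (x y : V) : nat := h (s x) != h (s y).
pose N s := (\sum_x \sum_(y | adj x y) bad s x y)%N.
have bad_sym s x y : adj x y -> bad s x y = bad s y x.
  by rewrite /bad eq_sym.
pose s0 : {ffun V -> V} := [ffun x => x].
have [s1 min1] : exists s1, forall s, E s1 <= E s.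
  case: (@Order.TotalTheory.arg_minP _ _ _ s0 predT E) => [//|s1 _ m1].
  by exists s1 => s; exact: m1.
have [s [Es minN]] : exists s, E s = E s1 /\
    forall s', E s' = E s1 -> (N s <= N s')%N.
  case: (@arg_minnP _ s1 (fun s => E s == E s1) N (eqxx _)) => s /eqP Es m.
  by exists s; split=> // s' /eqP; exact: m.
suff N0 : N s = 0%N.
  have e_le : e <= E s1.
    rewrite -Es; apply: (EP s).2; rewrite field_ham_constant // => x y xy /=.
    apply/eqP; move/eqP: N0; rewrite sum_nat_eq0 => /forallP/(_ x) /=.
    by rewrite sum_nat_eq0 => /forallP/(_ y); rewrite xy /bad eqb0 negbK.
  have -> : h = h \o s0 by apply: boolp.funext => x /=; rewrite ffunE.
  by apply: lower_bound_le (EP s0).1; apply: le_trans e_le _; exact: min1.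
apply/eqP; rewrite sum_nat_eq0; apply/forallP => x; apply/implyP => _.
rewrite sum_nat_eq0; apply/forallP => y; apply/implyP => xy.
have [th [left [thK lth adjth cr [lx thx]]]] := reflections xy.
pose sL : {ffun V -> V} := [ffun z => if left z then s z else s (th z)].
pose sR : {ffun V -> V} := [ffun z => if left z then s (th z) else s z].
have hL : h \o sL = reflect_left th left (h \o s).
  apply: boolp.funext => z; rewrite /reflect_left /= ffunE.
  by case: ifP.
have hR : h \o sR = reflect_right th left (h \o s).
  apply: boolp.funext => z; rewrite /reflect_right /= ffunE.
  by case: ifP.
have rp : (E sL + E sR) / 2 <= E s.
  apply: (EP s).2; apply: (reflection_positivity adj_sym adj_irr thK lth adjth cr).
  - rewrite -hL; exact: (EP sL).1.
  - rewrite -hR; exact: (EP sR).1.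
(* The average of two energies that are at least the minimum is at most the minimum, so both
   reflected fields are minimisers. *)
have [EL ER] : E sL = E s1 /\ E sR = E s1.
  have := min1 sL; have := min1 sR; move: rp; rewrite Es.
  by move=> a b c; split; lra.
have mR := minN sR ER; have mL := minN sL EL.
pose VL := {z : V | left z}.
pose A s := (\sum_(a : VL) \sum_(b : VL | adj (val a) (val b))
  bad s (val a) (val b))%N.
pose A' s := (\sum_(a : VL) \sum_(b : VL | adj (val a) (val b))
  bad s (th (val a)) (th (val b)))%N.
pose X s := (\sum_(a : VL | adj (val a) (th (val a)))
  bad s (val a) (th (val a)))%N.
have split t : N t = (A t + A' t + (X t + X t))%N.
  apply: (sum_adj_reflection adj_sym thK lth adjth cr) => ? ?.
  exact: bad_sym.
have AL : A sL = A s.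
  apply: eq_bigr => a _; apply: eq_bigr => b _.
  by rewrite /bad !ffunE (valP a) (valP b).
have AL' : A' sL = A s.
  apply: eq_bigr => a _; apply: eq_bigr => b _.
  by rewrite /bad !ffunE !lth (valP a) (valP b) /= !thK.
have XL : X sL = 0%N.
  by apply: big1 => a _; rewrite /bad !ffunE lth (valP a) /= thK eqxx.
have AR : A sR = A' s.
  apply: eq_bigr => a _; apply: eq_bigr => b _.
  by rewrite /bad !ffunE (valP a) (valP b).
have AR' : A' sR = A' s.
  apply: eq_bigr => a _; apply: eq_bigr => b _.
  by rewrite /bad !ffunE !lth (valP a) (valP b).
have XR : X sR = 0%N.
  by apply: big1 => a _; rewrite /bad !ffunE lth (valP a) /= eqxx.
have le_X : (bad s x y <= X s)%N.
  rewrite /X (bigD1 (Sub x lx)) /= ?thx ?xy // leq_addr //.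
(* The counts are A + A' + 2X for s and 2A, 2A' for its reflections. Minimality against both gives
   4X <= 0, so no crossing bond is bad. *)
move: mL mR le_X; rewrite !split AL AL' XL AR AR' XR.
by move: (A s) (A' s) (X s) (bad s x y) => a b c d; lia.
Qed.

End GaussianDomination.

(** * Rotation of one sublattice *)

Section SublatticeRotation.
Variables (R : realType) (n : nat) (V : finType) (par : pred V).
Local Notation C := R[i].
Local Notation cfg V := {ffun V -> 'I_n.+1}.
Local Notation op V := 'M[C]_#|{: cfg V}|.

Definition sublattice_sign (x : V) : R := (-1) ^+ par x.

Lemma sublattice_sign_sqr x : sublattice_sign x * sublattice_sign x = 1.
Proof. by rewrite /sublattice_sign; case: (par x); rewrite ?expr0 ?expr1 ?mulrNN mulr1. Qed.

Definition flip_cfg (s : cfg V) : cfg V :=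
  [ffun x => if par x then rev_ord (s x) else s x].

Lemma flip_cfgK : involutive flip_cfg.
Proof.
by move=> s; apply/ffunP => x; rewrite !ffunE; case: (par x); rewrite ?rev_ordK.
Qed.

(** The rotation by pi about the second axis exchanges the weights k and n - k up to a sign (-1)^k;
    this product collects the signs. *)
Definition cfg_sign (s : cfg V) : C := \prod_(x | par x) (-1) ^+ (s x).

Lemma cfg_signM s : cfg_sign s * cfg_sign s = 1.
Proof.
rewrite /cfg_sign -big_split big1 //= => x _.
by rewrite -exprMn mulrNN mulr1 expr1n.
Qed.

Lemma conj_cfg_sign s : (cfg_sign s)^*%C = cfg_sign s.
Proof.
apply: (big_ind (fun z : C => z^*%C = z)) => [|y z ey ez|x _].
- exact: conjc1.
- by rewrite conjM ey ez.
- by rewrite -signr_odd; case: (odd _); rewrite ?expr1 ?expr0 ?conjN conjc1.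
Qed.

(* The rotation by pi about the second axis on the sublattice [par]. *)
Definition rotation : op V :=
  mk (fun s t => cfg_sign s * (t == flip_cfg s)%:R).

Lemma ker_rotation_conj (A : op V) s t : ker (rotation *m A *m dag rotation) s t
  = cfg_sign s * cfg_sign t * ker A (flip_cfg s) (flip_cfg t).
Proof.
rewrite kerM (bigD1 (flip_cfg t)) //= big1 ?addr0; last first.
  move=> u ut; rewrite ker_dag ker_mk conjM (negPf ut).
  by rewrite conjc_nat !mulr0.
rewrite ker_dag ker_mk eqxx mulr1 conj_cfg_sign kerM.
rewrite (bigD1 (flip_cfg s)) //= big1 ?addr0; last first.
  by move=> u us; rewrite ker_mk (negPf us) mulr0 mul0r.
by rewrite ker_mk eqxx mulr1 mulrAC.
Qed.

Lemma rotation_unitary : rotation *m dag rotation = 1%:M.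
Proof.
apply: kerP => s t; have := ker_rotation_conj 1%:M s t; rewrite mulmx1 => ->.
rewrite !ker1 (inj_eq (inv_inj flip_cfgK)); case: eqP => [->|_].
  by rewrite mulr1 cfg_signM.
by rewrite mulr0.
Qed.

Lemma rotation_unitary' : dag rotation *m rotation = 1%:M.
Proof. exact/mulmx1C/rotation_unitary. Qed.

Definition rot (A : op V) : op V := rotation *m A *m dag rotation.

Lemma rotD A B : rot (A + B) = rot A + rot B.
Proof. by rewrite /rot mulmxDr mulmxDl. Qed.
Lemma rotN A : rot (- A) = - rot A.
Proof. by rewrite /rot mulmxN mulNmx. Qed.
Lemma rotZ a A : rot (a *: A) = a *: rot A.
Proof. by rewrite /rot -scalemxAr -scalemxAl. Qed.
Lemma rot0 : rot 0 = 0.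
Proof. by rewrite /rot mulmx0 mul0mx. Qed.
Lemma rot1 : rot 1%:M = 1%:M.
Proof. by rewrite /rot mulmx1 rotation_unitary. Qed.
Lemma rot_sum I (r : seq I) (P : pred I) (F : I -> op V) :
  rot (\sum_(i <- r | P i) F i) = \sum_(i <- r | P i) rot (F i).
Proof. exact: (big_morph _ rotD rot0). Qed.
Lemma rotM (A B : op V) : rot (A *m B) = rot A *m rot B.
Proof.
rewrite /rot !mulmxA -[in RHS](mulmxA _ (dag rotation) rotation).
by rewrite rotation_unitary' mulmx1.
Qed.

Lemma lower_bound_rot A e : lower_bound (rot A) e <-> lower_bound A e.
Proof.
split=> lA v.
  have := lA (rotation *m v); rewrite dagM !mulmxA.
  rewrite -(mulmxA (dag v) (dag rotation) rotation) rotation_unitary' mulmx1.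
  by rewrite -(mulmxA _ (dag rotation) rotation) rotation_unitary' mulmx1.
have := lA (dag rotation *m v); rewrite dagM dagK /rot !mulmxA.
by rewrite -(mulmxA (dag v) rotation (dag rotation)) rotation_unitary mulmx1.
Qed.

Definition flip_mx (M : 'M[C]_n.+1) : 'M[C]_n.+1 :=
  \matrix_(k, l) ((-1) ^+ k * (-1) ^+ l * M (rev_ord k) (rev_ord l)).

Lemma rot_sop x (M : 'M[C]_n.+1) :
  rot (sop x M) = sop x (if par x then flip_mx M else M).
Proof.
apply: kerP => s t; rewrite ker_rotation_conj !ker_sop !ffunE.
have -> : [forall y, (y != x) ==> (flip_cfg s y == flip_cfg t y)]
    = [forall y, (y != x) ==> (s y == t y)].
  apply: eq_forallb => y; rewrite !ffunE.
  by case: (par y); rewrite ?(inj_eq rev_ord_inj).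
case: (boolP [forall _, _]) => [/forallP st|_]; last by rewrite !mulr0.
rewrite !mulr1; have sgn (P : pred V) : (forall y, P y -> y != x) ->
    \prod_(y | P y) (-1) ^+ s y * \prod_(y | P y) (-1) ^+ t y = 1 :> C.
  move=> Px; rewrite -big_split big1 //= => y /Px yx.
  have := st y; rewrite yx => /eqP ->.
  by rewrite -exprMn mulrNN mulr1 expr1n.
case: ifP => px; last first.
  rewrite /cfg_sign sgn ?mul1r // => y py.
  by apply: contraTneq py => ->; rewrite px.
rewrite /cfg_sign (bigD1 x) //= [X in _ * X * _](bigD1 x) //= mulrACA sgn.
  by rewrite mulr1 mxE.
by move=> y /andP[].
Qed.

Lemma spin_c_rev k k' : (k + k').+1 = n -> spin_c R n k = spin_c R n k'.
Proof.
move=> kk; rewrite /spin_c.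
have -> : (k'.+1 = n - k)%N by lia.
have -> : (n - k' = k.+1)%N by lia.
by rewrite mulnC.
Qed.

Lemma flip_s1 : flip_mx (s1 R n) = - s1 R n.
Proof.
apply/matrixP => k l; rewrite oppmxE !mxE /spin1 /= !subSS.
rewrite -exprD -[RHS]mulNr mulrA; congr (_ / _).
have kn := ltn_ord k; have ln := ltn_ord l.
case: (eqVneq (l : nat) k.+1) => [e|ne].
  rewrite (_ : (n - l == (n - k).+1)%N = false); last by apply/eqP; lia.
  rewrite (_ : (n - k == (n - l).+1)%N = true); last by apply/eqP; lia.
  rewrite e addnS exprS addnn -signr_odd odd_double expr0 mulr1 mulN1r.
  by congr (- _); apply: spin_c_rev; lia.
case: (eqVneq (k : nat) l.+1) => [e|ne'].
  rewrite (_ : (n - l == (n - k).+1)%N = true); last by apply/eqP; lia.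
  rewrite e addSn exprS addnn -signr_odd odd_double expr0 mulr1 mulN1r.
  by congr (- _); apply: spin_c_rev; lia.
rewrite (_ : (n - l == (n - k).+1)%N = false); last by apply/eqP; lia.
rewrite (_ : (n - k == (n - l).+1)%N = false); last by apply/eqP; lia.
by rewrite mulr0 oppr0.
Qed.

Lemma flip_s2 : flip_mx (s2 R n) = s2 R n.
Proof.
apply/matrixP => k l; rewrite !mxE /spin2 /= !subSS.
rewrite -exprD mulrA; congr (_ / _).
have kn := ltn_ord k; have ln := ltn_ord l.
case: (eqVneq (l : nat) k.+1) => [e|ne].
  rewrite (_ : (n - l == (n - k).+1)%N = false); last by apply/eqP; lia.
  rewrite (_ : (n - k == (n - l).+1)%N = true); last by apply/eqP; lia.
  rewrite e addnS exprS addnn -signr_odd odd_double expr0 mulr1 mulN1r opprK.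
  by apply: spin_c_rev; lia.
case: (eqVneq (k : nat) l.+1) => [e|ne'].
  rewrite (_ : (n - l == (n - k).+1)%N = true); last by apply/eqP; lia.
  rewrite e addSn exprS addnn -signr_odd odd_double expr0 mulr1 mulN1r.
  by congr (- _); apply: spin_c_rev; lia.
rewrite (_ : (n - l == (n - k).+1)%N = false); last by apply/eqP; lia.
rewrite (_ : (n - k == (n - l).+1)%N = false); last by apply/eqP; lia.
by rewrite mulr0.
Qed.

Lemma flip_s3 : flip_mx (s3 R n) = - s3 R n.
Proof.
apply/matrixP => k l; rewrite oppmxE !mxE /spin3 (inj_eq rev_ord_inj).
case: eqVneq => [<-|_]; last by rewrite mulr0 oppr0.
rewrite -exprMn mulrNN mulr1 expr1n mul1r /spin_m /= subSS natrB -1?ltnS //.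
by rewrite -[RHS]mulNr; congr (_ * _); ring.
Qed.

Lemma rot_S1 x : rot (S1_ R n x) = (sublattice_sign x)%:C%C *: S1_ R n x.
Proof.
rewrite S1_E rot_sop /sublattice_sign; case: (par x); rewrite ?flip_s1 ?expr1 ?expr0 ?scale1r //.
by rewrite rmorphN1 scaleN1r sopN.
Qed.

Lemma rot_S2 x : rot (S2_ R n x) = S2_ R n x.
Proof. by rewrite S2_E rot_sop flip_s2 if_same. Qed.

Lemma rot_S3 x : rot (S3_ R n x) = (sublattice_sign x)%:C%C *: S3_ R n x.
Proof.
rewrite S3_E rot_sop /sublattice_sign; case: (par x); rewrite ?flip_s3 ?expr1 ?expr0 ?scale1r //.
by rewrite rmorphN1 scaleN1r sopN.
Qed.

End SublatticeRotation.


Lemma rot_bond_algebra (F : comPzRingType) m (c c' t w G r : F)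
    (a1 b1 a2 b2 a3 b3 : 'M[F]_m) : c * c = 1 -> c' = - c -> w = t * G * c ->
  - (a1 *m b1) + a2 *m b2 - a3 *m b3 - w *: (a1 - b1) + r *: 1%:M =
  (c *: a1) *m (c' *: b1) + a2 *m b2 + (c *: a3) *m (c' *: b3)
    - t *: (G *: (c *: a1 + c' *: b1)) + r *: 1%:M.
Proof.
move=> cc -> ->.
have cm (a b : 'M[F]_m) : (c *: a) *m ((- c) *: b) = - (a *m b).
  by rewrite -scalemxAl -scalemxAr scalerA mulrN cc scaleN1r.
rewrite !cm; move: (a1 *m b1) (a2 *m b2) (a3 *m b3) => x y z.
by apply/matrixP => i j; rewrite !mxE; ring.
Qed.

(** * The antiferromagnet on a bipartite graph *)

Section BipartiteHamiltonian.
Variables (R : realType) (n : nat) (V : finType) (adj : rel V) (par : pred V).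
Local Notation C := R[i].
Local Notation cfg V := {ffun V -> 'I_n.+1}.
Local Notation op V := 'M[C]_#|{: cfg V}|.
Local Notation S1 := (S1_ R n).
Local Notation S2 := (S2_ R n).
Local Notation S3 := (S3_ R n).
Local Notation eta := (sublattice_sign R par).
Hypothesis adj_par : forall x y, adj x y -> par y = ~~ par x.

Definition dot_def (x y : V) : op V := S1 x *m S1 y + S2 x *m S2 y + S3 x *m S3 y.
Lemma dot_sealed : {f | f = dot_def}.
Proof. exact: seal. Qed.
Definition dot : V -> V -> op V := sval dot_sealed.

Lemma dotE x y : dot x y = S1 x *m S1 y + S2 x *m S2 y + S3 x *m S3 y.
Proof. exact: (congr1 (fun g => g x y) (svalP dot_sealed)). Qed.

Definition ham_def : op V := (2^-1 : R)%:C%C *: \sum_x \sum_(y | adj x y) dot x y.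
Lemma ham_sealed : {f | f = ham_def}.
Proof. exact: seal. Qed.
Definition ham : op V := sval ham_sealed.

Lemma hamE : ham = (2^-1 : R)%:C%C *: \sum_x \sum_(y | adj x y) dot x y.
Proof. exact: (svalP ham_sealed). Qed.

Definition staggered_def : op V := \sum_x (eta x)%:C%C *: S3 x.
Lemma staggered_sealed : {f | f = staggered_def}.
Proof. exact: seal. Qed.
Definition staggered : op V := sval staggered_sealed.

Lemma staggeredE : staggered = \sum_x (eta x)%:C%C *: S3 x.
Proof. exact: (svalP staggered_sealed). Qed.

Definition bond_field_def (g : V -> R) : op V :=
  (2^-1 : R)%:C%C *: \sum_x \sum_(y | adj x y) (g x + g y)%:C%C *: (S1 x + S1 y).
Lemma bond_field_sealed : {f | f = bond_field_def}.
Proof. exact: seal. Qed.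
Definition bond_field : (V -> R) -> op V := sval bond_field_sealed.

Lemma bond_fieldE g : bond_field g =
  (2^-1 : R)%:C%C *: \sum_x \sum_(y | adj x y) (g x + g y)%:C%C *: (S1 x + S1 y).
Proof. exact: (congr1 (fun f => f g) (svalP bond_field_sealed)). Qed.

(** One factor 1/2 for the ordered pairs and one from the completed square. *)
Definition field_energy (g : V -> R) : R :=
  4^-1 * \sum_x \sum_(y | adj x y) (g x + g y) ^+ 2.

Lemma eta_adj x y : adj x y -> eta y = - eta x.
Proof.
by move=> /adj_par e; rewrite /sublattice_sign e; case: (par x); rewrite ?opprK.
Qed.

(** For the field h = t eta g, the sign eta changes along a bond, hence h_x - h_y = t eta_x (g_x +
    g_y); the remaining sign is absorbed by the rotated spins. *)
Lemma rot_bond (t : R) (g : V -> R) x y : adj x y ->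
  field_bond n (fun z => t * eta z * g z) x y =
  rot par (dot x y - t%:C%C *: ((g x + g y)%:C%C *: (S1 x + S1 y))
    + (t ^+ 2 * (g x + g y) ^+ 2 / 2)%:C%C *: 1%:M).
Proof.
move=> xy; rewrite field_bond_diff dotE !(rotD, rotN) !rotZ rot1 !rotD !rotM.
rewrite !rot_S1 !rot_S2 !rot_S3 (eta_adj xy).
have e2 := sublattice_sign_sqr R par x; move: (sublattice_sign R par x) e2 => c e2.
have -> : ((t * c * g x - t * - c * g y) ^+ 2 / 2)
    = t ^+ 2 * (g x + g y) ^+ 2 / 2.
  have -> : t * c * g x - t * - c * g y = t * c * (g x + g y) by ring.
  by rewrite !exprMn [c ^+ 2]expr2 e2 mulr1.
apply: rot_bond_algebra; first by rewrite -rmorphM e2.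
  by rewrite rmorphN.
by rewrite -!rmorphM; congr (_%:C)%C; ring.
Qed.

Lemma rot_ham B t g :
  field_ham n adj B (fun z => t * eta z * g z) =
  rot par (ham - B%:C%C *: staggered - t%:C%C *: bond_field g
    + (t ^+ 2 * field_energy g)%:C%C *: 1%:M).
Proof.
have -> : ham - B%:C%C *: staggered - t%:C%C *: bond_field g
    + (t ^+ 2 * field_energy g)%:C%C *: 1%:M =
    (2^-1 : R)%:C%C *: (\sum_x \sum_(y | adj x y)
      (dot x y - t%:C%C *: ((g x + g y)%:C%C *: (S1 x + S1 y))
        + (t ^+ 2 * (g x + g y) ^+ 2 / 2)%:C%C *: 1%:M))
    - B%:C%C *: staggered.
  have -> : \sum_x \sum_(y | adj x y)
      (dot x y - t%:C%C *: ((g x + g y)%:C%C *: (S1 x + S1 y))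
        + (t ^+ 2 * (g x + g y) ^+ 2 / 2)%:C%C *: 1%:M) =
    \sum_x \sum_(y | adj x y) dot x y
    - t%:C%C *: (\sum_x \sum_(y | adj x y) (g x + g y)%:C%C *: (S1 x + S1 y))
    + (\sum_x \sum_(y | adj x y) t ^+ 2 * (g x + g y) ^+ 2 / 2)%:C%C *: 1%:M.
    rewrite scaler_sumr (rmorph_sum (real_complex R)) /= scaler_suml -sumrB -big_split /=.
    apply: eq_bigr => x _.
    rewrite scaler_sumr (rmorph_sum (real_complex R)) /= scaler_suml -sumrB -big_split /=.
    by [].
  rewrite hamE bond_fieldE.
  move: (\sum_x \sum_(y | adj x y) dot x y) => X.
  move: (\sum_x \sum_(y | adj x y) (g x + g y)%:C%C *: (S1 x + S1 y)) => Y.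
  have -> : \sum_x \sum_(y | adj x y) t ^+ 2 * (g x + g y) ^+ 2 / 2
     = 2 * (t ^+ 2 * field_energy g).
    rewrite /field_energy !mulr_sumr; apply: eq_bigr => x _.
    by rewrite !mulr_sumr; apply: eq_bigr => y _; field.
  move: (t ^+ 2 * field_energy g) => r.
  rewrite scalerDr scalerBr !scalerA [((2^-1 : R)%:C)%C * t%:C%C]mulrC.
  have -> : ((2^-1 : R)%:C)%C * (2 * r)%:C%C = r%:C%C :> C.
    by rewrite -rmorphM mulKf ?pnatr_eq0.
  by rewrite [RHS]addrAC [X in _ = X + _]addrAC.
rewrite field_hamE rotD rotN !rotZ !rot_sum; congr (_ *: _ - _ *: _).
  apply: eq_bigr => x _; rewrite rot_sum; apply: eq_bigr => y xy.
  exact: rot_bond.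
rewrite staggeredE rot_sum; apply: eq_bigr => x _.
rewrite rotZ rot_S3 scalerA -rmorphM.
by have -> := sublattice_sign_sqr R par x; rewrite rmorph1 scale1r.
Qed.

Lemma bipartite_gaussian_domination B t g (E : R) :
    symmetric adj -> irreflexive adj ->
    (forall x y, adj x y -> exists (theta : V -> V) (left : pred V),
      [/\ involutive theta, forall z, left (theta z) = ~~ left z,
        forall z w, adj (theta z) (theta w) = adj z w,
        forall z w, left z -> ~~ left w -> adj z w -> w = theta z &
        left x /\ theta x = y]) ->
    lower_bound (ham - B%:C%C *: staggered) E ->
  lower_bound (ham - B%:C%C *: staggered - t%:C%C *: bond_field g
    + (t ^+ 2 * field_energy g)%:C%C%:M) E.
Proof.
move=> sym irr refl lb.
have e1 (r : R) : (r%:C%C%:M : op V) = r%:C%C *: 1%:M by rewrite scalemx1.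
rewrite e1; apply: (lower_bound_rot par _ _).1.
rewrite -rot_ham; apply: (gaussian_domination sym irr refl).
(* The reference energy is the same formula at t = 0 and g = 0, so the zero field is the rotation of
   the unperturbed Hamiltonian. *)
have hz : (fun z => 0 * eta z * 0) = (fun _ => 0).
  by apply: boolp.funext => x; rewrite mulr0.
have e0 : field_ham n adj B (fun _ => 0) = rot par (ham - B%:C%C *: staggered).
  rewrite -hz (rot_ham B 0 (fun _ => 0)); congr rot.
  by rewrite expr0n mul0r !scale0r subr0 addr0.
rewrite e0; exact: (lower_bound_rot par _ _).2 lb.
Qed.

End BipartiteHamiltonian.

(** * The transverse inequality *)

Section Commutators.
Variables (R : rcfType) (m : nat).
Local Notation C := R[i].
Implicit Types X Y Z : 'M[C]_m.

Definition comm_def X Y := X *m Y - Y *m X.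
Lemma comm_sealed : {f | f = comm_def}.
Proof. exact: seal. Qed.
Definition comm : 'M[C]_m -> 'M[C]_m -> 'M[C]_m := sval comm_sealed.

Lemma commE X Y : comm X Y = X *m Y - Y *m X.
Proof. exact: (congr1 (fun g => g X Y) (svalP comm_sealed)). Qed.

Lemma comm_mulr X Y Z : comm X (Y *m Z) = comm X Y *m Z + Y *m comm X Z.
Proof. by rewrite !commE mulmxBl mulmxBr !mulmxA addrA subrK. Qed.

Lemma commDr X Y Z : comm X (Y + Z) = comm X Y + comm X Z.
Proof. by rewrite !commE mulmxDl mulmxDr opprD addrACA. Qed.

Lemma commDl X Y Z : comm (X + Y) Z = comm X Z + comm Y Z.
Proof. by rewrite !commE mulmxDl mulmxDr opprD addrACA. Qed.

Lemma commNr X Y : comm X (- Y) = - comm X Y.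
Proof. by rewrite !commE mulmxN mulNmx -opprD. Qed.

Lemma commZr X a Y : comm X (a *: Y) = a *: comm X Y.
Proof. by rewrite !commE -scalemxAl -scalemxAr scalerBr. Qed.

Lemma commZl X a Y : comm (a *: X) Y = a *: comm X Y.
Proof. by rewrite !commE -scalemxAl -scalemxAr scalerBr. Qed.

Lemma comm0r X : comm X 0 = 0.
Proof. by rewrite commE mulmx0 mul0mx subr0. Qed.

Lemma comm0l X : comm 0 X = 0.
Proof. by rewrite commE mulmx0 mul0mx subr0. Qed.

Lemma comm_sumr X I (r : seq I) (P : pred I) (F : I -> 'M[C]_m) :
  comm X (\sum_(i <- r | P i) F i) = \sum_(i <- r | P i) comm X (F i).
Proof. exact: (big_morph _ (commDr X) (comm0r X)). Qed.

Lemma comm_suml X I (r : seq I) (P : pred I) (F : I -> 'M[C]_m) :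
  comm (\sum_(i <- r | P i) F i) X = \sum_(i <- r | P i) comm (F i) X.
Proof. exact: (big_morph (comm^~ X) (fun A B => commDl A B X) (comm0l X)). Qed.

Lemma comm_linear4 T a b X Y :
  comm T (a *: X + b *: Y + (- (a *: Y) - b *: X)) =
  a *: comm T X + b *: comm T Y + (- (a *: comm T Y) - b *: comm T X).
Proof. by rewrite !commDr !commNr !commZr. Qed.

Lemma comm_anti X Y : comm X Y = - comm Y X.
Proof. by rewrite !commE opprB. Qed.

Lemma comm_self X : comm X X = 0.
Proof. by rewrite commE subrr. Qed.

(** - [A, [A, H]] = 2 A H A - A^2 H - H A^2, and H acts as E from either side. *)
Lemma rstate_double_comm (f : 'M[C]_m -> R) (H A : 'M[C]_m) E : is_rstate f ->
    (forall X, f (H *m X) = E * f X) -> (forall X, f (X *m H) = E * f X) ->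
  2 * (f (A *m H *m A) - E * f (A *m A)) = - f (comm A (comm A H)).
Proof.
move=> hf fH fH'; rewrite !commE mulmxBr mulmxBl !mulmxA.
have lin (P Q S T : 'M[C]_m) : f (P - Q - (S - T)) = f P - f Q - (f S - f T).
  by rewrite !(rstateB hf).
rewrite lin (fH' (A *m A)) -(mulmxA H) (fH (A *m A)).
by move: (f (A *m H *m A)) (f (A *m A)) => a b; ring.
Qed.

End Commutators.

(** * Double commutators and bounds on spin expectations *)

Section SpinCommutators.
Variables (R : realType) (n : nat) (V : finType).
Local Notation C := R[i].
Local Notation cfg V := {ffun V -> 'I_n.+1}.
Local Notation op V := 'M[C]_#|{: cfg V}|.
Local Notation S1 := (S1_ R n).
Local Notation S2 := (S2_ R n).
Local Notation S3 := (S3_ R n).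

Lemma sop_comm (x : V) (M N : 'M[C]_n.+1) :
  comm (sop x M) (sop x N) = sop x (M *m N - N *m M).
Proof. by rewrite commE sopB !sopM. Qed.

Lemma sop_comm0 (x y : V) (M N : 'M[C]_n.+1) : x != y ->
  comm (sop x M) (sop y N) = 0.
Proof. by move=> xy; rewrite commE sop_commute // subrr. Qed.

Lemma comm_S12 (x : V) : comm (S1 x) (S2 x) = 'i%C *: S3 x.
Proof. by rewrite S1_E S2_E S3_E sop_comm s12 sopZ. Qed.

Lemma comm_S13 (x : V) : comm (S1 x) (S3 x) = - ('i%C *: S2 x).
Proof. by rewrite comm_anti S1_E S2_E S3_E sop_comm s31 sopZ. Qed.

Definition total_spin_def (F : V -> R) : op V := \sum_x (F x)%:C%C *: S1 x.
Lemma total_spin_sealed : {f | f = total_spin_def}.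
Proof. exact: seal. Qed.
Definition total_spin : (V -> R) -> op V := sval total_spin_sealed.

Lemma total_spinE F : total_spin F = \sum_x (F x)%:C%C *: S1 x.
Proof. exact: (congr1 (fun g => g F) (svalP total_spin_sealed)). Qed.

Lemma total_spin_herm F : dag (total_spin F) = total_spin F.
Proof.
rewrite total_spinE dag_sum; apply: eq_bigr => x _.
by rewrite dagZ conjc_real S1_herm.
Qed.

Lemma comm_total_sop F x (M : 'M[C]_n.+1) :
  comm (total_spin F) (sop x M) = (F x)%:C%C *: comm (S1 x) (sop x M).
Proof.
rewrite total_spinE comm_suml (bigD1 x) //= big1 ?addr0 ?commZl // => y yx.
by rewrite commZl S1_E sop_comm0 // scaler0.
Qed.

Lemma comm_total_S1 F x : comm (total_spin F) (S1 x) = 0.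
Proof. by rewrite {1}S1_E comm_total_sop -S1_E comm_self scaler0. Qed.

Lemma comm_total_S2 F x :
  comm (total_spin F) (S2 x) = ((F x)%:C%C * 'i%C) *: S3 x.
Proof. by rewrite {1}S2_E comm_total_sop -S2_E comm_S12 scalerA. Qed.

Lemma comm_total_S3 F x :
  comm (total_spin F) (S3 x) = - (((F x)%:C%C * 'i%C) *: S2 x).
Proof. by rewrite {1}S3_E comm_total_sop -S3_E comm_S13 scalerN scalerA. Qed.

Lemma double_comm_S3 F x :
  comm (total_spin F) (comm (total_spin F) (S3 x)) = (F x ^+ 2)%:C%C *: S3 x.
Proof.
rewrite comm_total_S3 commNr commZr comm_total_S2 scalerA -scaleNr.
by rewrite mulrACA ii mulrN1 opprK -rmorphM.
Qed.

Lemma bond_double_comm_algebra (F : comPzRingType) k (p q i : F)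
    (a b : 'M[F]_k) : i * i = -1 ->
  (p * i) *: (- ((p * i) *: a) + (q * i) *: b)
  + (q * i) *: ((p * i) *: b - (q * i) *: a)
  + (- ((p * i) *: ((p * i) *: b - (q * i) *: a))
     - (q * i) *: (- ((p * i) *: a) + (q * i) *: b))
  = ((p - q) ^+ 2) *: (a + b).
Proof.
move=> i2; apply/matrixP => k1 k2; rewrite !mxE.
have -> : (p - q) ^+ 2 = (p - q) ^+ 2 * (- (i * i)) by rewrite i2 opprK mulr1.
ring.
Qed.

(** A rotation common to both sites leaves their scalar product invariant, so only the difference
    F_x - F_y can enter. *)
Lemma double_comm_dot F x y :
  comm (total_spin F) (comm (total_spin F) (dot R n x y)) =
  ((F x - F y) ^+ 2)%:C%C *: (S2 x *m S2 y + S3 x *m S3 y).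
Proof.
have e1 : comm (total_spin F) (dot R n x y) =
    ((F x)%:C%C * 'i%C) *: (S3 x *m S2 y) + ((F y)%:C%C * 'i%C) *: (S2 x *m S3 y)
    + (- (((F x)%:C%C * 'i%C) *: (S2 x *m S3 y))
       - ((F y)%:C%C * 'i%C) *: (S3 x *m S2 y)).
  rewrite dotE !commDr !comm_mulr !comm_total_S1 !comm_total_S2 !comm_total_S3.
  by rewrite mul0mx mulmx0 addr0 add0r !mulNmx !mulmxN -!scalemxAl -!scalemxAr.
have e32 : comm (total_spin F) (S3 x *m S2 y) =
    - (((F x)%:C%C * 'i%C) *: (S2 x *m S2 y))
    + ((F y)%:C%C * 'i%C) *: (S3 x *m S3 y).
  by rewrite comm_mulr comm_total_S2 comm_total_S3 mulNmx -scalemxAl -scalemxAr.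
have e23 : comm (total_spin F) (S2 x *m S3 y) =
    ((F x)%:C%C * 'i%C) *: (S3 x *m S3 y)
    - ((F y)%:C%C * 'i%C) *: (S2 x *m S2 y).
  rewrite comm_mulr comm_total_S2 comm_total_S3 mulmxN -scalemxAl -scalemxAr.
  by [].
have -> : ((F x - F y) ^+ 2)%:C%C = ((F x)%:C%C - (F y)%:C%C) ^+ 2 :> C.
  by rewrite -rmorphB -rmorphXn.
rewrite e1 comm_linear4 e32 e23; apply: bond_double_comm_algebra.
exact: ii.
Qed.

Lemma sop_herm_sum (x y : V) : x != y ->
  S2 x *m S2 y = S2 y *m S2 x /\ S3 x *m S3 y = S3 y *m S3 x.
Proof. by move=> xy; rewrite !S2_E !S3_E !(sop_commute _ _ xy). Qed.

Section StateBounds.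
Variable f : op V -> R.
Hypothesis hf : is_rstate f.
Local Notation kappa := (casimir R n).

Lemma rstate_casimir x :
  f (S1 x *m S1 x) + f (S2 x *m S2 x) + f (S3 x *m S3 x) = kappa.
Proof.
rewrite -!(rstateD hf) S1_E S2_E S3_E -!sopM -!sopD spin_casimir -scalemx1.
by rewrite sopZ sop1 (rstateZ hf) (rstate1 hf) mulr1.
Qed.

Lemma rstate_S2_sqr x : f (S2 x *m S2 x) <= kappa.
Proof.
rewrite -(rstate_casimir x).
have := rstate_herm_sqr_ge0 hf (S1_herm R n x).
have := rstate_herm_sqr_ge0 hf (S3_herm R n x).
move: (f (S1 x *m S1 x)) (f (S2 x *m S2 x)) (f (S3 x *m S3 x)) => a b c; lra.
Qed.

Lemma rstate_S3_sqr x : f (S3 x *m S3 x) <= kappa.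
Proof.
rewrite -(rstate_casimir x).
have := rstate_herm_sqr_ge0 hf (S1_herm R n x).
have := rstate_herm_sqr_ge0 hf (S2_herm R n x).
move: (f (S1 x *m S1 x)) (f (S2 x *m S2 x)) (f (S3 x *m S3 x)) => a b c; lra.
Qed.

Lemma rstate_S1_sqr x : f (S1 x *m S1 x) <= kappa.
Proof.
rewrite -(rstate_casimir x).
have := rstate_herm_sqr_ge0 hf (S3_herm R n x).
have := rstate_herm_sqr_ge0 hf (S2_herm R n x).
move: (f (S1 x *m S1 x)) (f (S2 x *m S2 x)) (f (S3 x *m S3 x)) => a b c; lra.
Qed.

(** Positivity on P + Q and on P - Q gives 2 |f(P Q)| <= f(P^2) + f(Q^2) when P and Q commute. *)
Lemma rstate_product_le (P Q : op V) : dag P = P -> dag Q = Q ->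
    P *m Q = Q *m P -> f (P *m P) <= kappa -> f (Q *m Q) <= kappa ->
  `|f (P *m Q)| <= kappa.
Proof.
move=> hP hQ PQ fP fQ.
have hD : dag (P + Q) = P + Q by rewrite dagD hP hQ.
have hB : dag (P - Q) = P - Q by rewrite dagD dagN hP hQ.
have := rstate_herm_sqr_ge0 hf hD; have := rstate_herm_sqr_ge0 hf hB.
rewrite mulmxBl mulmxDl !mulmxDr !mulmxN -PQ !(rstateD hf, rstateN hf).
move: fP fQ; move: (f (P *m P)) (f (Q *m Q)) (f (P *m Q)) => a b c h1 h2 h3 h4.
rewrite ler_norml; apply/andP; split; lra.
Qed.

(** Positivity on 1 + S3 and on 1 - S3; this avoids square roots at the price of the constant. *)
Lemma rstate_S3_le x : `|f (S3 x)| <= (kappa + 1) / 2.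
Proof.
have hD : dag (1%:M + S3 x) = 1%:M + S3 x by rewrite dagD dag1 S3_herm.
have hB : dag (1%:M - S3 x) = 1%:M - S3 x by rewrite dagD dagN dag1 S3_herm.
have := rstate_herm_sqr_ge0 hf hD; have := rstate_herm_sqr_ge0 hf hB.
rewrite mulmxBl mulmxDl !mulmxDr !mulmxN !mul1mx mulmx1.
rewrite !(rstateD hf, rstateN hf) (rstate1 hf).
have := rstate_S3_sqr x.
move: (f (S3 x *m S3 x)) (f (S3 x)) => a b h1 h2 h3.
rewrite ler_norml; apply/andP; split; lra.
Qed.

Lemma rstate_S22_le x y : `|f (S2 x *m S2 y)| <= kappa.
Proof.
have [->|xy] := eqVneq x y.
  rewrite ger0_norm ?rstate_S2_sqr //.
  exact: (rstate_herm_sqr_ge0 hf (S2_herm R n y)).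
apply: rstate_product_le; rewrite ?S2_herm ?rstate_S2_sqr //.
by have [] := sop_herm_sum xy.
Qed.

Lemma rstate_S33_le x y : `|f (S3 x *m S3 y)| <= kappa.
Proof.
have [->|xy] := eqVneq x y.
  rewrite ger0_norm ?rstate_S3_sqr //.
  exact: (rstate_herm_sqr_ge0 hf (S3_herm R n y)).
apply: rstate_product_le; rewrite ?S3_herm ?rstate_S3_sqr //.
by have [] := sop_herm_sum xy.
Qed.

Lemma rstate_S11_le x y : `|f (S1 x *m S1 y)| <= kappa.
Proof.
have [->|xy] := eqVneq x y.
  rewrite ger0_norm ?rstate_S1_sqr //.
  exact: (rstate_herm_sqr_ge0 hf (S1_herm R n y)).
apply: rstate_product_le; rewrite ?S1_herm ?rstate_S1_sqr //.
by rewrite !S1_E (sop_commute _ _ xy).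
Qed.

Lemma rstate_dot_le x y : `|f (dot R n x y)| <= 3 * kappa.
Proof.
rewrite dotE !(rstateD hf).
have := rstate_S11_le x y; have := rstate_S22_le x y; have := rstate_S33_le x y.
move: (f (S1 x *m S1 y)) (f (S2 x *m S2 y)) (f (S3 x *m S3 y)) => a b c.
rewrite !ler_norml.
move=> /andP[h1 h2] /andP[h3 h4] /andP[h5 h6]; apply/andP; split; lra.
Qed.

End StateBounds.

End SpinCommutators.

Lemma eq_add3 (Z : nmodType) (a b c a' b' c' : Z) :
  a = a' -> b = b' -> c = c' -> a + b + c = a' + b' + c'.
Proof. by move=> -> -> ->. Qed.

Lemma half_double (R : rcfType) m p (X : 'M[R[i]]_(m, p)) :
  (2^-1 : R)%:C%C *: (X + X) = X.
Proof.
rewrite -mulr2n -scalerMnr scalerMnl -(rmorphMn (real_complex R)).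
have -> : 2^-1 *+ 2 = 1 :> R by rewrite -[LHS]mulr_natr mulVf // pnatr_eq0.
by rewrite rmorph1 scale1r.
Qed.

(** * The inequality for the ground state on a bipartite graph *)

Section TransverseInequality.
Variables (R : realType) (n : nat) (V : finType) (adj : rel V) (par : pred V).
Local Notation C := R[i].
Local Notation cfg V := {ffun V -> 'I_n.+1}.
Local Notation op V := 'M[C]_#|{: cfg V}|.
Local Notation S1 := (S1_ R n).
Local Notation S2 := (S2_ R n).
Local Notation S3 := (S3_ R n).
Local Notation eta := (sublattice_sign R par).
Local Notation kappa := (casimir R n).
Hypothesis adj_sym : symmetric adj.
Hypothesis adj_irr : irreflexive adj.
Hypothesis adj_par : forall x y, adj x y -> par y = ~~ par x.
Hypothesis reflections : forall x y, adj x y ->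
  exists (theta : V -> V) (left : pred V),
    [/\ involutive theta, forall z, left (theta z) = ~~ left z,
        forall z w, adj (theta z) (theta w) = adj z w,
        forall z w, left z -> ~~ left w -> adj z w -> w = theta z &
        left x /\ theta x = y].

(** The coefficient F_x of S1_x in A. *)
Definition bond_weight (g : V -> R) (x : V) : R := \sum_(y | adj x y) (g x + g y).

Lemma bond_field_total g : bond_field n adj g = total_spin n (bond_weight g).
Proof.
rewrite bond_fieldE total_spinE.
have -> : \sum_x \sum_(y | adj x y) (g x + g y)%:C%C *: (S1 x + S1 y) =
    \sum_x \sum_(y | adj x y) (g x + g y)%:C%C *: S1 x
    + \sum_x \sum_(y | adj x y) (g x + g y)%:C%C *: S1 y.
  rewrite -big_split; apply: eq_bigr => x _; rewrite -big_split.
  by apply: eq_bigr => y _; rewrite scalerDr.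
have -> : \sum_x \sum_(y | adj x y) (g x + g y)%:C%C *: S1 y =
    \sum_x \sum_(y | adj x y) (g x + g y)%:C%C *: S1 x.
  rewrite (exchange_big_dep predT) //=; apply: eq_bigr => x _.
  by apply: eq_big => [y|y _]; [exact: adj_sym|rewrite addrC].
have -> : \sum_x \sum_(y | adj x y) (g x + g y)%:C%C *: S1 x =
    \sum_x (bond_weight g x)%:C%C *: S1 x.
  apply: eq_bigr => x _; rewrite -scaler_suml; congr (_ *: _).
  by rewrite (rmorph_sum (real_complex R)).
exact: half_double.
Qed.

Lemma ham_herm : dag (ham R n adj) = ham R n adj.
Proof.
rewrite hamE dagZ conjc_real dag_sum; congr (_ *: _).
apply: eq_bigr => x _; rewrite dag_sum; apply: eq_bigr => y xy.
have xny : x != y by apply: contraTneq xy => ->; rewrite adj_irr.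
rewrite dotE !dagD !dagM !S1_herm !S2_herm !S3_herm.
have yx : y != x by rewrite eq_sym.
by apply: eq_add3; rewrite ?S1_E ?S2_E ?S3_E; exact: sop_commute.
Qed.

Lemma staggered_herm : dag (staggered R n par) = staggered R n par.
Proof.
rewrite staggeredE dag_sum; apply: eq_bigr => x _.
by rewrite dagZ conjc_real S3_herm.
Qed.


Definition transverse_def (b : V -> R) : op V := \sum_x (eta x * b x)%:C%C *: S2 x.
Lemma transverse_sealed : {f | f = transverse_def}.
Proof. exact: seal. Qed.
Definition transverse : (V -> R) -> op V := sval transverse_sealed.

Lemma transverseE b : transverse b = \sum_x (eta x * b x)%:C%C *: S2 x.
Proof. exact: (congr1 (fun g => g b) (svalP transverse_sealed)). Qed.

Lemma transverse_herm b : dag (transverse b) = transverse b.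
Proof.
rewrite transverseE dag_sum; apply: eq_bigr => x _.
by rewrite dagZ conjc_real S2_herm.
Qed.

Section GroundState.
Variables (f : op V -> R) (B E : R).
Local Notation H := (ham R n adj - B%:C%C *: staggered R n par).
Hypothesis hf : is_rstate f.
Hypothesis B_ge0 : 0 <= B.
Hypothesis lbH : lower_bound H E.
Hypothesis fH : forall X, f (H *m X) = E * f X.
Hypothesis fH' : forall X, f (X *m H) = E * f X.

Lemma H_herm : dag H = H.
Proof. by rewrite dagD dagN dagZ conjc_real ham_herm staggered_herm. Qed.

Lemma double_comm_energy (F : V -> R) :
  comm (total_spin n F) (comm (total_spin n F) H) =
  (2^-1 : R)%:C%C *: (\sum_x \sum_(y | adj x y)
    ((F x - F y) ^+ 2)%:C%C *: (S2 x *m S2 y + S3 x *m S3 y))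
  - B%:C%C *: \sum_x (eta x * F x ^+ 2)%:C%C *: S3 x.
Proof.
rewrite !(commDr, commNr, commZr) hamE staggeredE !commZr.
rewrite (comm_sumr _ _ _ (fun x => \sum_(y | adj x y) dot R n x y)).
rewrite (comm_sumr _ _ _ (fun x => comm _ (\sum_(y | adj x y) dot R n x y))).
rewrite (comm_sumr _ _ _ (fun x => (eta x)%:C%C *: S3 x)).
rewrite (comm_sumr _ _ _ (fun x => comm _ ((eta x)%:C%C *: S3 x))).
apply: eq_scale_sub; apply: eq_bigr => x _.
  by rewrite !comm_sumr; apply: eq_bigr => y _; exact: double_comm_dot.
rewrite !commZr double_comm_S3 scalerA; congr (_ *: _).
by rewrite -rmorphM.
Qed.

Lemma rstate_double_comm_le (F : V -> R) :
  - f (comm (total_spin n F) (comm (total_spin n F) H)) <=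
  kappa * (\sum_x \sum_(y | adj x y) (F x - F y) ^+ 2)
  + B * ((kappa + 1) / 2) * \sum_x F x ^+ 2.
Proof.
rewrite double_comm_energy (rstateB hf) !(rstateZ hf) opprB addrC.
apply: lerD; last first.
  rewrite -mulrA; apply: ler_wpM2l => //.
  rewrite (rstate_sum hf) mulr_sumr; apply: ler_sum => x _.
  rewrite (rstateZ hf); apply: le_trans (ler_norm _) _.
  rewrite (normrM (eta x * F x ^+ 2)) (normrM (eta x)).
  rewrite (ger0_norm (sqr_ge0 (F x))).
  have -> : `|eta x| = 1.
    by rewrite /sublattice_sign; case: (par x); rewrite ?normrN1 ?normr1.
  rewrite mul1r mulrC; apply: ler_wpM2r; first exact: sqr_ge0.
  exact: rstate_S3_le.
rewrite -mulrN (rstate_sum hf) -sumrN !mulr_sumr; apply: ler_sum => x _.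
rewrite (rstate_sum hf) -sumrN !mulr_sumr; apply: ler_sum => y _.
rewrite (rstateZ hf) (rstateD hf).
have := rstate_S22_le hf x y; have := rstate_S33_le hf x y.
move: (f (S2 x *m S2 y)) (f (S3 x *m S3 y)) => a b.
rewrite !ler_norml => /andP[h1 h2] /andP[h3 h4].
have := sqr_ge0 (F x - F y); move: ((F x - F y) ^+ 2) => w w0.
have : 0 <= w * (2 * kappa + a + b) by apply: mulr_ge0 => //; lra.
nra.
Qed.

Lemma rstate_spin_commutator (F b : V -> R) :
  f ('i%C *: (total_spin n F *m transverse b - transverse b *m total_spin n F))
  = - \sum_x F x * b x * (eta x * f (S3 x)).
Proof.
rewrite -commE transverseE comm_sumr scaler_sumr (rstate_sum hf) -sumrN.
apply: eq_bigr => x _; rewrite commZr comm_total_S2 !scalerA.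
have scal (p q i : C) : i * p * (q * i) = p * q * (i * i) by ring.
rewrite scal ii mulrN1 -rmorphM -rmorphN (rstateZ hf).
by move: (f (S3 x)) => v; ring.
Qed.

(** Let a = f(A^2), T the order parameter on the right, X the sum on the left, G the field energy, K
    the bound on the double commutator. The uncertainty relation gives X^2 <= 4 a T and linear
    response gives 2 a^2 <= G K, whence X^4 <= 16 a^2 T^2 <= 8 G K T^2. *)
Theorem transverse_inequality (g b : V -> R) :
  (\sum_x bond_weight g x * b x * (eta x * f (S3 x))) ^+ 4 <=
  8 * field_energy adj g *
  (kappa * (\sum_x \sum_(y | adj x y) (bond_weight g x - bond_weight g y) ^+ 2)
   + B * ((kappa + 1) / 2) * \sum_x bond_weight g x ^+ 2)
  * f (transverse b *m transverse b) ^+ 2.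
Proof.
set F := bond_weight g; set A := total_spin n F.
have hA : dag A = A by exact: total_spin_herm.
have gd : f (A *m A) ^+ 2 <=
    field_energy adj g * (f (A *m H *m A) - E * f (A *m A)).
  apply: (rstate_gaussian_domination hf H_herm hA fH fH') => t.
  rewrite /A -bond_field_total.
  exact: (bipartite_gaussian_domination adj_par).
have dc := rstate_double_comm A hf fH fH'.
have dl := rstate_double_comm_le F; rewrite -/A -dc in dl.
have un := rstate_uncertainty hf hA (transverse_herm b).
rewrite rstate_spin_commutator sqrrN in un.
have AA0 := rstate_herm_sqr_ge0 hf hA.
have TT0 := rstate_herm_sqr_ge0 hf (transverse_herm b).
have G0 : 0 <= field_energy adj g.
  apply: mulr_ge0; first by rewrite invr_ge0 ler0n.
  by apply: sumr_ge0 => x _; apply: sumr_ge0 => y _; exact: sqr_ge0.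
move: gd dl un AA0 TT0 G0.
move: (field_energy adj g) (f (A *m A)) (f (A *m H *m A)).
move: (f (transverse b *m transverse b)) (\sum_x _ * _ * _).
move: (kappa * _ + _) => K T X G a c gd dl un a0 T0 G0.
have -> : X ^+ 4 = (X ^+ 2) ^+ 2 by rewrite -exprM.
apply: (@le_trans _ _ ((4 * a * T) ^+ 2)).
  by rewrite ler_pXn2r // nnegrE ?sqr_ge0 // !mulr_ge0.
have -> : (4 * a * T) ^+ 2 = 16 * a ^+ 2 * T ^+ 2 by ring.
apply: ler_wpM2r; first exact: sqr_ge0.
have : G * (2 * (c - E * a)) <= G * K by apply: ler_wpM2l.
nra.
Qed.

End GroundState.

End TransverseInequality.

(** * The torus *)

Section Torus.
Variables (d m : nat).
Local Notation N := m.*2.+2.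
Local Notation box := (Box d m).
Local Notation vbox := {ffun 'I_d -> 'I_N}.

(** Addition of residues modulo 2m + 2, the ring structure of the index type; periodic adjacency
    becomes a step by a unit vector. *)
Definition add_box (b c : box) : box := (b : vbox) + (c : vbox).
Definition unit_box (i : 'I_d) : box := [ffun j => if j == i then 1 else 0].

Lemma add_boxC b c : add_box b c = add_box c b.
Proof. exact: addrC. Qed.

Lemma add_boxA a b c : add_box a (add_box b c) = add_box (add_box a b) c.
Proof. exact: addrA. Qed.

Lemma add_box_inj b : injective (add_box b).
Proof. exact: addrI. Qed.

Lemma val_ordD (a b : 'I_N) : (a + b)%R = ((a + b) %% N)%N :> nat.
Proof. by []. Qed.

Lemma val_ordN (a : 'I_N) : (- a)%R = ((N - a) %% N)%N :> nat.
Proof. by []. Qed.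

Lemma val_ord1 : (1 : 'I_N) = 1%N :> nat.
Proof. by []. Qed.

Lemma val_ordNB1 (k : 'I_N) : (- k - 1)%R = (N - 1 - k)%N :> nat.
Proof.
rewrite val_ordD !val_ordN val_ord1 modnDm; have kN := ltn_ord k.
have -> : (N - k + (N - 1) = (N - 1 - k) + N)%N by lia.
by rewrite modnDr modn_small //; lia.
Qed.

Lemma adjpP (b c : box) :
  reflect (exists i, c = add_box b (unit_box i) \/ b = add_box c (unit_box i))
    (adjp b c).
Proof.
have step (x y : box) i : ((x i).+1 %% N == y i)%N ->
    (forall j, j != i -> x j = y j) -> y = add_box x (unit_box i).
  move=> /eqP e h; apply/ffunP => j; rewrite !ffunE.
  case: (eqVneq j i) => [->|/h ->]; last by rewrite addr0.
  by apply: ord_inj; rewrite val_ordD val_ord1 addn1 e.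
apply: (iffP existsP) => [[i /andP[/orP[e|e] /forallP h]]|[i e]].
- exists i; left; apply: step e _ => j ji.
  by have := h j; rewrite ji => /eqP.
- exists i; right; apply: step e _ => j ji.
  by have := h j; rewrite ji => /eqP.
- have step' (x y : box) : y = add_box x (unit_box i) ->
      ((x i).+1 %% N == y i)%N && [forall j, (j != i) ==> (x j == y j)].
    move=> ->; rewrite !ffunE eqxx val_ordD val_ord1 addn1 eqxx /=.
    apply/forallP => j; apply/implyP => ji; rewrite !ffunE (negPf ji) addr0.
    exact: eqxx.
  exists i; case: e => /step' /andP[e h]; rewrite e ?orbT //=.
  by apply/forallP => j; have /forallP/(_ j) := h; rewrite (eq_sym (c j)).
Qed.

Lemma adjp_sym : symmetric (@adjp d m).
Proof.
by move=> b c; apply/adjpP/adjpP => -[i [e|e]]; exists i; [right|left|right|left].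
Qed.

Lemma adjp_irr : irreflexive (@adjp d m).
Proof.
move=> b; apply/negbTE/negP => /adjpP[i e].
have {e} : b = add_box b (unit_box i) by case: e.
move=> /ffunP/(_ i); rewrite !ffunE eqxx => /eqP.
by rewrite -subr_eq0 opprD addrA subrr add0r oppr_eq0 oner_eq0.
Qed.

Lemma adjp_add v b c : adjp (add_box v b) (add_box v c) = adjp b c.
Proof.
apply/adjpP/adjpP => -[i e]; exists i; case: e => e; [left|right|left|right];
  rewrite ?e ?add_boxA //; apply: (@add_box_inj v); by rewrite e add_boxA.
Qed.

(** With s = 2a + 1 this exchanges a and a + 1: the mirror lies between sites and has no fixed site,
    as the side is even. *)
Definition reflect_box (i : 'I_d) (s : 'I_N) (b : box) : box :=
  [ffun j => if j == i then s - b j else b j].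

Lemma reflect_boxK i s : involutive (reflect_box i s).
Proof.
move=> b; apply/ffunP => j; rewrite !ffunE; case: eqP => // _.
by rewrite opprB addrC subrK.
Qed.

Lemma reflect_box_unit i s b j :
  reflect_box i s (add_box b (unit_box j)) =
    add_box (reflect_box i s b) (unit_box j) \/
  reflect_box i s b =
    add_box (reflect_box i s (add_box b (unit_box j))) (unit_box j).
Proof.
have [->|ji] := eqVneq j i; [right|left]; apply/ffunP => k; rewrite !ffunE.
  case: eqP => [->|_]; last by rewrite !addr0.
  by rewrite opprD addrA subrK.
case: (eqVneq k j) => [->|_]; first by rewrite (negPf ji).
by rewrite !addr0.
Qed.

Lemma adjp_reflect i s b c :
  adjp (reflect_box i s b) (reflect_box i s c) = adjp b c.
Proof.
have half b' c' : adjp b' c' -> adjp (reflect_box i s b') (reflect_box i s c').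
  move=> /adjpP[j [->|->]]; apply/adjpP; exists j.
    exact: reflect_box_unit.
  by have [|] := reflect_box_unit i s c' j; [right|left].
apply/idP/idP => [/half|/half //]; by rewrite !reflect_boxK.
Qed.

(** Counted from y, the residues m+1, ..., 2m+1, half of the torus; the site y has residue 0 and is
    outside, its predecessor has residue 2m+1 and is inside. *)
Definition half_box (i : 'I_d) (y : 'I_N) (z : box) : bool :=
  (m < (z i - y)%R)%N.

Lemma half_box_reflect i (x y : 'I_N) z : y = x + 1 ->
  half_box i y (reflect_box i (x + y) z) = ~~ half_box i y z.
Proof.
move=> yx; rewrite /half_box ffunE eqxx.
have -> : x + y - z i - y = - (z i - y) - 1.
  by rewrite opprB addrAC addrK yx [X in _ = X - 1]addrAC addrK.
move: (z i - y) => k; rewrite val_ordNB1; have kN := ltn_ord k; lia.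
Qed.

(** On a torus the boundary of a half has two components. In residues a crossing bond is {2m+1, 0}
    or {m, m+1}, and both pairs are exchanged by k -> - k - 1. *)
Lemma half_box_cross i (x y : 'I_N) z w : y = x + 1 ->
    half_box i y z -> ~~ half_box i y w -> adjp z w ->
  w = reflect_box i (x + y) z.
Proof.
move=> yx hz hw /adjpP[j zw].
have ij : j = i.
  apply/eqP; apply: contraTT hz => ji.
  suff -> : half_box i y z = half_box i y w by [].
  rewrite /half_box; case: zw => ->; rewrite ffunE [unit_box j i]ffunE eq_sym;
    by rewrite (negPf ji) addr0.
rewrite {j}ij in zw; apply/ffunP => k; rewrite ffunE; case: eqP => [->|/eqP ki].
  move: hz hw; rewrite /half_box.
  have e : w i - y = z i - y + 1 \/ z i - y = w i - y + 1.
    case: zw => ->; rewrite !ffunE eqxx; [left|right]; by rewrite addrAC.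
  move=> hz hw; suff ew : w i - y = - (z i - y) - 1.
    by rewrite -[w i](subrK y) ew yx; ring.
  move: (z i - y) (w i - y) e hz hw => p q e hp hq; apply: ord_inj.
  rewrite val_ordNB1; have pN := ltn_ord p; have qN := ltn_ord q.
  case: e => e; move: hp hq; rewrite e val_ordD val_ord1.
    case: (ltnP p.+1 N) => pl; first by rewrite addn1 modn_small //; lia.
    have -> : (p + 1 = N)%N by lia.
    by rewrite modnn => _ _; lia.
  case: (ltnP q.+1 N) => ql; first by rewrite addn1 modn_small //; lia.
  have -> : (q + 1 = N)%N by lia.
  by rewrite modnn.
by case: zw => ->; rewrite !ffunE (negPf ki) addr0.
Qed.

Lemma adjp_reflections (x y : box) : adjp x y ->
  exists (theta : box -> box) (left : pred box),
    [/\ involutive theta, forall z, left (theta z) = ~~ left z,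
        forall z w, adjp (theta z) (theta w) = adjp z w,
        forall z w, left z -> ~~ left w -> adjp z w -> w = theta z &
        left x /\ theta x = y].
Proof.
have self (a : 'I_N) : (m < (a - (a + 1))%R)%N.
  rewrite opprD addrA subrr add0r val_ordN val_ord1 modn_small; lia.
have refl_unit (a b : box) i : b = add_box a (unit_box i) ->
    reflect_box i (a i + b i) a = b.
  move=> ->; apply/ffunP => j; rewrite !ffunE.
  case: (eqVneq j i) => [->|_]; last by rewrite addr0.
  by rewrite eqxx addrC addrA addNr add0r.
move=> /adjpP[i [e|e]].
  have yx : y i = x i + 1 by rewrite e !ffunE eqxx.
  exists (reflect_box i (x i + y i)), (half_box i (y i)); split.
  - exact: reflect_boxK.
  - by move=> z; exact: half_box_reflect.
  - by move=> z w; exact: adjp_reflect.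
  - by move=> z w; exact: half_box_cross.
  - split; first by rewrite /half_box yx self.
    exact: refl_unit.
have xy : x i = y i + 1 by rewrite e !ffunE eqxx.
(* For a bond in the negative direction the complementary half is taken, so that it contains x. *)
exists (reflect_box i (y i + x i)), (fun z => ~~ half_box i (x i) z); split.
- exact: reflect_boxK.
- by move=> z; rewrite half_box_reflect.
- by move=> z w; exact: adjp_reflect.
- move=> z w; rewrite negbK => hz hw zw.
  rewrite adjp_sym in zw; rewrite [z in RHS](half_box_cross xy hw hz zw).
  by rewrite reflect_boxK.
- have h0 : (x i - x i)%R = 0%N :> nat by rewrite subrr.
  split; first by rewrite /half_box h0.
  by rewrite -[in RHS](reflect_boxK i (y i + x i) y) (refl_unit _ _ _ e).
Qed.

Definition parity (b : box) : bool := odd (absz (\sum_(i < d) pt b i)).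
(** Parity of the raw indices, which differs from [parity] by the constant d m. It is additive on
    the torus because the side 2m + 2 is even. *)
Definition index_parity (b : box) : bool := odd (\sum_(i < d) (b i : nat)).

Lemma odd_absz_natB (p q : nat) : odd (absz (p%:Z - q%:Z)) = odd p (+) odd q.
Proof.
case: (leqP q p) => h; first by rewrite subzn // absz_nat oddB.
by rewrite -opprB abszN subzn ?(ltnW h) // absz_nat oddB ?(ltnW h) // addbC.
Qed.

Lemma parityE b : parity b = index_parity b (+) odd (d * m).
Proof.
rewrite /parity /index_parity -odd_absz_natB sumrB sumr_const card_ord.
by rewrite -[RHS]/(odd `|_ - (d * m)%:Z|) PoszM -mulr_natl natz (big_morph Posz PoszD erefl).
Qed.

Lemma index_parity_add b c :
  index_parity (add_box b c) = index_parity b (+) index_parity c.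
Proof.
rewrite /index_parity -oddD -big_split /=; apply: (big_ind2 (fun x y => odd x = odd y)).
- by [].
- by move=> x1 x2 y1 y2; rewrite !oddD => -> ->.
move=> i _; rewrite ffunE val_ordD -[in RHS](odd_mod _ (_ : odd N = false)) //.
by rewrite /= odd_double.
Qed.

Lemma index_parity_unit i : index_parity (unit_box i).
Proof.
rewrite /index_parity (bigD1 i) //= big1 ?addn0; first by rewrite ffunE eqxx.
by move=> j ji; rewrite ffunE (negPf ji).
Qed.

Lemma adjp_parity b c : adjp b c -> parity c = ~~ parity b.
Proof.
move=> /adjpP[i [->|->]]; rewrite !parityE index_parity_add index_parity_unit.
  by rewrite addbT addNb.
by rewrite addbT addNb negbK.
Qed.

End Torus.

(** * The normalised trace over the ground-state space *)

Section GroundProjection.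
Variables (R : realType) (N : nat) (H P : 'M[R[i]]_N).
Local Notation C := R[i].
Hypothesis hH : dag H = H.
Hypothesis gsP : is_gs_proj H P.

Definition gs_val (A : 'M[C]_N) : R :=
  complex.Re (\tr (P *m A)) / complex.Re (\tr P).

Let PP : P *m P = P. Proof. by case: gsP. Qed.
Let hP : dag P = P. Proof. by case: gsP => _ []; rewrite dag_unseal. Qed.

(** The order on complex eigenvalues forces E0 to be real, and comparison in both directions
    identifies it with the minimum of the quadratic form. Adjoints appear because [eigenvalue]
    refers to row vectors. *)
Lemma gs_energy : exists E : R, [/\ lower_bound H E,
  forall v : 'cV[C]_N, P *m v = v <-> H *m v = E%:C%C *: v &
  exists v : 'cV[C]_N, v != 0 /\ P *m v = v].
Proof.
case: gsP => _ [_ [E0 [/eigenvalueP[u uH u0] [minE PE]]]].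
have N0 : (0 < N)%N.
  by rewrite lt0n; apply: contraNneq u0 => N0; apply/eqP/rowP => -[i iN];
    exfalso; rewrite N0 in iN.
have [e [v [le v0 Hv]]] := hermitian_minimum N0 hH.
have eig : eigenvalue H e%:C%C.
  apply/eigenvalueP; exists (dag v); last first.
    by apply: contra_neq v0 => v0; rewrite -[v]dagK v0 dag0.
  by rewrite -[H]hH -dagM Hv dagZ conjc_real.
have E0e := minE _ eig.
have E0r : E0 = (complex.Re E0)%:C%C.
  by move: E0e; rewrite lecE => /andP[/eqP /= im _]; case: (E0) im => a b /= <-.
have eE0 : e <= complex.Re E0.
  have := le (dag u); rewrite -mulmxA dagK.
  have -> : H *m dag u = E0 *: dag u.
    by rewrite -{1}[H]hH -dagM uH dagZ E0r conjc_real.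
  rewrite -scalemxAr linearZ /= E0r ReZ ler_pM2r // -{1}[u]dagK.
  by apply: mxtrace_dag_mul_gt0; apply: contra_neq u0 => u0; rewrite -[u]dagK u0 dag0.
have E0E : E0 = e%:C%C.
  rewrite E0r; congr (_%:C)%C; apply/eqP; rewrite eq_le eE0 andbT.
  by move: E0e; rewrite lecE => /andP[].
exists e; split=> //; first by rewrite -E0E.
by exists v; split=> //; apply/PE; rewrite E0E.
Qed.


Lemma gs_trace_gt0 : 0 < complex.Re (\tr P) /\ \tr P = (complex.Re (\tr P))%:C%C.
Proof.
have [E [_ _ [v [v0 Pv]]]] := gs_energy.
have e : \tr P = \tr (dag P *m P) by rewrite hP PP.
have t0 := mxtrace_dag_mul_ge0 P; rewrite -e in t0.
split; last first.
  by move: t0; rewrite lecE => /andP[/eqP /= im _]; case: (\tr P) im => a b /= ->.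
rewrite lt_def Re_ge0 // andbT; apply: contra_neq v0 => tr0.
suff P0 : P = 0 by rewrite -Pv P0 mul0mx.
have col0 j : col j P = 0.
  apply/eqP; apply: contraT => cj; have := mxtrace_dag_mul_gt0 cj.
  suff -> : complex.Re (\tr (dag (col j P) *m col j P)) = 0 by rewrite ltxx.
  apply/eqP; rewrite eq_le Re_ge0 ?mxtrace_dag_mul_ge0 // andbT.
  rewrite -{}tr0 e /mxtrace !Re_sum big_ord1 (bigD1 j) //= -[leLHS]addr0.
  have ce k : complex.Re ((dag P *m P) k k) =
      complex.Re ((dag (col k P) *m col k P) 0 0).
    by rewrite !mxE; congr complex.Re; apply: eq_bigr => i _; rewrite !dagE !mxE.
  rewrite -ce lerD2l; apply: sumr_ge0 => k _; rewrite ce.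
  have := Re_ge0 (mxtrace_dag_mul_ge0 (col k P)).
  by rewrite /mxtrace big_ord1.
by apply/matrixP => i j; have /matrixP/(_ i 0) := col0 j; rewrite !mxE.
Qed.

Lemma fixed_columns (E : R) (Q : 'M[C]_N) :
    (forall v : 'cV[C]_N, P *m v = v <-> H *m v = E%:C%C *: v) ->
  P *m Q = Q <-> H *m Q = E%:C%C *: Q.
Proof.
have ce (X : 'M[C]_N) i j : X i j = (X *m (delta_mx j 0 : 'cV_N)) i 0.
  by rewrite -colE mxE.
move=> PE; split=> e; apply/matrixP => i j; rewrite ce [RHS]ce -mulmxA.
  by rewrite -scalemxAl (PE _).1 // mulmxA e.
by rewrite (PE _).2 // mulmxA e scalemxAl.
Qed.

Lemma gs_rstate : is_rstate gs_val.
Proof.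
have [t0 tr] := gs_trace_gt0; rewrite /gs_val; split=> [A B|r A|A|].
- by rewrite mulmxDr mxtraceD ReD mulrDl.
- by rewrite -scalemxAr mxtraceZ ReZ mulrA.
- apply: divr_ge0; last exact: ltW.
  rewrite -PP -mulmxA mxtrace_mulC -mulmxA.
  have -> : dag A *m A *m P = dag A *m (A *m P) by rewrite mulmxA.
  have -> : P *m (dag A *m (A *m P)) = dag (A *m P) *m (A *m P).
    by rewrite dagM hP !mulmxA.
  exact/Re_ge0/mxtrace_dag_mul_ge0.
- by rewrite mulmx1 divff // gt_eqF.
Qed.

Lemma gs_val_energy : exists E : R, [/\ lower_bound H E,
  forall X, gs_val (H *m X) = E * gs_val X,
  forall X, gs_val (X *m H) = E * gs_val X &
  forall v : 'cV[C]_N, P *m v = v <-> H *m v = E%:C%C *: v].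
Proof.
have [E [lE PE _]] := gs_energy; exists E.
have HP : H *m P = E%:C%C *: P by apply/(fixed_columns P PE).
have PH : P *m H = E%:C%C *: P by rewrite -[LHS]dagK dagM hP hH HP dagZ conjc_real hP.
split=> // X; rewrite /gs_val.
  by rewrite mulmxA PH -scalemxAl mxtraceZ ReZ mulrA.
by rewrite mulmxA mxtrace_mulC mulmxA HP -scalemxAl mxtraceZ ReZ mulrA.
Qed.

End GroundProjection.

(** * Symmetries of the ground-state projection *)

Section SymmetricProjection.
Variables (R : realType) (n : nat) (V : finType).
Local Notation C := R[i].
Local Notation cfg V := {ffun V -> 'I_n.+1}.
Local Notation op V := 'M[C]_#|{: cfg V}|.
Variables (H P : op V) (tau : V -> V).
Hypothesis hH : dag H = H.
Hypothesis gsP : is_gs_proj H P.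
Hypothesis tau_inj : injective tau.
Hypothesis tauH : emb tau H = H.

Lemma emb_id (sig : V -> V) (A : op V) : sig =1 id -> emb sig A = A.
Proof.
move=> /emb_eq ->; apply: kerP => s t; rewrite ker_emb.
have -> : eqoff (@id V) s t.
  by apply/eqoffP => y /negP[]; apply/codomP; exists y.
by rewrite mulr1; congr ker; apply/ffunP => x; rewrite ffunE.
Qed.

(** A symmetry maps the ground space into itself, so P absorbs its image from the left. The inverse
    symmetry shows that the image absorbs P, and taking adjoints identifies the two projections. *)
Lemma emb_gs_proj : emb tau P = P.
Proof.
have PP : P *m P = P by case: gsP.
have hP : dag P = P by case: gsP => _ []; rewrite dag_unseal.
have [g tg gt] := injF_bij tau_inj.
have g_inj : injective g := can_inj gt.
have gH : emb g H = H by rewrite -[in LHS]tauH emb_comp // emb_id.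
have [E [_ PE _]] := gs_energy hH gsP.
have HP : H *m P = E%:C%C *: P by apply/(fixed_columns P PE).
have fixed (sig : V -> V) : injective sig -> emb sig H = H ->
    P *m emb sig P = emb sig P.
  move=> si sH; apply/(fixed_columns _ PE).
  by rewrite -{1}sH -embM // HP embZ.
have e1 := fixed _ tau_inj tauH.
have e2 : emb tau P *m P = P.
  have := congr1 (emb tau) (fixed _ g_inj gH).
  by rewrite embM // !emb_comp // (@emb_id (tau \o g)).
by rewrite -[LHS]dagK -emb_dag hP -e1 dagM hP -emb_dag hP e2.
Qed.

Lemma gs_val_emb (A : op V) : gs_val P (emb tau A) = gs_val P A.
Proof.
by rewrite /gs_val -{1}emb_gs_proj -embM // mxtrace_emb_bij.
Qed.

End SymmetricProjection.

(** * Ground states on the torus and averaging over translations *)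

Section TorusGroundState.
Variables (R : realType) (n d m : nat).
Local Notation C := R[i].
Local Notation N := m.*2.+2.
Local Notation box := (Box d.+1 m).
Local Notation op := (Op R n d.+1 m).
Local Notation S1 := (S1_ R n).
Local Notation S2 := (S2_ R n).
Local Notation S3 := (S3_ R n).
Local Notation adj := (@adjp d.+1 m).
Local Notation par := (@parity d.+1 m).
Local Notation eta := (sublattice_sign R par).
Local Notation kappa := (casimir R n).

Lemma mkopE (f : {ffun box -> 'I_n.+1} -> {ffun box -> 'I_n.+1} -> C) :
  mkop (f : Cfg n d.+1 m -> Cfg n d.+1 m -> C) = mk f.
Proof. by rewrite mk_unseal. Qed.

Lemma siteopE a (x : box) :
  siteop R n a x = sop x (\matrix_(k, l) spin R a k l) :> 'M[C]_#|{: {ffun box -> 'I_n.+1}}|.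
Proof.
rewrite /siteop mkopE; apply: kerP => s t.
by rewrite ker_mk ker_sop mxE; case: [forall _, _].
Qed.

Lemma spin_inord1 : \matrix_(k, l) @spin R n (inord 0) k l = s1 R n.
Proof. by apply/matrixP => k l; rewrite !mxE /spin inordK. Qed.

Lemma spin_inord2 : \matrix_(k, l) @spin R n (inord 1) k l = s2 R n.
Proof. by apply/matrixP => k l; rewrite !mxE /spin inordK. Qed.

Lemma spin_inord3 : \matrix_(k, l) @spin R n (inord 2) k l = s3 R n.
Proof. by apply/matrixP => k l; rewrite !mxE /spin inordK. Qed.

Lemma Defs_S2 (x : box) : Defs.S2 R n x = S2 x :> op.
Proof. by rewrite /Defs.S2 siteopE spin_inord2 S2_E. Qed.

Lemma Defs_S3 (x : box) : Defs.S3 R n x = S3 x :> op.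
Proof. by rewrite /Defs.S3 siteopE spin_inord3 S3_E. Qed.

Lemma Defs_dotS (x y : box) : dotS R n x y = dot R n x y.
Proof.
rewrite /dotS !big_ord_recl big_ord0 addr0 addrA dotE.
have e0 : ord0 = inord 0 :> 'I_3 by apply: val_inj; rewrite /= inordK.
have e1 : lift ord0 ord0 = inord 1 :> 'I_3 by apply: val_inj; rewrite /= inordK.
have e2 : lift ord0 (lift ord0 ord0) = inord 2 :> 'I_3.
  by apply: val_inj; rewrite /= inordK.
rewrite !S1_E !S2_E !S3_E !siteopE e2 e1 e0.
by rewrite spin_inord1 spin_inord2 spin_inord3.
Qed.

Lemma Defs_H0p : H0p R n d.+1 m = ham R n adj.
Proof.
rewrite /H0p hamE; have -> : (2^-1 : R)%:C%C = 2^-1 :> C.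
  by rewrite fmorphV rmorph_nat.
congr (_ *: _); apply: eq_bigr => x _; apply: eq_bigr => y _; exact: Defs_dotS.
Qed.

Lemma Defs_stag (x : box) : stag R x = (eta x)%:C%C.
Proof. by rewrite /stag /sublattice_sign rmorphXn rmorphN1. Qed.

Lemma Defs_Ostag : Ostag R n d.+1 m = staggered R n par.
Proof.
rewrite /Ostag staggeredE; apply: eq_bigr => x _.
by rewrite Defs_S3 Defs_stag.
Qed.

(** On indices, k -> 2m + 1 - k in the first coordinate: it exchanges the sublattices but preserves
    every centred box. The dimension is written d.+1 so that a first coordinate exists. *)
Definition mirror (x : box) : box := reflect_box ord0 (- 1) x.

Lemma mirrorK : involutive mirror. Proof. exact: reflect_boxK. Qed.

Lemma index_parity_mirror (x : box) : index_parity (mirror x) = ~~ index_parity x.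
Proof.
rewrite /index_parity (bigD1 ord0) //= [in RHS](bigD1 ord0) //= !oddD.
have -> : \sum_(i < d.+1 | i != ord0) (mirror x i : nat) =
    \sum_(i < d.+1 | i != ord0) (x i : nat).
  by apply: eq_bigr => i i0; rewrite ffunE (negPf i0).
rewrite -addNb; congr (_ (+) _).
have -> : mirror x ord0 = (N - 1 - x ord0)%N :> nat.
  by rewrite ffunE eqxx addrC val_ordNB1.
have := ltn_ord (x ord0); move: (x ord0 : nat) => k kN.
by rewrite -subnDA oddB ?oddD; [rewrite /= odd_double|lia].
Qed.

(* The reflection makes the shifts by odd v preserve the sublattices. *)
Definition shift (v x : box) : box :=
  add_box v (if index_parity v then mirror x else x).

Lemma shift_inj v : injective (shift v).
Proof.
move=> x y /add_box_inj; case: ifP => // _; exact: (inv_inj mirrorK).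
Qed.

Lemma shift_parity v x : par (shift v x) = par x.
Proof.
rewrite !parityE index_parity_add; congr (_ (+) _).
by case: (boolP (index_parity v)) => [e|_]; rewrite ?index_parity_mirror ?addTb ?negbK.
Qed.

Lemma shift_adj v x y : adj (shift v x) (shift v y) = adj x y.
Proof. by rewrite adjp_add; case: ifP => // _; exact: adjp_reflect. Qed.

Lemma emb_dot (tau : box -> box) x y : injective tau ->
  emb tau (dot R n x y) = dot R n (tau x) (tau y).
Proof.
by move=> ti; rewrite !dotE !embD !(embM ti) !emb_S1 ?emb_S2 ?emb_S3.
Qed.

Lemma emb_ham_shift v : emb (shift v) (ham R n adj) = ham R n adj.
Proof.
rewrite !hamE embZ emb_sum; congr (_ *: _).
rewrite [RHS](reindex_inj (@shift_inj v)) /=; apply: eq_bigr => x _.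
rewrite emb_sum [RHS](reindex_inj (@shift_inj v)) /=.
apply: eq_big => y; first by rewrite shift_adj.
by move=> _; apply: emb_dot; exact: shift_inj.
Qed.

Lemma emb_staggered_shift v :
  emb (shift v) (staggered R n par) = staggered R n par.
Proof.
rewrite !staggeredE emb_sum [RHS](reindex_inj (@shift_inj v)) /=.
apply: eq_bigr => x _; rewrite embZ emb_S3; last exact: shift_inj.
by rewrite /sublattice_sign shift_parity.
Qed.

Section FiniteVolume.
Variables (B : R) (P : op).
Hypothesis B_ge0 : 0 <= B.
Hypothesis gsP : is_gs_proj (Hp n d.+1 m B) P.
Local Notation H := (ham R n adj - B%:C%C *: staggered R n par).

Lemma Hp_ham : Hp n d.+1 m B = H.
Proof. by rewrite /Hp Defs_H0p Defs_Ostag. Qed.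

Lemma dagH : dag H = H.
Proof. by apply: H_herm; exact: adjp_irr. Qed.

Let gsH : is_gs_proj H P. Proof. by rewrite -Hp_ham. Qed.

Definition mu (x : box) : R := eta x * gs_val P (S3 x).

Lemma mu_shift v x : mu (shift v x) = mu x.
Proof.
rewrite /mu {1}/sublattice_sign shift_parity; congr (_ * _).
rewrite -(emb_S3 R n x (@shift_inj v)); apply: (gs_val_emb dagH gsH).
  exact: shift_inj.
by rewrite embB embZ emb_ham_shift emb_staggered_shift.
Qed.

Lemma sum_mu : \sum_x mu x = gs_val P (Ostag R n d.+1 m).
Proof.
rewrite Defs_Ostag staggeredE (rstate_sum (gs_rstate dagH gsH)).
by apply: eq_bigr => x _; rewrite (rstateZ (gs_rstate dagH gsH)).
Qed.

(** [mu] is invariant under each [shift v], a translation up to the mirror. If F is symmetric,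
    reindexing removes the mirror, so the sum of F against [mu] equals that against any translate of
    [mu], and averaging over translations separates the factors. This is why the test functions must
    be symmetric. *)
Lemma average_mu (F : box -> R) : (forall x, F (mirror x) = F x) ->
  #|{: box}|%:R * \sum_x F x * mu x = (\sum_x F x) * \sum_x mu x.
Proof.
move=> FM; have e v : \sum_x F x * mu x = \sum_x F x * mu (add_box v x).
  under eq_bigr => x _ do rewrite -(mu_shift v) /shift.
  case: (index_parity v) => //; rewrite [LHS](reindex_inj (inv_inj mirrorK)) /=.
  by apply: eq_bigr => x _; rewrite FM mirrorK.
rewrite mulr_natl -sumr_const.
under eq_bigr => v _ do rewrite (e v).
rewrite exchange_big /= mulr_suml; apply: eq_bigr => x _.
rewrite -mulr_sumr; congr (_ * _).
rewrite [RHS](reindex_inj (@add_box_inj _ _ x)) /=.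
by apply: eq_bigr => v _; congr mu; exact: add_boxC.
Qed.

Lemma bond_weight_mirror (g : box -> R) : (forall x, g (mirror x) = g x) ->
  forall x, bond_weight adj g (mirror x) = bond_weight adj g x.
Proof.
move=> gM x; rewrite /bond_weight [LHS](reindex_inj (inv_inj mirrorK)) /=.
by apply: eq_big => y; [exact: adjp_reflect|rewrite !gM].
Qed.

Theorem finite_volume_inequality (g b : box -> R) :
    (forall x, g (mirror x) = g x) -> (forall x, b (mirror x) = b x) ->
  ((\sum_x bond_weight adj g x * b x) *
     (gs_val P (Ostag R n d.+1 m) / #|{: box}|%:R)) ^+ 4 <=
  8 * field_energy adj g *
  (kappa * (\sum_x \sum_(y | adj x y)
     (bond_weight adj g x - bond_weight adj g y) ^+ 2)
   + B * ((kappa + 1) / 2) * \sum_x bond_weight adj g x ^+ 2)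
  * gs_val P (transverse n par b *m transverse n par b) ^+ 2.
Proof.
move=> gM bM; have FM x : bond_weight adj g (mirror x) * b (mirror x) =
    bond_weight adj g x * b x by rewrite (bond_weight_mirror gM) bM.
have card0 : (#|{: box}|%:R : R) != 0.
  by rewrite pnatr_eq0 -lt0n; apply/card_gt0P; exists [ffun=> ord0].
have -> : (\sum_x bond_weight adj g x * b x) *
     (gs_val P (Ostag R n d.+1 m) / #|{: box}|%:R) =
    \sum_x bond_weight adj g x * b x * mu x.
  by rewrite mulrA -sum_mu -(average_mu FM) mulrC mulKf.
have [E [lE fH fH' _]] := gs_val_energy dagH gsH.
exact: (transverse_inequality (@adjp_sym _ _) (@adjp_irr _ _)
  (@adjp_parity _ _) (@adjp_reflections _ _) (gs_rstate dagH gsH) B_ge0 lE fH fH').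
Qed.

End FiniteVolume.

End TorusGroundState.

(** * Local perturbations of infinite-volume ground states *)

Lemma sum_codom (S : nmodType) (V W : finType) (tau : V -> W) (F : W -> S) :
  injective tau -> \sum_(x in codom tau) F x = \sum_b F (tau b).
Proof.
move=> ti; rewrite -big_uniq /=; last by rewrite map_inj_uniq ?enum_uniq.
by rewrite big_map big_enum.
Qed.

Section LocalPerturbation.
Variables (R : realType) (n : nat) (V W : finType) (adjV : rel V) (adjW : rel W).
Local Notation C := R[i].
Local Notation cfg V := {ffun V -> 'I_n.+1}.
Local Notation op V := 'M[C]_#|{: cfg V}|.
Local Notation kappa := (casimir R n).
Variables (tau : V -> W) (phi : op W -> R) (H P : op V).
Hypothesis tau_inj : injective tau.
Hypothesis phi_state : is_rstate phi.
Hypothesis hH : dag H = H.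
Hypothesis gsP : is_gs_proj H P.

Local Notation K := (fun p => P *m delta_mx p.1 p.2 : op V).
(** Kraus operators, up to the factor 1/tr P, of the channel that discards the state on the tile and
    prepares P / tr P there. *)
Definition local_op (p : 'I_#|{: cfg V}| * 'I_#|{: cfg V}|) : op W :=
  emb tau (P *m delta_mx p.1 p.2).

Lemma sum_delta_conj N (Y : 'M[C]_N) :
  \sum_(p : 'I_N * 'I_N) dag (delta_mx p.1 p.2 : 'M[C]_N) *m Y *m delta_mx p.1 p.2
  = (\tr Y)%:M.
Proof.
have dE (i j : 'I_N) : dag (delta_mx i j : 'M[C]_N) = delta_mx j i.
  apply/matrixP => k l; rewrite dagE !mxE andbC.
  by case: (_ && _); rewrite ?conjc1 ?conjc0.
have e (i j : 'I_N) : delta_mx j i *m Y *m delta_mx i j = Y i i *: delta_mx j j.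
  apply/matrixP => k l; rewrite !mxE (bigD1 i) //= big1 ?addr0; last first.
    by move=> i' ne; rewrite [delta_mx i j _ _]mxE (negPf ne) mulr0.
  rewrite !mxE (bigD1 i) //= big1 ?addr0; last first.
    by move=> i' ne; rewrite mxE (negPf ne) andbF mul0r.
  rewrite !mxE !eqxx /= andbT; case: (k == j); case: (l == j);
    by rewrite ?mul0r ?mulr0 ?mul1r ?mulr1.
under eq_bigr => p _ do rewrite dE e.
rewrite -(pair_bigA _ (fun i j => Y i i *: (delta_mx j j : 'M[C]_N))) /=.
under eq_bigr => i _ do rewrite -scaler_sumr.
rewrite -scaler_suml -scalemx1; congr (_ *: _).
apply/matrixP => k l; rewrite summxE !mxE (bigD1 k) //= big1 ?addr0.
  by rewrite !mxE eqxx eq_sym.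
by move=> j jk; rewrite !mxE eq_sym (negPf jk).
Qed.

Let t := complex.Re (\tr P).
Let t_gt0 : 0 < t. Proof. by have [] := gs_trace_gt0 hH gsP. Qed.
Let trP : \tr P = t%:C%C. Proof. by have [] := gs_trace_gt0 hH gsP. Qed.
Let PP : P *m P = P. Proof. by case: gsP. Qed.
Let hP : dag P = P. Proof. by case: gsP => _ []; rewrite dag_unseal. Qed.

Lemma sum_local_op (X : op V) :
  \sum_p dag (local_op p) *m emb tau X *m local_op p = (\tr (P *m X)) *: 1%:M.
Proof.
have -> : (\tr (P *m X)) *: (1%:M : op W) = emb tau ((\tr (P *m X)) *: 1%:M).
  by rewrite embZ emb1.
have -> : (\tr (P *m X)) *: (1%:M : op V) = (\tr (P *m X *m P))%:M.
  by rewrite scalemx1 (mxtrace_mulC (P *m X)) mulmxA PP.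
rewrite -sum_delta_conj emb_sum; apply: eq_bigr => p _.
rewrite /local_op -emb_dag -!(embM tau_inj); congr emb.
by rewrite dagM hP !mulmxA.
Qed.

Lemma sum_local_op1 : \sum_p dag (local_op p) *m local_op p = t%:C%C *: 1%:M.
Proof.
have := sum_local_op 1%:M; rewrite mulmx1 trP => <-.
by apply: eq_bigr => p _; rewrite emb1 mulmx1.
Qed.

(* phi perturbed by local operators that replace its restriction to the image
   of tau by the ground state of H. *)
Definition perturbed (X : op W) : R :=
  t^-1 * \sum_p phi (dag (local_op p) *m X *m local_op p).

Lemma perturbed_state : is_rstate perturbed.
Proof.
rewrite /perturbed; split=> [A B|r A|A|].
- rewrite -mulrDr -big_split /=; congr (_ * _); apply: eq_bigr => p _.
  by rewrite mulmxDr mulmxDl (rstateD phi_state).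
- rewrite mulrCA [r * _]mulr_sumr; congr (_ * _); apply: eq_bigr => p _.
  by rewrite -scalemxAr -scalemxAl (rstateZ phi_state).
- apply: mulr_ge0; first by rewrite invr_ge0 ltW.
  apply: sumr_ge0 => p _.
  have -> : dag (local_op p) *m (dag A *m A) *m local_op p =
      dag (A *m local_op p) *m (A *m local_op p) by rewrite dagM !mulmxA.
  exact: (rstate_ge0 phi_state).
- under eq_bigr => p _ do rewrite mulmx1.
  rewrite -(rstate_sum phi_state) sum_local_op1 (rstateZ phi_state).
  by rewrite (rstate1 phi_state) mulr1 mulVf // gt_eqF.
Qed.

Lemma perturbed_emb (X : op V) : dag X = X -> perturbed (emb tau X) = gs_val P X.
Proof.
move=> hX; rewrite /perturbed -(rstate_sum phi_state) sum_local_op.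
have -> : \tr (P *m X) = (complex.Re (\tr (P *m X)))%:C%C.
  have : \tr (P *m X) = (\tr (P *m X))^*%C.
    by rewrite -mxtrace_dag dagM hP hX mxtrace_mulC.
  case: (\tr (P *m X)) => a b [] /eqP; rewrite -addr_eq0 -mulr2n mulrn_eq0 /=.
  by move=> /eqP ->.
by rewrite (rstateZ phi_state) (rstate1 phi_state) mulr1 mulrC.
Qed.

Lemma perturbed_commute (X : op W) :
  (forall A : op V, X *m emb tau A = emb tau A *m X) -> perturbed X = phi X.
Proof.
move=> cX; rewrite /perturbed -(rstate_sum phi_state).
under eq_bigr => p _ do rewrite -mulmxA cX mulmxA.
rewrite -mulmx_suml sum_local_op1 -scalemxAl mul1mx (rstateZ phi_state).
by rewrite mulrA mulVf ?mul1r // gt_eqF.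
Qed.

Lemma perturbed_far x y : x \notin codom tau -> y \notin codom tau ->
  perturbed (dot R n x y) = phi (dot R n x y).
Proof.
move=> xN yN; apply: perturbed_commute => A; rewrite dotE.
have e (z : W) M : z \notin codom tau -> sop z M *m emb tau A = emb tau A *m sop z M.
  by move=> zN; rewrite (emb_sop_commute A M tau_inj zN).
have e2 (M M' : 'M[C]_n.+1) : sop x M *m sop y M' *m emb tau A =
    emb tau A *m (sop x M *m sop y M').
  by rewrite -mulmxA (e y) // mulmxA (e x) // mulmxA.
by rewrite S1_E S2_E S3_E S1_E S2_E S3_E !mulmxDl !mulmxDr !e2.
Qed.

(** For X the Hamiltonian each term is the quantity whose limit is nonnegative in an infinite-volume
    ground state, so the perturbation cannot lower the energy appreciably. *)
Lemma perturbed_energy_gap (X : op W) :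
  t * (perturbed X - phi X) = \sum_p phi (dag (local_op p) *m
    (X *m local_op p - local_op p *m X)).
Proof.
under eq_bigr => p _ do rewrite mulmxBr !mulmxA (rstateB phi_state).
rewrite sumrB mulrBr /perturbed mulrA divff ?gt_eqF // mul1r; congr (_ - _).
rewrite -(rstate_sum phi_state) -mulmx_suml sum_local_op1 -scalemxAl mul1mx.
by rewrite (rstateZ phi_state).
Qed.

Hypothesis adjV_irr : irreflexive adjV.
Hypothesis adjW_sym : symmetric adjW.
Variables (interior : pred V) (D : nat).
Hypothesis interior_nbr : forall b y, interior b -> adjW (tau b) y ->
  exists2 c, y = tau c & adjV b c.
Hypothesis interior_adj : forall b c, interior b -> adjV b c -> adjW (tau b) (tau c).
Hypothesis degV : forall b, (#|[pred c | adjV b c]| <= D)%N.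
Hypothesis degW : forall x, (#|[pred y | adjW x y]| <= D)%N.

Lemma dot_herm (T : finType) (x y : T) : x != y -> dag (dot R n x y) = dot R n x y.
Proof.
move=> xy; have yx : y != x by rewrite eq_sym.
rewrite dotE !dagD !dagM !S1_herm !S2_herm !S3_herm.
by apply: eq_add3; rewrite ?S1_E ?S2_E ?S3_E; exact: sop_commute.
Qed.

(** Bonds that avoid the tile are unchanged, and bonds of interior sites change exactly as on the
    tile. Three groups remain, each of at most D terms per non-interior site: bonds of the lattice
    leaving such a site, bonds entering it from outside, and bonds of the tile. A term is at most 6
    kappa and ordered pairs count 1/2, whence 9 D kappa per site. *)
Lemma local_energy : -1 <= perturbed (ham R n adjW) - phi (ham R n adjW) ->
  -1 - (9 * D * #|[pred b | ~~ interior b]|)%:R * kappa <=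
  gs_val P (ham R n adjV) - phi (emb tau (ham R n adjV)).
Proof.
pose T x y : R := perturbed (dot R n x y) - phi (dot R n x y).
pose T' b c : R := gs_val P (dot R n b c) - phi (emb tau (dot R n b c)).
have gs_state := gs_rstate hH gsP.
have bd (f1 f2 : R) : `|f1| <= 3 * kappa -> `|f2| <= 3 * kappa ->
    `|f1 - f2| <= 6 * kappa.
  by rewrite !ler_norml => /andP[a b] /andP[c e]; apply/andP; split; lra.
have Tb x y : `|T x y| <= 6 * kappa.
  by apply: bd; apply: rstate_dot_le => //; exact: perturbed_state.
have T'b b c : b != c -> `|T' b c| <= 6 * kappa.
  move=> bc; apply: bd; first exact: rstate_dot_le.
  have -> : emb tau (dot R n b c) = dot R n (tau b) (tau c).
    by rewrite !dotE !embD !(embM tau_inj) !emb_S1 ?emb_S2 ?emb_S3.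
  exact: rstate_dot_le.
have k0 : 0 <= kappa by rewrite /casimir divr_ge0.
have -> : perturbed (ham R n adjW) - phi (ham R n adjW) =
    2^-1 * \sum_x \sum_(y | adjW x y) T x y.
  rewrite hamE (rstateZ perturbed_state) (rstateZ phi_state) -mulrBr.
  rewrite (rstate_sum perturbed_state) (rstate_sum phi_state) -sumrB.
  congr (_ * _); apply: eq_bigr => x _.
  by rewrite (rstate_sum perturbed_state) (rstate_sum phi_state) -sumrB.
have -> : gs_val P (ham R n adjV) - phi (emb tau (ham R n adjV)) =
    2^-1 * \sum_b \sum_(c | adjV b c) T' b c.
  rewrite hamE embZ emb_sum (rstateZ gs_state) (rstateZ phi_state) -mulrBr.
  rewrite (rstate_sum gs_state) (rstate_sum phi_state) -sumrB.
  congr (_ * _); apply: eq_bigr => x _.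
  by rewrite emb_sum (rstate_sum gs_state) (rstate_sum phi_state) -sumrB.
pose nI := #|[pred b | ~~ interior b]|.
pose Z := (D * nI)%:R * (6 * kappa) : R.
have boundary (F : V -> R) : (forall b, ~~ interior b -> F b <= D%:R * (6 * kappa)) ->
    \sum_(b | ~~ interior b) F b <= Z.
  move=> h; apply: le_trans (ler_sum _ h) _.
  rewrite sumr_const -[_ *+ #|_|]mulr_natr -mulrA [_ * _%:R]mulrC mulrA -natrM.
  by rewrite /Z /nI.
pose Sint := \sum_(b | interior b) \sum_(c | adjV b c) T' b c.
have interior_sum (F : W -> R) b : interior b ->
    \sum_(y | adjW (tau b) y) F y = \sum_(c | adjV b c) F (tau c).
  move=> ib; rewrite (bigID (mem (codom tau))) /= addrC big1 ?add0r; last first.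
    by move=> y /andP[/(interior_nbr ib)[c -> _]]; rewrite codom_f.
  under eq_bigl do rewrite andbC.
  rewrite big_mkcondr (sum_codom _ tau_inj) -big_mkcond; apply: eq_bigl => c.
  apply/idP/idP => [/(interior_nbr ib)[c' /tau_inj -> //]|]; exact: interior_adj.
have k6 : 0 <= 6 * kappa by apply: mulr_ge0.
have const_sum (U : finType) (A : pred U) : (#|A| <= D)%N ->
    \sum_(y | A y) 6 * kappa <= D%:R * (6 * kappa).
  by move=> AD; rewrite sumr_const -[_ *+ #|_|]mulr_natl; apply: ler_wpM2r => //; rewrite ler_nat.
have W_le : \sum_x \sum_(y | adjW x y) T x y <= Sint + Z + Z.
  rewrite (bigID (mem (codom tau))) /= (sum_codom _ tau_inj) (bigID interior) /=.
  apply: lerD; first apply: lerD.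
  - rewrite le_eqVlt; apply/orP; left; apply/eqP; apply: eq_bigr => b ib.
    rewrite interior_sum //; apply: eq_bigr => c bc.
    have hbc : dag (dot R n b c) = dot R n b c.
      by apply: dot_herm; apply: contraTneq bc => ->; rewrite adjV_irr.
    have e : dot R n (tau b) (tau c) = emb tau (dot R n b c).
      by rewrite !dotE !embD !(embM tau_inj) !emb_S1 ?emb_S2 ?emb_S3.
    by rewrite /T /T' e perturbed_emb.
  - apply: boundary => b _; apply: le_trans (const_sum _ _ (degW (tau b))).
    by apply: ler_sum => y _; apply: le_trans (ler_norm _) (Tb _ _).
  - have far x : x \notin codom tau ->
        \sum_(y | adjW x y) T x y <= \sum_c (if adjW x (tau c) then 6 * kappa else 0).
      move=> xN; rewrite (bigID (mem (codom tau))) /= [X in _ + X]big1 ?addr0; last first.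
        by move=> y /andP[_ yN]; rewrite /T perturbed_far ?subrr.
      under eq_bigl do rewrite andbC.
      rewrite big_mkcondr (sum_codom _ tau_inj); apply: ler_sum => c _.
      by case: ifP => // _; apply: le_trans (ler_norm _) (Tb _ _).
    (* Summation by the endpoint inside the tile: an interior endpoint has no neighbour outside, so
       only non-interior sites contribute. *)
    apply: le_trans (ler_sum _ far) _; rewrite exchange_big /= (bigID interior) /=.
    rewrite big1 ?add0r; last first.
      move=> c ic; apply: big1 => x xN; case: ifP => //; rewrite adjW_sym.
      by move=> /(interior_nbr ic)[c' xe _]; rewrite xe codom_f in xN.
    apply: boundary => c _; rewrite -big_mkcondr /=.
    apply: le_trans (const_sum _ _ (degW (tau c))).
    rewrite big_mkcond [leRHS]big_mkcond /=; apply: ler_sum => x _.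
    rewrite adjW_sym; case: (adjW _ x); rewrite ?andbF // andbT.
    by case: ifP.
have V_ge : Sint - Z <= \sum_b \sum_(c | adjV b c) T' b c.
  rewrite [leRHS](bigID interior) /=; apply: lerD => //.
  rewrite lerNl -sumrN; apply: boundary => b _.
  rewrite -sumrN; apply: le_trans (const_sum _ _ (degV b)).
  apply: ler_sum => c bc; apply: le_trans (ler_norm _) _; rewrite normrN.
  by apply: T'b; apply: contraTneq bc => ->; rewrite adjV_irr.
have -> : (9 * D * nI)%:R * kappa = (3 / 2) * Z by rewrite /Z -mulnA natrM; field.
move: W_le V_ge; move: (\sum_x _) (\sum_b _) => a b; lra.
Qed.

End LocalPerturbation.

Lemma sub_unit d M (b : Box d M) i : (0 < b i)%N ->
  exists2 c, b = add_box c (unit_box M i) & ((c i).+1 < M.*2.+2)%N.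
Proof.
move=> bi; pose c : Box d M := (b : {ffun 'I_d -> 'I__}) - (unit_box M i : {ffun 'I_d -> 'I__}).
have bc : b = add_box c (unit_box M i) by rewrite /add_box subrK.
exists c => //; have := ltn_ord (b i); have := bi.
have -> : b i = ((c i).+1 %% M.*2.+2)%N :> nat.
  by rewrite {1}bc !ffunE eqxx val_ordD val_ord1 addn1.
have := ltn_ord (c i); rewrite leq_eqVlt => /orP[/eqP ->|//].
by rewrite modnn.
Qed.

(** * Placing a small box in a large torus *)

Section Placement.
Variables (d M m : nat) (k : 'I_d -> nat).
Hypothesis k_fits : forall i, (k i + M.*2.+2 <= m.*2.+2)%N.

Definition place (b : Box d M) : Box d m := [ffun i => inord (k i + b i)].

Lemma placeE b i : place b i = (k i + b i)%N :> nat.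
Proof.
rewrite ffunE inordK //; apply: leq_trans (k_fits i).
by rewrite ltn_add2l.
Qed.

Lemma place_inj : injective place.
Proof.
move=> b c e; apply/ffunP => i; apply: ord_inj.
by apply/eqP; rewrite -(eqn_add2l (k i)) -!placeE e.
Qed.

Lemma place_unit (b : Box d M) i : ((b i).+1 < M.*2.+2)%N ->
  place (add_box b (unit_box M i)) = add_box (place b) (unit_box m i).
Proof.
move=> bi; apply/ffunP => j; apply: ord_inj; rewrite placeE.
move: (place b) (placeE b) => p pE; rewrite !ffunE.
case: (eqVneq j i) => [->|_]; last by rewrite !addr0 pE.
have le : (k i + (b i).+1 < m.*2.+2)%N.
  by apply: leq_trans (k_fits i); rewrite ltn_add2l.
by rewrite !val_ordD !val_ord1 !addn1 pE !modn_small // -addnS.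
Qed.

(** Excludes the outer faces, where the small torus has wrap-around bonds that its image need not
    have. *)
Definition interior (b : Box d M) : bool :=
  [forall i, (0 < b i)%N && ((b i).+1 < M.*2.+2)%N].

Lemma place_interior_nbr b (y : Box d m) : interior b -> adjp (place b) y ->
  exists2 c, y = place c & adjp b c.
Proof.
move=> /forallP ib /adjpP[i [->|e]]; have /andP[b0 bN] := ib i.
  exists (add_box b (unit_box M i)); first by rewrite place_unit.
  by apply/adjpP; exists i; left.
have [c bc cN] := sub_unit b0; exists c; last by apply/adjpP; exists i; right.
apply: (@add_box_inj _ _ (unit_box m i)); rewrite ![add_box (unit_box m i) _]add_boxC.
by rewrite -e bc place_unit.
Qed.

Lemma place_interior_adj b c : interior b -> adjp b c -> adjp (place b) (place c).
Proof.
move=> /forallP ib /adjpP[i [->|e]]; have /andP[b0 bN] := ib i.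
  by rewrite place_unit //; apply/adjpP; exists i; left.
have [c' bc' cN] := sub_unit b0.
have -> : c = c'.
  apply: (@add_box_inj _ _ (unit_box M i)); rewrite ![add_box (unit_box M i) _]add_boxC.
  by rewrite -e.
by apply/adjpP; exists i; right; rewrite bc' place_unit.
Qed.

Lemma index_parity_place b : index_parity (place b) =
  index_parity b (+) odd (\sum_i k i).
Proof.
rewrite /index_parity -oddD -big_split /=; congr odd.
by apply: eq_bigr => i _; rewrite placeE addnC.
Qed.

End Placement.

Lemma adjp_degree d m (b : Box d m) : (#|[pred c | adjp b c]| <= 2 * d)%N.
Proof.
pose f (p : 'I_d * bool) : Box d m := if p.2 then add_box b (unit_box m p.1)
  else (b : {ffun 'I_d -> 'I__}) - (unit_box m p.1 : {ffun 'I_d -> 'I__}).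
apply: (@leq_trans #|codom f|).
  apply: subset_leq_card; apply/subsetP => c /adjpP[i [->|e]].
    exact: (codom_f f (i, true)).
  have -> : c = f (i, false) by rewrite /f /= e /add_box addrK.
  exact: codom_f.
apply: leq_trans (card_size _) _.
by rewrite size_codom card_prod card_ord card_bool mulnC.
Qed.

(** The pairs (f, x) with f i in A are sent to (f i, f with value x at i), which is injective: a
    proportion |A|/|T|, stated without division. *)
Lemma card_ffun_coordinate (I T : finType) (i : I) (A : pred T) :
  (#|[pred f : {ffun I -> T} | A (f i)]| * #|T| <= #|A| * #|{: {ffun I -> T}}|)%N.
Proof.
pose upd (q : {ffun I -> T} * T) := (q.1 i, [ffun j => if j == i then q.2 else q.1 j]).
have upd_inj : injective upd.
  move=> [f x] [g y] [fg /ffunP h]; congr (_, _); last first.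
    by have := h i; rewrite !ffunE eqxx.
  apply/ffunP => j; case: (eqVneq j i) => [->//|ji].
  by have := h j; rewrite !ffunE (negPf ji).
rewrite -!cardX -(card_imset _ upd_inj); apply: subset_leq_card.
apply/subsetP => _ /imsetP[[f x] /andP[/= fA _] ->].
by rewrite inE /= andbT.
Qed.

Lemma card_ffun_some_coordinate d (T : finType) (A : pred T) :
  (#|[pred f : {ffun 'I_d -> T} | [exists i, A (f i)]]| * #|T| <=
   d * (#|A| * #|{: {ffun 'I_d -> T}}|))%N.
Proof.
apply: (@leq_trans ((\sum_(i < d) #|[pred f : {ffun 'I_d -> T} | A (f i)]|) * #|T|)).
  rewrite leq_mul2r; apply/orP; right; rewrite -sum1_card.
  under [leqRHS]eq_bigr => i _ do rewrite -sum1_card big_mkcond.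
  rewrite exchange_big big_mkcond /=; apply: leq_sum => f _; case: ifP => // /existsP[i Ai].
  by rewrite (bigD1 i) //= unfold_in Ai.
rewrite big_distrl /=.
apply: (@leq_trans (\sum_(i < d) #|A| * #|{: {ffun 'I_d -> T}}|)).
  by apply: leq_sum => i _; exact: card_ffun_coordinate.
by rewrite sum_nat_const card_ord.
Qed.

Lemma card_not_interior d M :
  (#|[pred b : Box d M | ~~ interior b]| * M.*2.+2 <= 2 * d * #|{: Box d M}|)%N.
Proof.
pose A : pred 'I_M.*2.+2 := [pred t | (t == ord0) || (t == ord_max)].
have cA : (#|A| <= 2)%N by rewrite -[A]/(pred2 _ _ : pred _) card2; case: (_ != _).
have face (b : Box d M) : ~~ interior b -> [exists i, A (b i)].
  rewrite /interior negb_forall => /existsP[ i]; rewrite negb_and -!leqNgt => bi.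
  apply/existsP; exists i; rewrite /A inE /= -!val_eqE /=; move: bi; have := ltn_ord (b i).
  by rewrite leqn0 => biN /orP[->//|bi]; apply/orP; right; lia.
have := card_ffun_some_coordinate d A; rewrite card_ord => h.
apply: leq_trans (leq_trans h _); last by rewrite mulnA leq_mul2r mulnC leq_mul2r cA !orbT.
rewrite leq_mul2r; apply/orP; right; apply: subset_leq_card.
by apply/subsetP => b; exact: face.
Qed.

(* The canonical inclusion of boxes is the placement with offset m - m0. *)
Section BoxInclusion.
Variables (R : realType) (n d m0 m : nat).
Hypothesis m0m : (m0 <= m)%N.
Local Notation incl := (@place d.+1 m0 m (fun=> (m - m0)%N)).

Lemma incl_fits (i : 'I_d.+1) : ((m - m0) + m0.*2.+2 <= m.*2.+2)%N.
Proof. by lia. Qed.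

Lemma box_of_pt (b : Box d.+1 m0) : box_of m (pt b) = incl b.
Proof.
apply/ffunP => i; rewrite !ffunE /pt; congr inord.
by have -> : (b i)%:Z - m0%:Z + m%:Z = (m - m0 + b i)%N%:Z by lia.
Qed.

Lemma codom_incl (b : Box d.+1 m) : (b \in codom incl) = inbox m0 (pt b).
Proof.
apply/codomP/forallP => [[c ->] i|h].
  rewrite /pt (placeE incl_fits) /=; have := ltn_ord (c i).
  move: (nat_of_ord (c i)) => q qN; lia.
exists [ffun i => inord (b i - (m - m0))]; apply/ffunP => i; apply: ord_inj.
have := h i; rewrite /pt (placeE incl_fits) ffunE => /andP[]; move: (nat_of_ord (b i)) => q h1 h2.
rewrite inordK; lia.
Qed.

Lemma embedE (A : Op R n d.+1 m0) : embed m A = emb incl A.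
Proof.
rewrite /embed mkopE; apply: kerP => s t; rewrite ker_mk ker_emb.
have pE (u : {ffun Box d.+1 m -> 'I_n.+1}) : restr m0 u = pull incl u.
  by apply/ffunP => b; rewrite !ffunE box_of_pt.
rewrite !pE; congr (_ * _).
have -> : [forall b : Box d.+1 m, inbox m0 (pt b) || (s b == t b)] = eqoff incl s t.
  by apply: eq_forallb => b; rewrite codom_incl.
by case: (eqoff _ _ _).
Qed.

Lemma place_comp M (k : 'I_d.+1 -> nat) (b : Box d.+1 M) :
    (forall i, (k i + M.*2.+2 <= m0.*2.+2)%N) ->
  incl (place m0 k b) = place m (fun i => (m - m0) + k i)%N b.
Proof.
move=> kf; apply/ffunP => i; rewrite ffunE (placeE kf).
by rewrite addnA [RHS]ffunE.
Qed.

End BoxInclusion.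

Lemma rstate_emb (R : rcfType) n (V W : finType) (tau : V -> W)
    (f : 'M[R[i]]_#|{: {ffun W -> 'I_n.+1}}| -> R) :
  injective tau -> is_rstate f -> is_rstate (fun A => f (emb tau A)).
Proof.
move=> ti hf; split=> [A B|r A|A|].
- by rewrite embD (rstateD hf).
- by rewrite embZ (rstateZ hf).
- by rewrite (embM ti) emb_dag; exact: (rstate_ge0 hf).
- by rewrite emb1 (rstate1 hf).
Qed.

(** * Comparison with an infinite-volume ground state *)

Section InfiniteVolume.
Variables (R : realType) (n d : nat) (w : State R n d.+1).
Local Notation C := R[i].
Local Notation op := (Op R n d.+1).
Local Notation box := (Box d.+1).
Local Notation kappa := (casimir R n).
Hypothesis w_gs : is_inf_gs w.

Definition value m (A : op m) : R := complex.Re (w A).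

Lemma value_state m : is_rstate (@value m).
Proof.
have [[lin [pos [one _]]] _] := w_gs.
have wD (A B : op m) : w (A + B) = w A + w B.
  by have := lin m 1 A B; rewrite scale1r mul1r.
have w0 : w (0 : op m) = 0.
  by apply: (@addrI _ (w (0 : op m))); rewrite -wD !addr0.
rewrite /value; split=> [A B|r A|A|].
- by rewrite wD ReD.
- by have := lin m r%:C%C A 0; rewrite addr0 w0 addr0 => ->; rewrite ReZ.
- by have := pos m A; rewrite /adj_op -dag_unseal; exact: Re_ge0.
- by rewrite one.
Qed.

Lemma value_embed m0 m (A : op m0) : (m0 <= m)%N -> value (embed m A) = value A.
Proof. by move=> h; have [[_ [_ [_ e]]] _] := w_gs; rewrite /value e. Qed.

(** Each term has a nonnegative limit, hence eventually exceeds - e / (#|I| + 1); finitely many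
    terms share one volume. *)
Lemma gs_finite_family (I : finType) m0 (a : I -> op m0) (e : R) : 0 < e ->
  exists2 m, (m0 <= m)%N & - e <= \sum_j value (dag (embed m (a j)) *m
     (H0p R n d.+1 m *m embed m (a j) - embed m (a j) *m H0p R n d.+1 m)).
Proof.
move=> e0; pose c : R := e / (#|I|.+1)%:R.
have c0 : 0 < c by rewrite divr_gt0.
pose F j m := value (dag (embed m (a j)) *m
     (H0p R n d.+1 m *m embed m (a j) - embed m (a j) *m H0p R n d.+1 m)).
have low j : exists N, forall m, (N <= m)%N -> - c <= F j m.
  have [_ gs] := w_gs; have [l [l0 cv]] := gs m0 (a j).
  have [N hN] := cv c c0; exists N => m /hN; rewrite /F /value dag_unseal.
  move: (w _) => z zl; have := normc_ge_Re (z - l); have := Re_ge0 l0.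
  move=> Rl h; have := le_lt_trans h zl; rewrite ltcR ReD ReN => /ltr_normlP[h1 h2].
  lra.
have [N hN] := fin_all_exists low.
exists (maxn m0 (\max_j N j)); first exact: leq_maxl.
have: \sum_(j : I) - c <= \sum_j F j (maxn m0 (\max_j N j)).
  apply: ler_sum => j _; apply: hN; apply: leq_trans (leq_maxr _ _).
  exact: (leq_bigmax j).
apply: le_trans; rewrite sumr_const mulNrn lerN2 -mulr_natr /c mulrAC.
by rewrite ler_pdivrMr // ler_pM2l // ler_nat.
Qed.

Section Tile.
Variables (M m0 : nat) (k : 'I_d.+1 -> nat) (s : bool).
Hypothesis k_fits : forall i, (k i + M.*2.+2 <= m0.*2.+2)%N.

(** The flag mirrors the tile, which exchanges its sublattices and reverses the sign of its
    magnetisation; one of the two choices is favourable. *)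
Definition tile m (k : 'I_d.+1 -> nat) (b : box M) : box m :=
  place m k (if s then mirror b else b).

Lemma tile_inj m l : (forall i, (l i + M.*2.+2 <= m.*2.+2)%N) -> injective (tile m l).
Proof.
move=> lf b c /(place_inj lf); rewrite /tile; case: s => //.
exact: (inv_inj (@mirrorK _ _)).
Qed.

Lemma interior_mirror (b : box M) : interior b -> interior (mirror b).
Proof.
move=> /forallP h; apply/forallP => i; rewrite ffunE; case: eqP => // _.
have := h i; rewrite addrC val_ordNB1; lia.
Qed.

Variables (B : R) (P : op M).
Hypothesis B_gt0 : 0 < B.
Hypothesis gsP : is_gs_proj (Hp n d.+1 M B) P.

Definition boundary_cost : R :=
  1 + (9 * (2 * d.+1) * #|[pred b : box M | ~~ interior b]|)%:R * kappa.

(** By the variational principle on the tile, B times the excess of its magnetisation over that of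
    the finite-volume ground state is at most the excess of its exchange energy, and [local_energy]
    bounds the latter by the boundary cost. *)
Lemma tile_bound :
  B * value (emb (tile m0 k) (Ostag R n d.+1 M)) - boundary_cost <=
  B * gs_val P (Ostag R n d.+1 M).
Proof.
pose H := ham R n (@adjp d.+1 M).
pose O := staggered R n (@parity d.+1 M).
have gsH : is_gs_proj (H - B%:C%C *: O) P by rewrite -Hp_ham.
have hH := dagH n d M B.
have ti := tile_inj k_fits.
have [t0 _] := gs_trace_gt0 hH gsH.
(* The tolerance is tr P, so that after normalisation the energy decreases by at most 1. *)
have [m m0m] := gs_finite_family (fun p => emb (tile m0 k) (P *m delta_mx p.1 p.2)) t0.
have incl_i : injective (place m (fun=> (m - m0)%N) : box m0 -> box m).
  by apply: place_inj => i /=; lia.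
pose l := (fun i => (m - m0) + k i)%N.
have lf i : (l i + M.*2.+2 <= m.*2.+2)%N by have := k_fits i; rewrite /l; lia.
have tl : place m (fun=> (m - m0)%N) \o tile m0 k =1 tile m l.
  by move=> b; rewrite /= /tile place_comp.
have embtl (A : op M) : embed m (emb (tile m0 k) A) = emb (tile m l) A.
  by rewrite (embedE m0m) (emb_comp _ _ incl_i); exact: emb_eq.
under eq_bigr => p _ do rewrite embtl.
have ti' := tile_inj lf.
rewrite Defs_H0p -(perturbed_energy_gap ti' (value_state m) hH gsH).
rewrite -[X in X <= _](mulr1 (- _)) mulNr -mulrN ler_pM2l // => gap.
have inbr b (y : box m) : interior b -> adjp (tile m l b) y ->
    exists2 c, y = tile m l c & adjp b c.
  rewrite /tile; case: s => ib; last exact: place_interior_nbr.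
  move=> /(place_interior_nbr lf (interior_mirror ib))[c -> bc].
  exists (mirror c); first by rewrite mirrorK.
  by rewrite -(adjp_reflect ord0 (-1)) [reflect_box _ _ (mirror c)]mirrorK.
have iadj b c : interior b -> adjp b c -> adjp (tile m l b) (tile m l c).
  rewrite /tile; case: s => ib bc; apply: place_interior_adj => //.
    exact: interior_mirror.
  by rewrite adjp_reflect.
have := local_energy ti' (value_state m) hH gsH (@adjp_irr _ _) (@adjp_sym _ _)
  inbr iadj (@adjp_degree _ _) (@adjp_degree _ _) gap.
rewrite -embtl (value_embed _ m0m) => low.
have [E [lE fH _ _]] := gs_val_energy hH gsH.
have := rstate_lower_bound (rstate_emb ti (value_state m0)) hH lE.
have gsr := gs_rstate hH gsH.
have := fH 1%:M; rewrite mulmx1 (rstate1 gsr) mulr1.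
rewrite embB embZ !(rstateB (value_state m0)) !(rstateZ (value_state m0)).
rewrite (rstateB gsr) (rstateZ gsr) Defs_Ostag /boundary_cost.
move: low; rewrite -/H -/O.
move: (value _) (value _) (gs_val _ _) (gs_val _ _) (_%:R * _) => x1 x2 x3 x4 x5.
move: (B * x2) (B * _) => y1 y2; lra.
Qed.

End Tile.

Lemma value_emb_staggered M m (tau : box M -> box m) : injective tau ->
  value (emb tau (Ostag R n d.+1 M)) =
  \sum_b sublattice_sign R (@parity _ _) b * value (S3_ R n (tau b)).
Proof.
move=> ti; rewrite Defs_Ostag staggeredE emb_sum (rstate_sum (value_state m)).
by apply: eq_bigr => b _; rewrite embZ emb_S3 // (rstateZ (value_state m)).
Qed.

Lemma value_tile_mirror M m (k : 'I_d.+1 -> nat) :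
    (forall i, (k i + M.*2.+2 <= m.*2.+2)%N) ->
  value (emb (@tile M true m k) (Ostag R n d.+1 M)) =
  - value (emb (@tile M false m k) (Ostag R n d.+1 M)).
Proof.
move=> kf; have ti s := @tile_inj M s m k kf.
rewrite !value_emb_staggered // (reindex_inj (inv_inj (@mirrorK _ _))) -sumrN.
apply: eq_bigr => b _; rewrite /tile mirrorK -mulNr /sublattice_sign !parityE.
by rewrite index_parity_mirror addNb; case: (_ (+) _); rewrite ?expr1 ?expr0 ?opprK.
Qed.

Lemma add_box_place M m (v : box m) (b : box M) :
    (forall i, (v i + M.*2.+2 <= m.*2.+2)%N) ->
  add_box v (place m (fun=> 0%N) b) = place m (fun i => v i) b.
Proof.
move=> vf; have zf (i : 'I_d.+1) : (0 + M.*2.+2 <= m.*2.+2)%N.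
  by apply: leq_trans (vf i); rewrite leq_add2r.
apply/ffunP => i; apply: ord_inj; rewrite (placeE vf).
move: (place _ _ b) (placeE zf b) => p pE; rewrite ffunE val_ordD pE modn_small //.
rewrite add0n; apply: leq_trans (vf i); rewrite ltn_add2l; exact: ltn_ord.
Qed.

(** Pigeonhole over translates: the tile sums over all translates add up to |tile| times the total
    magnetisation, while the translates that wrap around are a small fraction by the width
    hypothesis. Some unwrapped tile thus has magnetisation delta / 2 per site in modulus, and the
    mirror corrects its sign. *)
Lemma staggered_tile (delta : R) M m : 0 < delta -> (M <= m)%N ->
    delta <= `|mag_seq w m| ->
    (d.+1 * M.*2.+2)%:R * ((kappa + 1) / 2) < delta / 2 * (m.*2.+2)%:R ->
  exists (k : 'I_d.+1 -> nat) (s : bool),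
    (forall i, (k i + M.*2.+2 <= m.*2.+2)%N) /\
    delta / 2 * #|{: box M}|%:R <= value (emb (tile s m k) (Ostag R n d.+1 M)).
Proof.
move=> d0 Mm mag wide; pose c : R := (kappa + 1) / 2.
pose X (x : box m) : R := sublattice_sign R (@parity _ _) x * value (S3_ R n x).
have Xc x : `|X x| <= c.
  rewrite /X normrM /sublattice_sign normrX normrN1 expr1n mul1r.
  exact: (@rstate_S3_le R n (box m : finType) (@value m) (value_state m) x).
have c0 : 0 <= c by apply: le_trans (normr_ge0 _) (Xc [ffun=> ord0]).
have sumX : \sum_x X x = value (Ostag R n d.+1 m).
  rewrite Defs_Ostag staggeredE (rstate_sum (value_state m)).
  by apply: eq_bigr => x _; rewrite (rstateZ (value_state m)).
pose T : R := delta / 2 * #|{: box M}|%:R.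
pose Y v := \sum_(b : box M) X (add_box v (place m (fun=> 0%N) b)).
have sumY : \sum_v Y v = #|{: box M}|%:R * \sum_x X x.
  rewrite /Y exchange_big /= mulr_natl -sumr_const; apply: eq_bigr => b _.
  rewrite [RHS](reindex_inj (@add_box_inj _ _ (place m (fun=> 0%N) b))) /=.
  by apply: eq_bigr => v _; rewrite add_boxC.
(* The translates that wrap around the torus. *)
pose bad : pred (box m) := [pred v : box m | [exists i, (m.*2.+2 < v i + M.*2.+2)%N]].
have Ybad v : `|Y v| <= #|{: box M}|%:R * c.
  apply: le_trans (ler_norm_sum _ _ _) _; rewrite mulr_natl -sumr_const.
  by apply: ler_sum.
have goodP v : ~~ bad v -> forall i, (v i + M.*2.+2 <= m.*2.+2)%N.
  by rewrite /bad /= negb_exists => /forallP h i; rewrite leqNgt.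
have Ygood v : ~~ bad v -> `|Y v| = `|value (emb (tile false m (fun i => v i)) (Ostag R n d.+1 M))|.
  move=> /goodP vf; rewrite value_emb_staggered; last exact: tile_inj.
  (* The relative sign of the two sublattice conventions, constant over the tile. *)
  pose e : R := (-1) ^+ (odd (\sum_i v i) (+) (odd (d.+1 * m) (+) odd (d.+1 * M))).
  have e1 : `|e| = 1 by rewrite /e normrX normrN1 expr1n.
  rewrite -[RHS]mul1r -e1 -normrM mulr_sumr; congr `|_|; apply: eq_bigr => b _.
  rewrite /X add_box_place // mulrA; congr (_ * _).
  rewrite /sublattice_sign /e !parityE (index_parity_place vf) -signr_addb.
  by congr (_ ^+ _); rewrite -!addbA; do 5?case: (odd _) => //=; case: (index_parity _).
have badcard : (#|bad| * m.*2.+2 <= d.+1 * M.*2.+2 * #|{: box m}|)%N.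
  pose A : pred 'I_m.*2.+2 := [pred t : 'I_m.*2.+2 | (m.*2.+2 < t + M.*2.+2)%N].
  have cA : (#|A| <= M.*2.+2)%N.
    have Nm : (M.*2.+2 <= m.*2.+2)%N by lia.
    pose f (t : 'I_M.*2.+2) : 'I_m.*2.+2 := rev_ord (widen_ord Nm t).
    apply: leq_trans (_ : #|codom f| <= _)%N; last first.
      by apply: leq_trans (card_size _) _; rewrite size_codom card_ord.
    apply: subset_leq_card; apply/subsetP => t; rewrite inE => tA.
    have tr : (rev_ord t < M.*2.+2)%N by rewrite /=; lia.
    apply/codomP; exists (Ordinal tr); apply: val_inj; rewrite /=.
    by have := ltn_ord t; lia.
  have := card_ffun_some_coordinate d.+1 A; rewrite card_ord => h.
  by apply: leq_trans h _; rewrite mulnA leq_mul2r leq_mul2l cA !orbT.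
apply: boolp.contrapT => none.
have small v : ~~ bad v -> `|Y v| <= T.
  move=> vb; rewrite (Ygood _ vb) ler_norml; have vf := goodP _ vb.
  rewrite lerNl -(value_tile_mirror vf); apply/andP; split; rewrite leNgt; apply/negP => h;
    apply: none; [exists (fun i => v i), true|exists (fun i => v i), false];
    by split=> //; exact: ltW.
have : `|\sum_v Y v| <= #|{: box m}|%:R * T + #|bad|%:R * (#|{: box M}|%:R * c).
  apply: le_trans (ler_norm_sum _ _ _) _; rewrite (bigID bad) /= addrC.
  apply: lerD.
    apply: le_trans (ler_sum _ small) _; rewrite sumr_const -[_ *+ #|_|]mulr_natl.
    apply: ler_wpM2r; last by rewrite ler_nat max_card.
    by rewrite mulr_ge0 // ltW // divr_gt0.
  apply: le_trans (ler_sum _ (fun v _ => Ybad v)) _.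
  by rewrite sumr_const -[_ *+ #|_|]mulr_natl.
rewrite sumY sumX normrM normr_nat.
have M0 : 0 < #|{: box M}|%:R :> R.
  by rewrite ltr0n; apply/card_gt0P; exists [ffun=> ord0].
have m0 : 0 < #|{: box m}|%:R :> R.
  by rewrite ltr0n; apply/card_gt0P; exists [ffun=> ord0].
have {}mag : delta * #|{: box m}|%:R <= `|value (Ostag R n d.+1 m)|.
  move: mag; rewrite /mag_seq normrM normfV normr_nat ler_pdivlMr //.
have N0 : 0 < (m.*2.+2)%:R :> R by rewrite ltr0n.
have {badcard} : #|bad|%:R * (m.*2.+2)%:R <= (d.+1 * M.*2.+2)%:R * #|{: box m}|%:R :> R.
  by rewrite -!natrM ler_nat.
move: wide mag; rewrite /T -/c.
move: (`|value _|) (#|bad|%:R) (#|_|%:R) (#|_|%:R) (_.+2%:R) (_ * _)%:R M0 m0 N0.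
move=> v b p q N D q0 p0 N0 Dc pv bN.
have -> : p * (delta / 2 * q) + b * (q * c) = q * (p * (delta / 2) + b * c) by ring.
rewrite ler_pM2l // => vle.
have h1 : v * N <= (p * (delta / 2) + b * c) * N by rewrite ler_pM2r.
have h2 : b * N * c <= D * p * c by apply: ler_wpM2r.
have h3 : D * c * p < delta / 2 * N * p by rewrite ltr_pM2r.
have h4 : delta * p * N <= v * N by rewrite ler_pM2r.
have : (p * (delta / 2) + b * c) * N = p * (delta / 2) * N + b * N * c by ring.
move: h1 h2 h3 h4; lra.
Qed.

End InfiniteVolume.

(** * Magnetisation in arbitrarily large boxes *)

Section LimitSuperior.
Import normed_module.numFieldNormedType.Exports.

(** Otherwise the sequence tends to 0 and so does its limit superior. Only the modulus is bounded
    below, since the limit superior may be negative. *)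
Lemma limn_sup_neq0 (R : realType) (u : nat -> R) : limn_sup u <> 0 ->
  exists2 delta : R, 0 < delta & forall N, exists2 m, (N <= m)%N & delta <= `|u m|.
Proof.
move=> u0; apply: boolp.contrapT => none; apply: u0.
apply: (cvg_limn_inf_sup _).2.
apply/pseudometric_normed_Zmodule.cvgr0Pnorm_lt => delta d0.
suff [N hN] : exists N, forall m, (N <= m)%N -> `|u m| < delta by exists N.
apply: boolp.contrapT => noN; apply: none; exists delta => // N.
apply: boolp.contrapT => noM; apply: noN; exists N => m Nm; rewrite ltNge; apply/negP => h.
by apply: noM; exists m.
Qed.

End LimitSuperior.

Lemma card_box d m : #|{: Box d m}| = (m.*2.+2 ^ d)%N.
Proof. by rewrite card_ffun !card_ord. Qed.

Lemma exists_large (R : realType) (x : R) : exists N : nat, forall m, (N <= m)%N -> x < m%:R.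
Proof.
exists (Num.Def.archi_bound `|x|) => m h.
apply: le_lt_trans (ler_norm x) _; apply: lt_le_trans (archi_boundP (normr_ge0 _)) _.
by rewrite ler_nat.
Qed.

(* A ground state of infinite volume with magnetisation delta, restricted to a
   well-chosen tile, competes with the finite-volume ground state: the field
   term B O is extensive while the cost is only a boundary term. *)
Lemma finite_volume_magnetisation (R : realType) (n d : nat) (w : State R n d.+1)
    (delta : R) :
  is_inf_gs w -> 0 < delta ->
  (forall N, exists2 m, (N <= m)%N & delta <= `|mag_seq w m|) ->
  forall M (B : R) (P : Op R n d.+1 M), 0 < B -> is_gs_proj (Hp n d.+1 M B) P ->
  delta / 2 - (1 + 36 * (d.+1 ^ 2)%:R * casimir R n) / (B * (M.*2.+2)%:R) <=
  gs_val P (Ostag R n d.+1 M) / #|{: Box d.+1 M}|%:R.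
Proof.
move=> gs d0 many M B P B0 gsP.
have [N hN] := exists_large ((d.+1 * M.*2.+2)%:R * ((casimir R n + 1) / 2) / (delta / 2)).
have [m Nm mag] := many (maxn M N).
have [|k [s [kf mtile]]] := staggered_tile gs d0 (leq_trans (leq_maxl _ _) Nm) mag.
  rewrite -ltr_pdivrMl ?divr_gt0 // mulrC; apply: hN.
  by apply: leq_trans (leq_trans (leq_maxr M N) Nm) _; lia.
have := tile_bound gs s kf B0 gsP.
have k0 : 0 <= casimir R n by rewrite /casimir divr_ge0.
pose X := gs_val P (Ostag R n d.+1 M).
pose q : R := #|{: Box d.+1 M}|%:R; pose L : R := (M.*2.+2)%:R.
have q0 : 0 < q by rewrite ltr0n; apply/card_gt0P; exists [ffun=> ord0].
have L0 : 0 < L by rewrite ltr0n.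
(* Boundary sites are a fraction at most 2 (d+1) / L of the tile, hence the constant 9 * 2 * 2 =
   36. *)
have cost : boundary_cost R n d M * L <= (1 + 36 * (d.+1 ^ 2)%:R * casimir R n) * q.
  rewrite /boundary_cost mulrDl mul1r [leRHS]mulrDl mul1r; apply: lerD.
    by rewrite ler_nat card_box expnS leq_pmulr // expn_gt0.
  have := card_not_interior d.+1 M; rewrite -(ler_nat R) !natrM -/q -/L.
  move: (#|_|%:R) => z zL.
  have -> : 9%:R * (2%:R * d.+1%:R) * z * casimir R n * L =
    9 * (2 * d.+1%:R) * casimir R n * (z * L) :> R by ring.
  have -> : 36 * (d.+1%:R * d.+1%:R) * casimir R n * q =
    9 * (2 * d.+1%:R) * casimir R n * (2 * d.+1%:R * q) :> R.
    by ring.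
  apply: ler_wpM2l => //; apply: mulr_ge0 => //; apply: mulr_ge0 => //.
  exact: mulr_ge0.
rewrite -/X -/q; move: mtile cost; rewrite -/q.
move: (value _ _) (boundary_cost _ _ _ _) (1 + _) => v c C' mtile cost h.
rewrite ler_pdivlMr // mulrBl -(ler_pM2l B0) mulrBr.
have Bn0 := lt0r_neq0 B0; have Ln0 := lt0r_neq0 L0.
have -> : B * (C' / (B * L) * q) = C' * q / L.
  by move: (L) Ln0 => l ln0; field; rewrite ln0.
apply: le_trans h; apply: lerB; first by rewrite ler_pM2l.
by rewrite ler_pdivlMr.
Qed.

(** * The test function *)

Section LipschitzProfile.
Variables (R : realType) (V : finType) (adj : rel V) (g : V -> R) (D : nat) (rho : R).
Hypothesis adj_sym : symmetric adj.
Hypothesis degree_le : forall x, (#|[pred y | adj x y]| <= D)%N.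
Hypothesis degree_eq : forall x y, #|[pred z | adj x z]| = #|[pred z | adj y z]|.
Hypothesis g_ge0 : forall x, 0 <= g x.
Hypothesis rho_ge0 : 0 <= rho.
Hypothesis g_le : forall x, g x <= rho.
Hypothesis g_lip : forall x y, adj x y -> `|g x - g y| <= 1.
Local Notation F := (bond_weight adj g).
Local Notation s := (#|[pred x | g x != 0]|%:R : R).
Local Notation Dr := (D%:R : R).

Lemma sum_degree x (c : R) : 0 <= c -> \sum_(y | adj x y) c <= Dr * c.
Proof.
move=> c0; rewrite sumr_const -[_ *+ #|_|]mulr_natl; apply: ler_wpM2r => //.
by rewrite ler_nat; exact: degree_le.
Qed.

Lemma sum_bonds (u : V -> R) : (forall x, 0 <= u x) ->
  \sum_x \sum_(y | adj x y) (u x + u y) <= 2 * Dr * \sum_x u x.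
Proof.
move=> u0; have left : \sum_x \sum_(y | adj x y) u x <= Dr * \sum_x u x.
  rewrite mulr_sumr; apply: ler_sum => x _.
  exact: sum_degree.
have -> : \sum_x \sum_(y | adj x y) (u x + u y) =
    \sum_x \sum_(y | adj x y) u x + \sum_x \sum_(y | adj x y) u x.
  under eq_bigr => x _ do rewrite big_split.
  rewrite big_split /=; congr (_ + _).
  rewrite (exchange_big_dep predT) //=.
  by apply: eq_bigr => y _; apply: eq_bigl => x; rewrite adj_sym.
by move: left; move: (\sum_x _) (\sum_x _) => a b; lra.
Qed.

Lemma sum_support (u : V -> R) (c : R) : (forall x, u x <= c * (g x != 0)%:R) ->
  \sum_x u x <= c * s.
Proof.
move=> h; apply: le_trans (ler_sum _ (fun x _ => h x)) _; rewrite -mulr_sumr.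
rewrite -[#|_|]sum1_card natr_sum [X in _ * X]big_mkcond /= [X in _ <= _ * X]big_mkcond.
by rewrite le_eqVlt (_ : _ * _ == _) //; apply/eqP; congr (_ * _);
  apply: eq_bigr => x _; rewrite inE; case: (g x != 0).
Qed.

Lemma sum_profile_sqr : \sum_x g x ^+ 2 <= rho ^+ 2 * s.
Proof.
apply: sum_support => x; have [->|_] := eqVneq (g x) 0; first by rewrite expr0n mulr0.
rewrite mulr1; apply: lerXn2r; rewrite ?nnegrE //.
Qed.

Lemma field_energy_le : field_energy adj g <= Dr * rho ^+ 2 * s.
Proof.
rewrite /field_energy.
have h : \sum_x \sum_(y | adj x y) (g x + g y) ^+ 2 <=
    2 * \sum_x \sum_(y | adj x y) (g x ^+ 2 + g y ^+ 2).
  rewrite mulr_sumr; apply: ler_sum => x _; rewrite mulr_sumr; apply: ler_sum => y _.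
  have : 0 <= (g x - g y) ^+ 2 by exact: sqr_ge0.
  by rewrite !expr2; move: (g x) (g y) => a b; nra.
have := sum_bonds (fun x => sqr_ge0 (g x)); have := sum_profile_sqr.
have D0 : 0 <= Dr by [].
move=> h1 h2; have : Dr * \sum_x g x ^+ 2 <= Dr * (rho ^+ 2 * s) by exact: ler_wpM2l.
move: h h2; rewrite -!mulrA.
move: (\sum_x _) (\sum_x _) (\sum_x _) => a b c; move: (Dr * c) (Dr * _) => e f; lra.
Qed.

Lemma bond_weight_ge0 x : 0 <= F x.
Proof. by apply: sumr_ge0 => y _; apply: addr_ge0. Qed.

Lemma sum_bond_weight_sqr : \sum_x F x ^+ 2 <= 4 * Dr ^+ 2 * rho ^+ 2 * s.
Proof.
have F_le x : F x <= 2 * Dr * rho.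
  apply: (@le_trans _ _ (\sum_(y | adj x y) 2 * rho)).
    by apply: ler_sum => y _; have := g_le x; have := g_le y; lra.
  rewrite [2 * Dr]mulrC -mulrA; apply: sum_degree.
  by rewrite mulr_ge0.
have F2 x : F x ^+ 2 <= 2 * Dr * rho * F x.
  by rewrite expr2; apply: ler_wpM2r => //; exact: bond_weight_ge0.
apply: le_trans (ler_sum _ (fun x _ => F2 x)) _; rewrite -mulr_sumr.
have c0 : 0 <= 2 * Dr * rho by rewrite !mulr_ge0.
apply: le_trans (ler_wpM2l c0 (sum_bonds g_ge0)) _.
have : \sum_x g x <= rho * s.
  apply: sum_support => x; have [->|_] := eqVneq (g x) 0; first by rewrite mulr0.
  by rewrite mulr1.
move=> h; have -> : 4 * Dr ^+ 2 * rho ^+ 2 * s = 2 * Dr * rho * (2 * Dr * (rho * s)) by ring.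
by do 2!apply: ler_wpM2l => //; rewrite mulr_ge0.
Qed.

(** F_x is 2 deg(x) g_x plus the sum of the differences g_y - g_x, which is at most D in modulus. As
    all degrees agree, the main terms differ by at most 2D and the total is 4D, with no trace of the
    height of g. *)
Lemma bond_weight_step x y : adj x y -> `|F x - F y| <= 4 * Dr.
Proof.
have e z : `|F z - 2 * (#|[pred y | adj z y]|%:R * g z)| <= Dr.
  have -> : F z - 2 * (#|[pred y | adj z y]|%:R * g z) = \sum_(y | adj z y) (g y - g z).
    rewrite /bond_weight sumrB big_split /= sumr_const.
    have -> : g z *+ #|adj z| = #|[pred y | adj z y]|%:R * g z by rewrite mulr_natl.
    by move: (\sum_(y | _) _) (_%:R * _) => a b; ring.
  apply: le_trans (ler_norm_sum _ _ _) _.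
  apply: (@le_trans _ _ (\sum_(y | adj z y) 1)).
    by apply: ler_sum => y' zy; apply: g_lip; rewrite adj_sym.
  by rewrite -[leRHS]mulr1; apply: sum_degree.
move=> xy; have := e x; have := e y; rewrite -(degree_eq x y).
have := g_lip xy; have : #|[pred z | adj x z]|%:R <= Dr by rewrite ler_nat; exact: degree_le.
have : 0 <= #|[pred z | adj x z]|%:R :> R by [].
move: (#|_|%:R) (F x) (F y) (g x) (g y) => k a b p q k0 kD.
rewrite !ler_norml => /andP[h1 h2] /andP[h3 h4] /andP[h5 h6].
have h7 : k * (p - q) <= k * 1 by apply: ler_wpM2l.
have h8 : k * (-1) <= k * (p - q) by apply: ler_wpM2l.
by apply/andP; split; move: h3 h4 h5 h6 h7 h8; nra.
Qed.

(** Squared steps are at most 16 D^2, and only on bonds that meet the support of F. This support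
    lies within one step of that of g, so it has at most (1 + D) s sites, with at most 2D ordered
    bonds each. *)
Lemma sum_bond_weight_diff :
  \sum_x \sum_(y | adj x y) (F x - F y) ^+ 2 <= 32 * Dr ^+ 3 * (1 + Dr) * s.
Proof.
pose chi x : R := (F x != 0)%:R.
have chi0 x : 0 <= chi x by [].
have step x y : adj x y -> (F x - F y) ^+ 2 <= 16 * Dr ^+ 2 * (chi x + chi y).
  move=> xy; rewrite /chi; have [Fx|Fx] := eqVneq (F x) 0; last first.
    have h : (F x - F y) ^+ 2 <= 16 * Dr ^+ 2.
      rewrite -real_normK ?num_real //; have -> : 16 * Dr ^+ 2 = (4 * Dr) ^+ 2 by ring.
      by rewrite lerXn2r ?nnegrE ?mulr_ge0 // bond_weight_step.
    apply: le_trans h _; rewrite ler_peMr ?mulr_ge0 ?sqr_ge0 //.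
    by rewrite lerDl.
  have [Fy|Fy] := eqVneq (F y) 0; first by rewrite Fx Fy subrr expr0n addr0 mulr0.
  rewrite add0r mulr1 -real_normK ?num_real //.
  have -> : 16 * Dr ^+ 2 = (4 * Dr) ^+ 2 by ring.
  by rewrite lerXn2r ?nnegrE ?mulr_ge0 // bond_weight_step.
have : \sum_x \sum_(y | adj x y) (F x - F y) ^+ 2 <=
    16 * Dr ^+ 2 * \sum_x \sum_(y | adj x y) (chi x + chi y).
  rewrite mulr_sumr; apply: ler_sum => x _; rewrite mulr_sumr; apply: ler_sum => y.
  exact: step.
move=> /le_trans; apply.
have c0 : 0 <= 16 * Dr ^+ 2 by rewrite mulr_ge0 ?sqr_ge0.
apply: le_trans (ler_wpM2l c0 (sum_bonds chi0)) _.
have chi_le : \sum_x chi x <= s + Dr * s.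
  pose nz x : R := (g x != 0)%:R.
  have nz_le x : chi x <= nz x + \sum_(y | adj x y) nz y.
    rewrite /chi; have [_|Fx] := eqVneq (F x) 0.
      by apply: addr_ge0 => //; apply: sumr_ge0.
    have [gx|gx] := boolP (g x != 0).
      by rewrite /nz gx lerDl; apply: sumr_ge0.
    have [y xy gy] : exists2 y, adj x y & g y != 0.
      apply: boolp.contrapT => none; move/negP: Fx; apply; apply/eqP.
      apply: big1 => y xy; rewrite (eqP (negbNE gx)) add0r.
      by apply/eqP/negbNE/negP => gy; apply: none; exists y.
    rewrite (bigD1 y) //= {1}/nz (negbTE gx) add0r /nz gy lerDl.
    by apply: sumr_ge0.
  apply: le_trans (ler_sum _ (fun x _ => nz_le x)) _; rewrite big_split /=.
  have nzs : \sum_x nz x <= s.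
    by rewrite -[leRHS]mul1r; apply: sum_support => x; rewrite mul1r.
  apply: lerD => //; rewrite (exchange_big_dep predT) //=.
  apply: le_trans (ler_wpM2l (ler0n R D) nzs); rewrite mulr_sumr; apply: ler_sum => x _.
  rewrite sumr_const -[_ *+ #|_|]mulr_natl ler_wpM2r // ler_nat.
  apply: leq_trans (degree_le x); apply: subset_leq_card; apply/subsetP => y.
  by rewrite !inE adj_sym.
have -> : 32 * Dr ^+ 3 * (1 + Dr) * s = 16 * Dr ^+ 2 * (2 * Dr * (s + Dr * s)) by ring.
by do 2!apply: ler_wpM2l => //; rewrite mulr_ge0.
Qed.

Lemma sum_bond_weight_support : (forall x, exists y, adj x y) ->
  \sum_x g x <= \sum_x F x * (g x != 0)%:R.
Proof.
move=> nbr; apply: ler_sum => x _; have [->|_] := eqVneq (g x) 0; first by rewrite mulr0.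
have [y xy] := nbr x; rewrite mulr1 /bond_weight (bigD1 y) //= -addrA lerDl.
by apply: addr_ge0 => //; apply: sumr_ge0 => z _; apply: addr_ge0.
Qed.

End LipschitzProfile.

(** * The pyramid on the torus *)

Section LayerProfile.
Variables (d m : nat).
Local Notation box := (Box d m).

Lemma inbox_ptE k (x : box) :
  inbox k (pt x) = [forall i, (m <= x i + k)%N && (x i <= m.+1 + k)%N].
Proof.
apply: eq_forallb => i; rewrite /pt; move: (nat_of_ord (x i)) => q.
by apply/idP/idP => /andP[h1 h2]; apply/andP; split; lia.
Qed.

Lemma inbox_le k l (x : box) : (k <= l)%N -> inbox k (pt x) -> inbox l (pt x).
Proof.
rewrite !inbox_ptE => kl /forallP h; apply/forallP => i.
by have /andP[h1 h2] := h i; apply/andP; split; lia.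
Qed.

(** A wrap-around bond joins the indices 0 and 2m+1; a centred box that reaches either of them in
    some coordinate is already the whole torus. *)
Lemma inbox_adj k (x y : box) : adjp x y -> inbox k (pt x) -> inbox k.+1 (pt y).
Proof.
rewrite !inbox_ptE => /adjpP[i xy] /forallP h; apply/forallP => j.
have [ji|ij] := eqVneq j i; last first.
  have -> : y j = x j.
    by case: xy => ->; rewrite ffunE [unit_box _ _ _]ffunE (negPf ij) addr0.
  by have /andP[h1 h2] := h j; apply/andP; split; lia.
have /andP[h1 h2] := h j; have xN := ltn_ord (x j); have yN := ltn_ord (y j).
have {xy} : y j = ((x j).+1 %% m.*2.+2)%N :> nat \/ x j = ((y j).+1 %% m.*2.+2)%N :> nat.
  by case: xy => e; [left|right]; rewrite {1}e !ffunE ji eqxx val_ordD val_ord1 addn1.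
move: (nat_of_ord (x j)) (nat_of_ord (y j)) xN yN h1 h2 => p q pN qN h1 h2.
have step a b : (a < m.*2.+2)%N -> b = (a.+1 %% m.*2.+2)%N -> b = a.+1 \/ (b = 0 /\ a.+1 = m.*2.+2)%N.
  rewrite leq_eqVlt => /orP[/eqP e|lt] ->; first by right; rewrite e modnn.
  by left; rewrite modn_small.
by case => [/(step _ _ pN)|/(step _ _ qN)] [e|[e e']]; apply/andP; split; lia.
Qed.

(* A pyramid of height K and slope 1, as a sum of indicators of nested boxes. *)
Definition layers (K : nat) (x : box) : nat := (\sum_(k < K) inbox k (pt x))%N.

Lemma layers_le K x : (layers K x <= K)%N.
Proof.
rewrite /layers -[leqRHS](card_ord K) -sum1_card; apply: leq_sum => k _.
exact: leq_b1.
Qed.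

(** If x lies in layer k then y lies in layer k+1, so only the outermost layer of x is lost. *)
Lemma layers_adj K x y : adjp x y -> (layers K x <= (layers K y).+1)%N.
Proof.
move=> xy; case: K => [|K]; first by rewrite /layers !big_ord0.
rewrite /layers big_ord_recr [X in (_ <= X.+1)%N]big_ord_recl /=.
apply: (@leq_trans (\sum_(k < K) inbox k.+1 (pt y) + 1)).
  rewrite leq_add ?leq_b1 //; apply: leq_sum => k _.
  by case: (boolP (inbox k (pt x))) => // /(inbox_adj xy) ->.
by rewrite addn1 ltnS leq_addl.
Qed.

Lemma layers_gt0 K x : (layers K.+1 x != 0%N) = inbox K (pt x).
Proof.
rewrite /layers big_ord_recr /=; case: (boolP (inbox K (pt x))) => [_|xN].
  by rewrite addn1.
rewrite addn0 big1 ?eqxx // => k _; case: (boolP (inbox k (pt x))) => // h.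
by rewrite (inbox_le (ltnW (ltn_ord k)) h) in xN.
Qed.

Lemma layers_core k K x : inbox k (pt x) -> (K - k <= layers K x)%N.
Proof.
move=> xk; rewrite /layers -[X in (X - _)%N]card_ord -sum1_card.
rewrite leq_subLR; apply: (@leq_trans (\sum_(j < K) ((j < k)%N + inbox j (pt x)))).
  apply: leq_sum => j _; case: (leqP k j) => [kj|//]; by rewrite (inbox_le kj xk).
rewrite big_split /= leq_add2r; elim: K => [|K IH]; first by rewrite big_ord0.
rewrite big_ord_recr /=; case: (ltnP K k) => [Kk|kK]; last by rewrite addn0.
rewrite addn1; apply: leq_trans Kk; rewrite ltnS.
rewrite -[X in (_ <= X)%N]card_ord -sum1_card; apply: leq_sum => j _.
exact: leq_b1.
Qed.

End LayerProfile.

Section LayerProfileTorus.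
Variables (d m : nat).
Local Notation box := (Box d.+1 m).

Lemma card_inbox k : (k <= m)%N -> #|[pred x : box | inbox k (pt x)]| = (k.*2.+2 ^ d.+1)%N.
Proof.
move=> km; have ii : injective (place m (fun=> (m - k)%N) : Box d.+1 k -> box).
  by apply: place_inj => i /=; lia.
by rewrite -card_box -(card_codom ii); apply: eq_card => x; rewrite inE codom_incl.
Qed.

Lemma inbox_mirror k (x : box) : inbox k (pt (mirror x)) = inbox k (pt x).
Proof.
have half (y : box) : inbox k (pt y) -> inbox k (pt (mirror y)).
  rewrite !inbox_ptE => /forallP h; apply/forallP => i.
  have := h i; rewrite /mirror ffunE; case: eqP => // _ /andP[h1 h2].
  have := ltn_ord (y i); rewrite addrC val_ordNB1.
  by move: (nat_of_ord _) h1 h2 => q h1 h2 qN; apply/andP; split; lia.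
by apply/idP/idP => /half //; rewrite mirrorK.
Qed.

Lemma layers_mirror K (x : box) : layers K (mirror x) = layers K x.
Proof. by apply: eq_bigr => k _; rewrite inbox_mirror. Qed.

Lemma adjp_degree_eq (x y : box) : #|[pred z | adjp x z]| = #|[pred z | adjp y z]|.
Proof.
have e (v : box) : #|[pred z | adjp v z]| = #|[pred z | adjp ([ffun=> 0] : box) z]|.
  rewrite -[RHS](card_imset _ (@add_box_inj _ _ v)); apply: eq_card => z; rewrite !inE.
  have v0 : v = add_box v [ffun=> 0] by apply/ffunP => i; rewrite !ffunE addr0.
  apply/idP/imsetP => [vz|[u vu ->]]; last by rewrite {1}v0 adjp_add.
  have zE : z = add_box v ((z : {ffun 'I_d.+1 -> 'I__}) - (v : {ffun 'I_d.+1 -> 'I__})).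
    by rewrite /add_box addrC subrK.
  eexists; last exact: zE.
  by move: vz; rewrite {1}v0 {1}zE adjp_add.
by rewrite e [RHS]e.
Qed.

Lemma adjp_exists (x : box) : exists y, adjp x y.
Proof. by exists (add_box x (unit_box m ord0)); apply/adjpP; exists ord0; left. Qed.

End LayerProfileTorus.

(** * The transverse inequality for the pyramid *)

Section TorusBound.
Variables (R : realType) (n d m r : nat) (B : R) (P : Op R n d.+1 m).
Local Notation box := (Box d.+1 m).
Local Notation kappa := (casimir R n).
Local Notation D := (d.+1%:R : R).
Hypothesis r_gt0 : (0 < r)%N.
Hypothesis rm : (2 * r <= m)%N.
Hypothesis B_ge0 : 0 <= B.
Hypothesis Br : B * r%:R ^+ 2 <= 1.
Hypothesis gsP : is_gs_proj (Hp n d.+1 m B) P.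

(** The profile bounds with degree 2D and height 2r, where D is the dimension: 64 D = 8 * 2D * 4
    from the field energy, 256 D^3 = 32 (2D)^3 from the steps, and 64 D^2 = 4 (2D)^2 * 4 from the
    field term, in which B r^2 <= 1. *)
Definition torus_const : R :=
  64 * D * (kappa * (256 * D ^+ 3 * (1 + 2 * D)) + (kappa + 1) / 2 * (64 * D ^+ 2)).

(** The support of the pyramid: the box of index 2r - 1 has side 4r. *)
Definition cutoff (x : box) : R := (inbox (2 * r).-1 (pt x))%:R.

Lemma torus_bound (mag : R) : 0 <= mag ->
    mag <= gs_val P (Ostag R n d.+1 m) / #|{: box}|%:R ->
  (r%:R * (2 * r%:R) ^+ d.+1 * mag) ^+ 4 <=
  torus_const * r%:R ^+ 2 * ((4 * r%:R) ^+ d.+1) ^+ 2 *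
  gs_val P (transverse n (@parity d.+1 m) cutoff *m
            transverse n (@parity d.+1 m) cutoff) ^+ 2.
Proof.
move=> mag0 magle.
pose g (x : box) : R := (layers (2 * r) x)%:R.
have gM x : g (mirror x) = g x by rewrite /g layers_mirror.
have bM x : cutoff (mirror x) = cutoff x by rewrite /cutoff inbox_mirror.
have g0 x : 0 <= g x by rewrite /g.
have rho0 : 0 <= 2 * r%:R :> R by rewrite mulr_ge0.
have gle x : g x <= 2 * r%:R by rewrite /g -natrM ler_nat layers_le.
have glip x y : adjp x y -> `|g x - g y| <= 1.
  move=> xy; rewrite ler_norml /g; have := layers_adj (2 * r) xy.
  rewrite adjp_sym in xy; have := layers_adj (2 * r) xy.
  rewrite -!(ler_nat R) -!natr1; move: (_%:R) (_%:R) => p q h1 h2.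
  by apply/andP; split; lra.
have bE x : cutoff x = (g x != 0)%:R.
  rewrite /cutoff /g pnatr_eq0 -{2}[(2 * r)%N]prednK ?muln_gt0 // layers_gt0.
  by [].
have sE : #|[pred x | g x != 0]| = ((4 * r) ^ d.+1)%N.
  have -> : (4 * r = (2 * r).-1.*2.+2)%N by lia.
  rewrite -(@card_inbox d m); last by lia.
  apply: eq_card => x; rewrite !inE /g pnatr_eq0.
  by rewrite -{1}[(2 * r)%N]prednK ?muln_gt0 // layers_gt0.
have := finite_volume_inequality B_ge0 gsP gM bM.
have := field_energy_le (@adjp_sym _ _) (@adjp_degree _ _) g0 rho0 gle.
have := sum_bond_weight_sqr (@adjp_sym _ _) (@adjp_degree _ _) g0 rho0 gle.
have := sum_bond_weight_diff (@adjp_sym _ _) (@adjp_degree _ _) (@adjp_degree_eq _ _) glip.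
have : r%:R * (2 * r%:R) ^+ d.+1 <= \sum_x bond_weight (@adjp d.+1 m) g x * cutoff x.
  under eq_bigr => x _ do rewrite bE.
  apply: le_trans (sum_bond_weight_support g0 (@adjp_exists _ _)).
  (* On the centred box of index r - 1, of side 2r, the pyramid is at least r. *)
  have -> : r%:R * (2 * r%:R) ^+ d.+1 = \sum_(x : box | inbox r.-1 (pt x)) r%:R :> R.
    rewrite sumr_const (@card_inbox d m); last by lia.
    have -> : (r.-1.*2.+2 = 2 * r)%N by lia.
    by rewrite -[RHS]mulr_natr natrX natrM.
  rewrite big_mkcond /=; apply: ler_sum => x _; case: ifP => // xr.
  by rewrite /g ler_nat; have := layers_core (2 * r) xr; lia.
rewrite sE natrX !natrM /torus_const.
have : 0 <= field_energy (@adjp d.+1 m) g.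
  rewrite /field_energy mulr_ge0 ?invr_ge0 //; apply: sumr_ge0 => x _.
  by apply: sumr_ge0 => y _; exact: sqr_ge0.
have : 0 <= \sum_x bond_weight (@adjp d.+1 m) g x ^+ 2.
  by apply: sumr_ge0 => y _; exact: sqr_ge0.
have : 0 <= \sum_(x : box) \sum_(y | adjp x y)
    (bond_weight (@adjp d.+1 m) g x - bond_weight (@adjp d.+1 m) g y) ^+ 2.
  by apply: sumr_ge0 => x _; apply: sumr_ge0 => y _; exact: sqr_ge0.
have : 0 <= r%:R * (2 * r%:R) ^+ d.+1 :> R by rewrite mulr_ge0 ?exprn_ge0.
have : 0 <= (4 * r%:R) ^+ d.+1 :> R by rewrite exprn_ge0 // mulr_ge0.
have : 0 <= kappa by rewrite /casimir divr_ge0.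
move: (sqr_ge0 (gs_val P (transverse n (@parity d.+1 m) cutoff *m
            transverse n (@parity d.+1 m) cutoff))).
move: (gs_val P (_ *m _) ^+ 2) (field_energy _ _) (\sum_x \sum_(y | _) _).
move: (\sum_x _ * _) (\sum_x _ ^+ 2) (_ * _ ^+ d.+1) (_ ^+ d.+1) kappa magle mag0.
move: (gs_val _ _ / _) => M S F2 a s k magle mag0 T2 G X.
move=> T0 k0 s0 a0 X0 F0 G0 aS Xle Fle Gle ineq.
have D0 : 0 <= D by [].
have step : G * (k * X + B * ((k + 1) / 2) * F2) <= 8 * D * r%:R ^+ 2 * s *
    ((k * (256 * D ^+ 3 * (1 + 2 * D)) + (k + 1) / 2 * (64 * D ^+ 2)) * s).
  have k1 : 0 <= (k + 1) / 2 by rewrite divr_ge0 // addr_ge0.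
  apply: ler_pM => //.
  - by rewrite addr_ge0 // mulr_ge0 // mulr_ge0.
  - by apply: le_trans Gle _; rewrite le_eqVlt; apply/orP; left; apply/eqP; ring.
  rewrite [leRHS]mulrDl; apply: lerD.
    rewrite -mulrA; apply: ler_wpM2l => //; apply: le_trans Xle _.
    by rewrite le_eqVlt; apply/orP; left; apply/eqP; ring.
  have -> : B * ((k + 1) / 2) * F2 = (k + 1) / 2 * (B * F2) by ring.
  rewrite -[leRHS]mulrA; apply: ler_wpM2l => //.
  apply: le_trans (ler_wpM2l B_ge0 Fle) _.
  have -> : B * (4 * (2 * D) ^+ 2 * (2 * r%:R) ^+ 2 * s) =
    64 * D ^+ 2 * s * (B * r%:R ^+ 2) by ring.
  by rewrite -[leRHS]mulr1; apply: ler_wpM2l => //; rewrite !mulr_ge0 ?exprn_ge0.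
apply: (@le_trans _ _ ((S * M) ^+ 4)).
  by apply: lerXn2r; rewrite ?nnegrE ?mulr_ge0 ?(le_trans a0 aS) ?(le_trans mag0 magle) // ler_pM.
apply: le_trans ineq _; apply: ler_wpM2r => //; rewrite -mulrA.
apply: le_trans (ler_wpM2l (ler0n R 8) step) _.
by rewrite le_eqVlt; apply/orP; left; apply/eqP; ring.
Qed.

End TorusBound.

(** * Transverse correlations *)

Section CorrelationSum.
Variables (R : realType) (d N : nat).
Local Notation site := {ffun 'I_d.+1 -> 'I_N}.

Definition gap (a b : nat) : nat := ((a - b) + (b - a))%N.

Lemma card_gap (a k : nat) : (#|[pred t : 'I_N | (gap t a <= k)%N]| <= k.*2.+1)%N.
Proof.
pose f (t : 'I_N) : 'I_k.*2.+1 := inord (t + k - a).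
rewrite -[leqRHS]card_ord -(@card_in_imset _ _ f); first exact: max_card.
move=> s t; rewrite !inE /gap => sa ta /(congr1 val); rewrite /f /= !inordK; try by lia.
by move=> e; apply: val_inj => /=; lia.
Qed.

(** The sites whose sup-norm distance to q is attained in coordinate i, where they take the value t:
    one face of a cube around q. *)
Definition slab (q : site) (i : 'I_d.+1) (t : 'I_N) (f : site) : bool :=
  (f i == t) && [forall j, (gap (f j) (q j) <= gap t (q i))%N].

Lemma card_slab q i t : (#|[pred f | slab q i t f]| <= (gap t (q i)).*2.+1 ^ d)%N.
Proof.
set k := gap _ _.
pose e (f : site) : {ffun 'I_d -> 'I_k.*2.+1} :=
  [ffun j => inord (f (lift i j) + k - q (lift i j))].
have -> : (k.*2.+1 ^ d = #|{: {ffun 'I_d -> 'I_k.*2.+1}}|)%N.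
  by rewrite card_ffun !card_ord.
rewrite -(@card_in_imset _ _ e); first exact: max_card.
move=> f g; rewrite !inE => /andP[/eqP fi /forallP fk] /andP[/eqP gi /forallP gk] fg.
apply/ffunP => j; case: (unliftP i j) => [l ->|->]; last by rewrite fi gi.
have /ffunP/(_ l) := fg; rewrite !ffunE => /(congr1 val) /=.
have := fk (lift i l); have := gk (lift i l); rewrite -/k /gap.
move: (f _) (g _) (nat_of_ord (q _)) => x y z yz xz.
by rewrite !inordK; try lia; move=> xy; apply: val_inj => /=; lia.
Qed.

(* i is a coordinate realising the sup-norm distance between q and f. *)
Lemma exists_slab (q f : site) : exists i, slab q i (f i) f.
Proof.
exists [arg max_(i > ord0) gap (f i) (q i)]; rewrite /slab eqxx /=.
apply/forallP => j; case: arg_maxnP => // i _ h; exact: h.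
Qed.

(** A slab at distance k has at most (2k+1)^d sites, each of weight at most eps / k^d, so every far
    slab contributes at most 3^d eps whatever its distance. The dimension being d + 1, this is the
    borderline exponent. Near slabs are bounded through their number and K. *)
Lemma correlation_sum (q : site) (h : site -> R) (eps K : R) (r0 : nat) :
    0 <= eps -> 0 <= K -> (forall f, 0 <= h f) -> (forall f, h f <= K) ->
    (forall (f : site) i, (r0 < gap (f i) (q i))%N ->
       (gap (f i) (q i))%:R ^+ d * h f <= eps) ->
  \sum_f h f <= d.+1%:R * (N%:R * (3 ^+ d * eps) + K * (r0.*2.+1)%:R ^+ d.+1).
Proof.
move=> e0 K0 h0 hK far.
have cover f : h f <= \sum_i \sum_t (slab q i t f)%:R * h f.
  have [i hi] := exists_slab q f; rewrite (bigD1 i) //= (bigD1 (f i)) //= hi mul1r.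
  rewrite -addrA lerDl; apply: addr_ge0; first by apply: sumr_ge0 => t _; rewrite mulr_ge0.
  by apply: sumr_ge0 => j _; apply: sumr_ge0 => t _; rewrite mulr_ge0.
apply: le_trans (ler_sum _ (fun f _ => cover f)) _.
rewrite exchange_big /=.
suff slice i : \sum_f \sum_t (slab q i t f)%:R * h f <=
    N%:R * (3 ^+ d * eps) + K * (r0.*2.+1)%:R ^+ d.+1.
  apply: le_trans (ler_sum _ (fun i _ => slice i)) _.
  by rewrite sumr_const card_ord -[leLHS]mulr_natl.
rewrite exchange_big /=.
pose near t : bool := (gap t (q i) <= r0)%N.
have inner t : \sum_f (slab q i t f)%:R * h f <=
    3 ^+ d * eps + (near t)%:R * (K * (r0.*2.+1)%:R ^+ d).
  have count (c : R) : 0 <= c -> (forall f, slab q i t f -> h f <= c) ->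
      \sum_f (slab q i t f)%:R * h f <= (gap t (q i)).*2.+1%:R ^+ d * c.
    move=> c0 hc; apply: (@le_trans _ _ (\sum_(f | slab q i t f) c)).
      rewrite [leRHS]big_mkcond; apply: ler_sum => f _.
      by case: (boolP (slab q i t f)) => [/hc|_]; rewrite ?mul1r ?mul0r.
    rewrite sumr_const -[_ *+ #|_|]mulr_natl; apply: ler_wpM2r => //.
    by rewrite -natrX ler_nat; exact: card_slab.
  rewrite /near; case: leqP => tr.
    rewrite mul1r; apply: le_trans (count K K0 (fun f _ => hK f)) _.
    rewrite mulrC -[leLHS]add0r; apply: lerD; first by rewrite mulr_ge0 // exprn_ge0.
    apply: ler_wpM2l => //; apply: lerXn2r; rewrite ?nnegrE // ler_nat; lia.
  rewrite mul0r addr0; set k := gap _ _ in tr count *.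
  have k0 : 0 < k%:R :> R by rewrite ltr0n; apply: leq_trans tr.
  have c0 : 0 <= eps / k%:R ^+ d by rewrite divr_ge0 // exprn_ge0 // ltW.
  apply: le_trans (count _ c0 _) _.
    move=> f /andP[/eqP fi _]; rewrite ler_pdivlMr ?exprn_gt0 // mulrC.
    by have := far f i; rewrite fi; exact.
  have -> : 3 ^+ d * eps = (3 * k%:R) ^+ d * (eps / k%:R ^+ d).
    by rewrite exprMn -mulrA; congr (_ * _); rewrite mulrC divfK // gt_eqF // exprn_gt0.
  apply: ler_wpM2r => //; apply: lerXn2r; rewrite ?nnegrE ?mulr_ge0 //.
  by rewrite -natrM ler_nat; have := leq_trans (ltn0Sn r0) tr; lia.
apply: le_trans (ler_sum _ (fun t _ => inner t)) _.
rewrite big_split /= sumr_const card_ord -[X in X + _]mulr_natl; apply: lerD => //.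
rewrite -mulr_suml exprSr [leRHS]mulrA [leLHS]mulrC; apply: ler_wpM2l.
  by rewrite mulr_ge0 // exprn_ge0.
rewrite -natr_sum ler_nat; apply: leq_trans (card_gap (q i) r0).
rewrite -sum1_card [leqRHS]big_mkcond; apply: leq_sum => t _.
by rewrite inE /near; case: (gap t (q i) <= r0)%N.
Qed.

End CorrelationSum.

Lemma transverse_sqr_le (R : realType) (n : nat) (V : finType) (par : V -> bool)
    (f : 'M[R[i]]_#|{: {ffun V -> 'I_n.+1}}| -> R) (b : V -> R) :
  is_rstate f -> (forall x, 0 <= b x) ->
  `|f (transverse n par b *m transverse n par b)| <=
  \sum_x b x * \sum_y b y * `|f (S2_ R n x *m S2_ R n y)|.
Proof.
move=> hf b0; have cM (a c : R) : a%:C%C * c%:C%C = (a * c)%:C%C :> R[i].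
  by rewrite rmorphM.
have -> : transverse n par b *m transverse n par b =
    \sum_x \sum_y ((sublattice_sign R par x * b x) * (sublattice_sign R par y * b y))%:C%C *:
      (S2_ R n x *m S2_ R n y).
  rewrite transverseE mulmx_suml; apply: eq_bigr => x _.
  rewrite mulmx_sumr; apply: eq_bigr => y _.
  by rewrite -scalemxAl -scalemxAr scalerA cM.
rewrite (rstate_sum hf); apply: le_trans (ler_norm_sum _ _ _) _.
apply: ler_sum => x _; rewrite (rstate_sum hf) mulr_sumr.
apply: le_trans (ler_norm_sum _ _ _) _; apply: ler_sum => y _.
rewrite (rstateZ hf) !normrM /sublattice_sign !normrX !normrN1 !expr1n !mul1r.
by rewrite (ger0_norm (b0 x)) (ger0_norm (b0 y)) mulrA.
Qed.

(** * Approximating the limit state by finite volumes *)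

Section Correlations.
Variables (R : realType) (n d : nat).
Local Notation C := R[i].
Local Notation S2 := (S2_ R n).
Local Notation kappa := (casimir R n).
Implicit Types X Y : Pt d.+1.

Lemma sum_inbox m k (u : Box d.+1 m -> R) : (k <= m)%N ->
  \sum_x (inbox k (pt x))%:R * u x = \sum_(q : Box d.+1 k) u (box_of m (pt q)).
Proof.
move=> km; have ii : injective (place m (fun=> (m - k)%N) : Box d.+1 k -> Box d.+1 m).
  by apply: place_inj => i /=; lia.
under [RHS]eq_bigr => q _ do rewrite (box_of_pt km).
rewrite -(sum_codom _ ii) [RHS]big_mkcond /=; apply: eq_bigr => x _.
by rewrite (codom_incl km); case: (inbox _ _); rewrite ?mul1r ?mul0r.
Qed.

Lemma box_of_incl l m X : (l <= m)%N -> inbox l X ->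
  place m (fun=> (m - l)%N) (box_of l X) = box_of m X.
Proof.
move=> lm /forallP h; apply/ffunP => i; rewrite !ffunE; congr inord.
have /andP[] := h i; move: (X i) => x h1 h2; rewrite inordK; lia.
Qed.

Lemma inbox_lev X Y : inbox (lev X Y) X /\ inbox (lev X Y) Y.
Proof.
have le i : (absz (X i) + absz (Y i) <= lev X Y)%N.
  exact: (leq_bigmax i (F := fun i => (absz (X i) + absz (Y i))%N)).
by split; apply/forallP => i; have := le i; move: (lev _ _) => l h; apply/andP; split; lia.
Qed.

Lemma Re_fin_val m (B : R) (P : Op R n d.+1 m) X Y :
    is_gs_proj (Hp n d.+1 m B) P -> (lev X Y <= m)%N ->
  complex.Re (fin_val P (Defs.S2 R n (box_of (lev X Y) X) *m
                         Defs.S2 R n (box_of (lev X Y) Y))) =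
  gs_val P (S2 (box_of m X) *m S2 (box_of m Y)).
Proof.
move=> gsP lm; rewrite /fin_val lm !Defs_S2 (embedE lm).
have ii : injective (place m (fun=> (m - lev X Y)%N) : Box d.+1 (lev X Y) -> Box d.+1 m).
  by apply: place_inj => i /=; lia.
have [iX iY] := inbox_lev X Y.
rewrite (embM ii) !(emb_S2 R n _ ii) !box_of_incl //.
rewrite Hp_ham in gsP; have [t0 ->] := gs_trace_gt0 (dagH n d m B) gsP.
rewrite /gs_val; move: (\tr _) (complex.Re (\tr P)) => z t.
by rewrite -fmorphV mulrC ReZ mulrC.
Qed.

Lemma cvgC_Re (u : nat -> C) l : cvgC u l -> cvgR (fun k => complex.Re (u k)) (complex.Re l).
Proof.
move=> cv e e0; have [N hN] := cv e e0; exists N => k /hN h.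
have := le_lt_trans (normc_ge_Re (u k - l)) h.
by rewrite ltcR ReD ReN.
Qed.

Lemma cvgR_finite (I : finType) (u : I -> nat -> R) (l : I -> R) (e : R) : 0 < e ->
  (forall i, cvgR (u i) (l i)) ->
  exists N, forall k, (N <= k)%N -> forall i, `|u i k - l i| < e.
Proof.
move=> e0 cv; have [N hN] := fin_all_exists (fun i => cv i e e0).
exists (\max_i N i) => k Nk i; apply: hN; apply: leq_trans Nk; exact: (leq_bigmax i).
Qed.

(** The iterated limit is undone for finitely many pairs at once: a field along the sequence first,
    then a volume. The size requirement may therefore depend on the chosen field. *)
Lemma omega0_approximation (w0 : State R n d.+1) (I : finType) (X Y : I -> Pt d.+1)
    (e b : R) (M : R -> nat) : is_omega0 w0 -> 0 < e -> 0 < b ->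
  exists (B : R) (m : nat) (P : Op R n d.+1 m),
    [/\ 0 < B, B < b, (M B <= m)%N, is_gs_proj (Hp n d.+1 m B) P &
     forall i, `|gs_val P (S2 (box_of m (X i)) *m S2 (box_of m (Y i))) -
                 complex.Re (corr2 w0 (X i) (Y i))| < e].
Proof.
move=> [Bs [ws [Bs0 [cvB [lim cvw]]]]] e0 b0.
have e2 : 0 < e / 2 by rewrite divr_gt0.
pose A i : Op R n d.+1 (lev (X i) (Y i)) :=
  Defs.S2 R n (box_of _ (X i)) *m Defs.S2 R n (box_of _ (Y i)).
have [K1 hK1] := cvgR_finite e2 (fun i => cvgC_Re (cvw _ (A i))).
have [K2 hK2] := cvB b b0; pose k := maxn K1 K2.
have [phi [phi_incr [P [gsP cvP]]]] := lim k.
have phi_ge j : (j <= phi j)%N.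
  by elim: j => // j IH; apply: leq_ltn_trans IH (phi_incr j).
have [J hJ] := cvgR_finite e2 (fun i => cvgC_Re (cvP _ (A i))).
pose L := \max_i lev (X i) (Y i); pose j := maxn J (maxn L (M (Bs k))).
exists (Bs k), (phi j), (P (phi j)); split=> //.
- have := hK2 k (leq_maxr _ _); rewrite subr0; exact: le_lt_trans (ler_norm _).
- by apply: leq_trans (phi_ge j); rewrite /j !leq_max leqnn !orbT.
move=> i; have lm : (lev (X i) (Y i) <= phi j)%N.
  apply: leq_trans (phi_ge j); rewrite /j !leq_max; apply/orP; right; apply/orP; left.
  exact: (leq_bigmax i (F := fun i => lev (X i) (Y i))).
have := hK1 k (leq_maxl _ _) i; have := hJ j (leq_maxl _ _) i.
rewrite /A (Re_fin_val (gsP _) lm) /corr2.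
move: (gs_val _ _) (complex.Re _) (complex.Re _) => x y z.
by rewrite !ltr_norml => /andP[h1 h2] /andP[h3 h4]; apply/andP; split; lra.
Qed.

(** The bound kappa holds in finite volume; the summand 1 is the tolerance of the approximation. *)
Lemma corr2_bounded (w0 : State R n d.+1) X Y : is_omega0 w0 ->
  `|complex.Re (corr2 w0 X Y)| <= kappa + 1.
Proof.
move=> w0P; have [B [m [P [_ _ _ gsP h]]]] :=
  @omega0_approximation w0 unit (fun=> X) (fun=> Y) 1 1 (fun=> 0%N) w0P ltr01 ltr01.
have gsH := gsP; rewrite Hp_ham in gsH.
have := rstate_S22_le (gs_rstate (dagH n d m B) gsH) (box_of m X) (box_of m Y).
have := h tt; move: (gs_val _ _) (complex.Re _) kappa; clear => x y c.
by rewrite !ler_norml ltr_norml => /andP[h1 h2] /andP[h3 h4]; apply/andP; split; lra.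
Qed.

Lemma gap_distZ k (q f : Box d.+1 k) i : (gap (f i) (q i))%:R <= distZ R (pt q) (pt f).
Proof.
have -> : (gap (f i) (q i))%:R = Num.sqrt ((pt q i - pt f i)%:~R ^+ 2) :> R.
  rewrite sqrtr_sqr -intr_norm -[RHS]/((absz (pt q i - pt f i))%:R).
  congr (_%:R); rewrite /gap /pt.
  by move: (nat_of_ord (f i)) (nat_of_ord (q i)) => a b; lia.
rewrite ler_sqrt /distZ; last by apply: sumr_ge0 => j _; exact: sqr_ge0.
by rewrite (bigD1 i) //= lerDl; apply: sumr_ge0 => j _; exact: sqr_ge0.
Qed.

End Correlations.

Lemma torus_const_ge0 (R : realType) (n d : nat) : 0 <= torus_const R n d.
Proof.
have k0 : 0 <= casimir R n by rewrite /casimir divr_ge0.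
rewrite /torus_const; move: (casimir R n) k0 => k k0.
by repeat first [done | apply: mulr_ge0 | apply: addr_ge0 | apply: exprn_ge0 | rewrite invr_ge0].
Qed.

Lemma half_magnetisation (F : realFieldType) (c delta B l : F) :
    0 < delta -> 0 < B -> 0 < l -> c / (B * (delta / 4)) < l ->
  delta / 4 <= delta / 2 - c / (B * l).
Proof.
move=> d0 B0 l0; have d4 : 0 < B * (delta / 4) by rewrite mulr_gt0 // divr_gt0.
rewrite (ltr_pdivrMr _ _ d4) => h.
have : c / (B * l) < delta / 4.
  rewrite (ltr_pdivrMr _ _ (mulr_gt0 B0 l0)).
  by have -> : delta / 4 * (B * l) = l * (B * (delta / 4)) by ring.
by move: (c / _) => x; lra.
Qed.

(** With p = 2^(d+1) and x = (2r)^(d+1), both sides contain (r p x)^4. What is left is a^2 <= K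
    eps^2, where a = (delta / (4p))^2 and K = t c^2, and eps = a / (K + 1) violates it for every
    r. *)
Lemma quartic_contradiction (F : realFieldType) (t c delta p x r eps T : F) :
    0 <= t -> 0 <= c -> 0 < delta -> 0 < p -> 0 < x -> 0 < r ->
    eps = (delta / 4 / p) ^+ 2 / (t * c ^+ 2 + 1) ->
    `|T| <= c * (p * x * (r * eps)) ->
  (r * x * (delta / 4)) ^+ 4 <= t * r ^+ 2 * (p * x) ^+ 2 * T ^+ 2 -> False.
Proof.
move=> t0 c0 d0 p0 x0 r0; set a := (delta / 4 / p) ^+ 2; set K := t * c ^+ 2.
move=> epsE Tle ineq.
have a0 : 0 < a by rewrite exprn_gt0 // !divr_gt0.
have K0 : 0 <= K by rewrite mulr_ge0 ?sqr_ge0.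
have K1 : 0 < K + 1 by rewrite ltr_wpDl.
have T2 : T ^+ 2 <= (c * (p * x * (r * eps))) ^+ 2.
  rewrite -[T ^+ 2]real_normK ?num_real //; apply: lerXn2r => //; rewrite nnegrE //.
  exact: le_trans (normr_ge0 T) Tle.
have : (r * x * (delta / 4)) ^+ 4 <=
    t * r ^+ 2 * (p * x) ^+ 2 * (c * (p * x * (r * eps))) ^+ 2.
  apply: le_trans ineq _; apply: ler_wpM2l T2.
  apply: mulr_ge0; last exact: sqr_ge0.
  by apply: mulr_ge0 => //; exact: sqr_ge0.
have pn0 : p != 0 by rewrite gt_eqF.
have -> : (r * x * (delta / 4)) ^+ 4 = (r * (p * x)) ^+ 4 * a ^+ 2.
  by rewrite /a; field.
have -> : t * r ^+ 2 * (p * x) ^+ 2 * (c * (p * x * (r * eps))) ^+ 2 =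
  (r * (p * x)) ^+ 4 * (K * eps ^+ 2) by rewrite /K; ring.
rewrite ler_pM2l; last by rewrite exprn_gt0 // mulr_gt0 // mulr_gt0.
apply/negP; rewrite -ltNge epsE expr_div_n.
rewrite mulrA ltr_pdivrMr ?exprn_gt0 // mulrC ltr_pM2l ?exprn_gt0 //;
  last by rewrite !divr_gt0.
by rewrite expr2; move: (K) K0 => k; nra.
Qed.

(** * The contradiction *)

Section Contradiction.
Variables (R : realType) (n d : nat) (w w0 : State R n d.+1).
Local Notation C := R[i].
Local Notation S2 := (S2_ R n).
Local Notation kappa := (casimir R n).
Hypothesis w_gs : is_inf_gs w.
Hypothesis w_mag : spont_mag w <> 0.
Hypothesis w0_omega : is_omega0 w0.
Hypothesis decay : forall eps : R, 0 < eps -> exists r : R, forall x y : Pt d.+1,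
  r < distZ R x y -> (distZ R x y ^+ d)%:C%C * `|corr2 w0 x y| < eps%:C%C.

Let h X Y : R := `|complex.Re (corr2 w0 X Y)|.
Let kappa0 : 0 <= kappa. Proof. by rewrite /casimir divr_ge0. Qed.

Lemma correlation_decay (eps : R) : 0 < eps -> exists r0 : nat, forall k (q : Box d.+1 k),
  \sum_(f : Box d.+1 k) h (pt q) (pt f) <=
  d.+1%:R * ((k.*2.+2)%:R * (3 ^+ d * eps) + (kappa + 1) * (r0.*2.+1)%:R ^+ d.+1).
Proof.
move=> e0; have [r1 hr1] := decay e0; have [r0 hr0] := exists_large r1.
exists r0 => k q; apply: (@correlation_sum R d _ q) => [||f|f|f i far].
- exact: ltW.
- by rewrite addr_ge0.
- exact: normr_ge0.
- exact: corr2_bounded.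
have gd := gap_distZ R q f i.
have /hr1 : r1 < distZ R (pt q) (pt f) by apply: lt_le_trans gd; apply: hr0; exact: ltnW.
rewrite /h; move: (corr2 _ _ _) (distZ _ _ _) gd => z l gd lz.
have le : (l ^+ d)%:C%C * (`|complex.Re z|)%:C%C < eps%:C%C.
  apply: le_lt_trans lz; apply: ler_wpM2l; last exact: normc_ge_Re.
  by rewrite lecR exprn_ge0 // (le_trans _ gd).
move: le; rewrite -rmorphM ltcR => /ltW; apply: le_trans.
apply: ler_wpM2r => //; apply: lerXn2r; rewrite ?nnegrE //.
exact: le_trans gd.
Qed.

(** The scale r depends on eps alone; the bound on the field and the volume are left open until r is
    known. In the constant, 4 * 3^d comes from far correlations in a box of side 4r, the first 1
    from near ones, which are below r eps for large r, and the last 1 from the finite-volume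
    error. *)
Lemma transverse_order_small (eps : R) : 0 < eps -> exists2 r : nat, (0 < r)%N &
  forall (b : R) (M : R -> nat), 0 < b -> exists (B : R) (m : nat) (P : Op R n d.+1 m),
    [/\ 0 < B, B < b, (maxn (M B) (2 * r) <= m)%N, is_gs_proj (Hp n d.+1 m B) P &
     `|gs_val P (transverse n (@parity d.+1 m) (@cutoff R d m r) *m
                 transverse n (@parity d.+1 m) (@cutoff R d m r))| <=
     (d.+1%:R * (4 * 3 ^+ d + 1) + 1) * ((4 * r%:R) ^+ d.+1 * (r%:R * eps))].
Proof.
move=> e0; have [r0 hr0] := correlation_decay e0.
have [r1 hr1] := exists_large ((kappa + 1) * (r0.*2.+1)%:R ^+ d.+1 / eps).
pose r := r1.+1; exists r => // b M b0.
have re : (kappa + 1) * (r0.*2.+1)%:R ^+ d.+1 <= r%:R * eps.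
  by rewrite -ler_pdivrMr //; apply/ltW/hr1.
pose k := (2 * r).-1; pose s : R := (4 * r%:R) ^+ d.+1.
have kE : (k.*2.+2 = 4 * r)%N by rewrite /k; lia.
have sE : #|{: Box d.+1 k}|%:R = s by rewrite card_box kE natrX natrM.
have s0 : 0 < s by rewrite exprn_gt0 // mulr_gt0 // ltr0n.
(* The error allowed per pair: summed over the s sites of the box it gives r eps. *)
have e1 : 0 < r%:R * eps / s by rewrite divr_gt0 // mulr_gt0 // ltr0n.
have [B [m [P [B0 Bb Mm gsP near]]]] := omega0_approximation
  (fun p : Box d.+1 k * Box d.+1 k => pt p.1) (fun p => pt p.2)
  (fun B => maxn (M B) (2 * r)) w0_omega e1 b0.
have rm : (2 * r <= m)%N by apply: leq_trans Mm; exact: leq_maxr.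
exists B, m, P; split=> //.
have gsH := gsP; rewrite Hp_ham in gsH; have gsr := gs_rstate (dagH n d m B) gsH.
have c0 x : 0 <= @cutoff R d m r x by rewrite /cutoff.
apply: le_trans (transverse_sqr_le (@parity d.+1 m) gsr c0) _.
have km : (k <= m)%N by rewrite /k; lia.
rewrite /cutoff -/k sum_inbox //; under eq_bigr => q _ do rewrite sum_inbox //.
have row (q : Box d.+1 k) : \sum_(f : Box d.+1 k)
    `|gs_val P (S2 (box_of m (pt q)) *m S2 (box_of m (pt f)))| <=
    (d.+1%:R * (4 * 3 ^+ d + 1) + 1) * (r%:R * eps).
  apply: (@le_trans _ _ (\sum_(f : Box d.+1 k) (h (pt q) (pt f) + r%:R * eps / s))).
    apply: ler_sum => f _; have := near (q, f); rewrite /h /=.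
    move: (gs_val _ _) (complex.Re _) (_ / s) => x y c xy.
    by have := ler_normD (x - y) y; rewrite subrK => /le_trans; apply; lra.
  rewrite big_split /= sumr_const -[_ *+ #|_|]mulr_natl sE [s * _]mulrC divfK ?gt_eqF //.
  rewrite [leRHS]mulrDl mul1r; apply: lerD => //; apply: le_trans (hr0 k q) _.
  rewrite kE natrM -[leRHS]mulrA; apply: ler_wpM2l => //.
  rewrite [leRHS]mulrDl mul1r; apply: lerD => //.
  by rewrite le_eqVlt; apply/orP; left; apply/eqP; ring.
apply: le_trans (ler_sum _ (fun q _ => row q)) _.
by rewrite sumr_const -[_ *+ #|_|]mulr_natl sE mulrCA.
Qed.

Lemma no_fast_decay : False.
Proof.
have [delta d0 many] := limn_sup_neq0 w_mag.
pose c4 : R := d.+1%:R * (4 * 3 ^+ d + 1) + 1.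
have c40 : 0 <= c4.
  by rewrite /c4; repeat first [done | apply: mulr_ge0 | apply: addr_ge0 | apply: exprn_ge0].
pose C0 : R := 1 + 36 * (d.+1 ^ 2)%:R * kappa.
have p0 : 0 < 2 ^+ d.+1 :> R by rewrite exprn_gt0.
(* The value required by [quartic_contradiction]; it does not involve r, so it may be fixed before
   r. *)
pose eps := (delta / 4 / 2 ^+ d.+1) ^+ 2 / (torus_const R n d * c4 ^+ 2 + 1).
have e0 : 0 < eps.
  rewrite divr_gt0 //; first by rewrite exprn_gt0 // !divr_gt0.
  by rewrite ltr_wpDl // mulr_ge0 ?sqr_ge0 // torus_const_ge0.
have [r r0 small] := transverse_order_small e0.
have rr0 : 0 < r%:R :> R by rewrite ltr0n.
have b0 : 0 < (r%:R ^+ 2)^-1 :> R by rewrite invr_gt0 exprn_gt0.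
(* The volume for which the boundary cost leaves at least delta / 4 of the magnetisation; it grows
   as B decreases. *)
have large (B : R) : exists N : nat, forall m, (N <= m)%N ->
    C0 / (B * (delta / 4)) < (m.*2.+2)%:R.
  have [N hN] := exists_large (C0 / (B * (delta / 4))); exists N => m Nm.
  by apply: hN; apply: leq_trans Nm _; clear; lia.
have [M hM] := boolp.choice large.
have [B [m [P [B0 Bb mM gsP T]]]] := small _ M b0.
have [Mm rm] : (M B <= m)%N /\ (2 * r <= m)%N by apply/andP; rewrite -geq_max.
have Br : B * r%:R ^+ 2 <= 1.
  by rewrite -ler_pdivlMr ?exprn_gt0 // mul1r ltW.
have mag0 : 0 <= delta / 4 by rewrite divr_ge0 // ltW.
have mag := le_trans (half_magnetisation d0 B0 (ltr0Sn R _) (hM B m Mm))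
  (finite_volume_magnetisation w_gs d0 many B0 gsP).
have x0 : 0 < (2 * r%:R) ^+ d.+1 :> R by rewrite exprn_gt0 // mulr_gt0.
have := torus_bound r0 rm (ltW B0) Br gsP mag0 mag.
have e4 : 4 * r%:R = 2 * (2 * r%:R) :> R by ring.
move: T; rewrite e4 [(2 * (2 * _)) ^+ _]exprMn.
exact: quartic_contradiction (torus_const_ge0 R n d) c40 d0 p0 x0 rr0 erefl.
Qed.

End Contradiction.

Theorem theorem2p3 (R : realType) (n d : nat) (hn : (0 < n)%N) (hd : (2 <= d)%N) :
  (exists w : State R n d, is_inf_gs w /\ spont_mag w <> 0) ->
  forall w0 : State R n d, is_omega0 w0 ->
  ~ (forall eps : R, 0 < eps -> exists r : R, forall x y : Pt d,
       r < distZ R x y ->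
       (distZ R x y ^+ (d - 1))%:C%C * `|corr2 w0 x y| < eps%:C%C).
Proof.
case: d hd => // d _ [w [w_gs w_mag]] w0 w0_omega decay.
apply: (no_fast_decay w_gs w_mag w0_omega) => eps /decay [r h].
by exists r => x y /h; rewrite subSS subn0.
Qed.
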